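(* Let $(\mathcal{A},\varphi)$ be a non-commutative probability space (a unital complex algebra with a unital linear functional $\varphi$), let $d\ge1$, let $I,J$ be disjoint index sets, and let $\{[Z_{k;i,j}]\}_{k\in I}\cup\{[Z_{k;i,j}]\}_{k\in J}\subseteq\mathcal{M}_d(\mathcal{A})$. Then the pair $(\{[Z_{k;i,j}]\}_{k\in I},\{[Z_{k;i,j}]\}_{k\in J})$ is $R$-cyclic if and only if $(\{L([Z_{k;i,j}])\}_{k\in I},\{R([Z_{k;i,j}])\}_{k\in J})$ is bi-free from $(L(\mathcal{M}_d(\mathbb{C})),R(\mathcal{M}_d(\mathbb{C})^{\mathrm{op}}))$ with amalgamation over $\mathcal{D}_d$ with respect to $F\circ E_d$.
   Context: All algebras are unital over $\mathbb{C}$. A $B$-$B$-non-commutative probability space is a triple $(\mathcal{A},E,\varepsilon)$ where $\mathcal{A}$ is a unital algebra, $\varepsilon:B\otimes B^{\mathrm{op}}\to\mathcal{A}$ is a unital homomorphism injective on $B\otimes 1_B$ and on $1_B\otimes B^{\mathrm{op}}$, and $E:\mathcal{A}\to B$ is linear with $E(1_{\mathcal A})=1_B$, $E(\varepsilon(b_1\otimes b_2)Z)=b_1E(Z)b_2$ and $E(Z\varepsilon(b\otimes1_B))=E(Z\varepsilon(1_B\otimes b))$. Write $L_b=\varepsilon(b\otimes1_B)$, $R_b=\varepsilon(1_B\otimes b)$, $\mathcal{A}_\ell=\{Z: ZR_b=R_bZ\ \forall b\in B\}$, $\mathcal{A}_r=\{Z: ZL_b=L_bZ\ \forall b\in B\}$.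 For $B=\mathbb{C}$ this is just a non-commutative probability space and $\mathcal{A}_\ell=\mathcal{A}_r=\mathcal{A}$. Bi-non-crossing partitions. For $\chi:\{1,\ldots,n\}\to\{\ell,r\}$ with $\chi^{-1}(\ell)=\{k_1<\cdots<k_p\}$, $\chi^{-1}(r)=\{k_{p+1}>\cdots>k_n\}$, put $s_\chi(q)=k_q$ and let $a\prec_\chi a'$ iff $s_\chi^{-1}(a)<s_\chi^{-1}(a')$. $BNC(\chi)$ is the set of partitions of $\{1,\ldots,n\}$ that are non-crossing for the total order $\prec_\chi$, ordered by refinement; $1_\chi$ is the one-block partition and $\mu_{BNC}$ is the Möbius function of this lattice. A $\chi$-interval is an interval for $\prec_\chi$. Moments and cumulants. For $Z_k\in\mathcal{A}_{\chi(k)}$ and $\pi\in BNC(\chi)$, $E^B_\pi(Z_1,\ldots,Z_n)\in B$ is defined recursively (independently of choices): $E^B_{1_\chi}(Z_1,\ldots,Z_n)=E(Z_1\cdots Z_n)$; if $V$ is a proper non-empty $\chi$-interval that is a union of blocks of $\pi$, $W$ is its complement, and $\beta=E^B_{\pi|_V}((Z_k)_{k\in V})$, then $E^B_\pi=\beta\,E^B_{\pi|_W}((Z_k)_{k\in W})$ if $V$ is initial for $\prec_\chi$, $E^B_\pi=E^B_{\pi|_W}((Z_k)_{k\in W})\,\beta$ if $V$ is terminal, and otherwise $E^B_\pi=E^B_{\pi|_W}((Z'_k)_{k\in W})$, where $Z'_k=Z_k$ except that for the immediate $\prec_\chi$-predecessor $p$ of $V$, $Z'_p=Z_pL_\beta$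 if $\chi(p)=\ell$ and $Z_p'=R_\beta Z_p$ if $\chi(p)=r$. The cumulants are $\kappa^B_\pi=\sum_{\sigma\le\pi}E^B_\sigma\,\mu_{BNC}(\sigma,\pi)$ and $\kappa^B_\chi:=\kappa^B_{1_\chi}$. $\kappa^{\mathbb{C}}$ denotes the case $B=\mathbb{C}$, $E=\varphi$. Bi-freeness. A pair of $B$-faces is a pair $(A_\ell,A_r)$ of unital subalgebras with $\varepsilon(B\otimes1_B)\subseteq A_\ell\subseteq\mathcal{A}_\ell$, $\varepsilon(1_B\otimes B^{\mathrm{op}})\subseteq A_r\subseteq\mathcal{A}_r$. A family $\{(A_{k,\ell},A_{k,r})\}_{k\in K}$ of pairs of $B$-faces is bi-free with amalgamation over $B$ iff $\kappa^B_\chi(Z_1,\ldots,Z_n)=0$ for all $n$, $\chi$, all non-constant $\epsilon:\{1,\ldots,n\}\to K$ and all $Z_k\in A_{\epsilon(k),\chi(k)}$. For families of elements of $\mathcal{A}_\ell$ and $\mathcal{A}_r$, bi-freeness refers to the pair of faces they generate together with $\varepsilon(B\otimes1_B)$ and $\varepsilon(1_B\otimes B^{\mathrm{op}})$ respectively. Matrices. Let $\mathcal{L}(\mathcal{M}_d(\mathcal{A}))$ be the algebra of linear maps on $\mathcal{M}_d(\mathcal{A})$. For $[Z_{i,j}]\in\mathcal{M}_d(\mathcal{A})$ define $L([Z_{i,j}])[T_{i,j}]=[\sum_kZ_{i,k}T_{k,j}]$ and $R([Z_{i,j}])[T_{i,j}]=[\sum_kZ_{k,j}T_{i,k}]$;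 for scalar matrices $a\in\mathcal{M}_d(\mathbb{C})\subseteq\mathcal{M}_d(\mathcal A)$ put $L_a=L(a)$, $R_a=R(a)$. With $\varepsilon(a\otimes a')=L_aR_{a'}$ and $E_d(T)=[\varphi((T(I_d))_{i,j})]$, $(\mathcal{L}(\mathcal{M}_d(\mathcal{A})),E_d,\varepsilon)$ is an $\mathcal{M}_d(\mathbb{C})$-$\mathcal{M}_d(\mathbb{C})$-non-commutative probability space. $\mathcal{D}_d\subseteq\mathcal{M}_d(\mathbb{C})$ is the subalgebra of diagonal matrices and $F:\mathcal{M}_d(\mathbb{C})\to\mathcal{D}_d$ the conditional expectation onto the diagonal; bi-freeness over $\mathcal{D}_d$ is taken in the $\mathcal{D}_d$-$\mathcal{D}_d$-non-commutative probability space $(\mathcal{L}(\mathcal{M}_d(\mathcal{A})),F\circ E_d,\varepsilon|_{\mathcal{D}_d\otimes\mathcal{D}_d^{\mathrm{op}}})$. $R$-cyclic. For $\omega:\{1,\ldots,n\}\to I\sqcup J$ let $\chi_\omega(k)=\ell$ if $\omega(k)\in I$ and $r$ if $\omega(k)\in J$. The pair $(\{[Z_{k;i,j}]\}_{k\in I},\{[Z_{k;i,j}]\}_{k\in J})$ is $R$-cyclic if for every $n\ge1$, $\omega:\{1,\ldots,n\}\to I\sqcup J$ (with $\chi=\chi_\omega$) and $1\le i_1,\ldots,i_n,j_1,\ldots,j_n\le d$, $\kappa^{\mathbb{C}}_{\chi}(Z_{\omega(1);i_1,j_1},\ldots,Z_{\omega(n);i_n,j_n})=0$ whenever at least one of the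 equalities $j_{s_\chi(1)}=i_{s_\chi(2)},\ j_{s_\chi(2)}=i_{s_\chi(3)},\ldots,\ j_{s_\chi(n-1)}=i_{s_\chi(n)},\ j_{s_\chi(n)}=i_{s_\chi(1)}$ fails. *)

(* Defs.v *)
From HB Require Import structures.
From mathcomp Require Import all_boot all_order all_algebra.
From mathcomp Require Import boolp classical_sets reals.
From mathcomp Require Import complex.

Set Implicit Arguments.
Unset Strict Implicit.
Unset Printing Implicit Defensive.

Import GRing.Theory.
Local Open Scope ring_scope.

(* A map [chi : 'I_n -> bool] encodes {1, .., n} -> {l, r}: [chi k] is true
   when k is a left index.  Indices are shifted by one, as usual for ['I_n]. *)

Section BiNonCrossing.
Variables (n : nat) (chi : 'I_n -> bool).

Definition schi_seq : seq 'I_n :=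
  [seq k <- enum 'I_n | chi k] ++ rev [seq k <- enum 'I_n | ~~ chi k].

Definition schi (q : 'I_n) : 'I_n := nth q schi_seq q.

Definition chi_lt (a b : 'I_n) : bool :=
  (index a schi_seq < index b schi_seq)%N.

Lemma mem_schi_seq k : k \in schi_seq.
Proof.
have kE := mem_enum 'I_n k.
by rewrite mem_cat mem_rev (mem_filter chi) (mem_filter (predC chi)) kE !andbT orbN.
Qed.

Lemma schi_seq_uniq : uniq schi_seq.
Proof.
have eU := enum_uniq 'I_n.
rewrite cat_uniq rev_uniq !(filter_uniq _ eU) andbT /=.
by apply/hasPn => k; rewrite mem_rev (mem_filter (predC chi)) (mem_filter chi) => /andP[/negbTE /= ->].
Qed.

Lemma size_schi_seq : size schi_seq = n.
Proof.
rewrite size_cat size_rev !size_filter.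
by rewrite [X in (_ + X)%N](_ : _ = count (predC chi) (enum 'I_n)) //
  count_predC size_enum_ord.
Qed.

Lemma index_schi (q : 'I_n) : index (schi q) schi_seq = q.
Proof. by rewrite index_uniq ?size_schi_seq ?schi_seq_uniq. Qed.

Lemma schi_inj : injective schi.
Proof. by move=> p q epq; apply/val_inj; rewrite /= -!index_schi epq. Qed.

Lemma chi_lt_schi (p q : 'I_n) : chi_lt (schi p) (schi q) = (p < q)%N.
Proof. by rewrite /chi_lt !index_schi. Qed.

Definition noncrossing (pi : {set {set 'I_n}}) : bool :=
  [forall V in pi, forall W in pi, (V != W) ==>
    ~~ [exists a in V, exists b in W, exists c in V, exists d in W,
         [&& chi_lt a b, chi_lt b c & chi_lt c d]]].

Definition BNC : {set {set {set 'I_n}}} :=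
  [set pi | finset.partition pi [set: 'I_n] && noncrossing pi].

End BiNonCrossing.

Definition refines n (sigma pi : {set {set 'I_n}}) : bool :=
  [forall V in sigma, exists W in pi, V \subset W].

Section Moebius.
Variables (T : finType) (P : {set T}) (le : rel T).

(* The first argument is fuel; [moebiusE] is the defining recursion. *)
Fixpoint moebius_rec (m : nat) (x y : T) : int :=
  if x == y then 1 else
  if m is m'.+1 then
    - \sum_(z in P | [&& le x z, le z y & z != y]) moebius_rec m' x z
  else 0.

Definition moebius : T -> T -> int := moebius_rec #|P|.

Hypotheses (le_refl : {in P, reflexive le}) (le_trans : {in P & &, transitive le}).
Hypothesis le_anti : {in P &, antisymmetric le}.

Let down y := [set z in P | le z y && (z != y)].

Let down_lt y z : y \in P -> z \in down y -> (#|down z| < #|down y|)%N.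
Proof.
move=> yP; rewrite inE => /and3P[zP zy nzy]; apply: proper_card.
apply/properP; split; last by exists z; rewrite ?inE ?zP ?zy ?nzy // eqxx !andbF.
apply/fintype.subsetP=> t; rewrite !inE => /and3P[tP tz ntz]; rewrite tP /=.
rewrite (le_trans zP tP yP tz zy) /=; apply: contraNneq ntz => ety.
by apply/eqP/le_anti; rewrite // tz ety zy.
Qed.

Let moebius_fuel m m' x y : x \in P -> y \in P ->
  (#|down y| <= m)%N -> (#|down y| <= m')%N ->
  le x y -> moebius_rec m x y = moebius_rec m' x y.
Proof.
have down0 u v : u \in P -> (#|down v| <= 0)%N -> le u v -> u == v.
  move=> uP; rewrite leqn0 cards_eq0 => /eqP d0 uv; apply: contraT => nuv.
  have : u \in down v by rewrite inE uP uv nuv.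
  by rewrite d0 inE.
elim: m m' y => [|m IH] [|m'] y xP yP.
- by [].
- by move=> y0 _ /(down0 _ _ xP y0) /= ->.
- by move=> _ y0 /(down0 _ _ xP y0) /= ->.
move=> ym ym' xy /=; case: eqP => // _; congr (- _).
apply: eq_bigr => z /andP[zP /and3P[xz zy nzy]].
have zd : z \in down y by rewrite inE zP zy nzy.
have lt_zy := down_lt yP zd.
by apply: IH => //; rewrite -ltnS; apply: leq_trans lt_zy _.
Qed.

Lemma moebiusE x y : x \in P -> y \in P -> le x y ->
  moebius x y = if x == y then 1 else
    - \sum_(z in P | [&& le x z, le z y & z != y]) moebius x z.
Proof.
move=> xP yP xy; rewrite /moebius; case cP: #|P| => [|m] /=.
  by move/eqP: cP; rewrite cards_eq0 => /eqP P0; rewrite P0 inE in xP.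
case: eqP => // _; congr (- _); apply: eq_bigr => z /andP[zP /and3P[xz zy nzy]].
have zd : z \in down y by rewrite inE zP zy nzy.
have hz : (#|down z| <= m)%N.
  rewrite -ltnS -cP; apply: leq_trans (down_lt yP zd) _.
  by apply: subset_leq_card; apply/fintype.subsetP=> t; rewrite inE => /andP[].
rewrite -[RHS]/(moebius_rec m.+1 x z).
by apply: moebius_fuel => //; apply: leq_trans hz _.
Qed.

End Moebius.

(* The homomorphism eps : B (x) B^op -> A is given by the pair of maps
   L_b = eps (b (x) 1), R_b = eps (1 (x) b): a unital homomorphism, resp.
   anti-homomorphism, with commuting ranges, eps (b (x) b') being
   L_b * R_b'. *)

Record bb_space (K : fieldType) (B A : algType K) := BBSpace {
  bbL : {lrmorphism B -> A};
  bbR : {linear B -> A};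
  bbR1 : bbR 1 = 1;
  bbRM : forall b b', bbR (b * b') = bbR b' * bbR b;
  bbLRC : forall b b', bbL b * bbR b' = bbR b' * bbL b;
  bbL_inj : injective bbL;
  bbR_inj : injective bbR;
  bbE : {linear A -> B};
  bbE1 : bbE 1 = 1;
  bbEM : forall b b' Z, bbE (bbL b * bbR b' * Z) = b * bbE Z * b';
  bbELR : forall Z b, bbE (Z * bbL b) = bbE (Z * bbR b)
}.

Section Cumulants.
Variables (K : fieldType) (B A : algType K) (S : bb_space B A).

Section Moments.
Variables (n : nat) (chi : 'I_n -> bool).

Definition chi_interval (U V : {set 'I_n}) : bool :=
  (V \subset U) && [forall a in V, forall c in V, forall b in U,
                      (chi_lt chi a b && chi_lt chi b c) ==> (b \in V)].

Definition chi_initial (U V : {set 'I_n}) : bool :=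
  [forall v in V, forall w in U :\: V, chi_lt chi v w].

Definition chi_terminal (U V : {set 'I_n}) : bool :=
  [forall v in V, forall w in U :\: V, chi_lt chi w v].

Definition chi_pred (U V : {set 'I_n}) (p : 'I_n) : bool :=
  [&& p \in U :\: V, [forall v in V, chi_lt chi p v] &
      [forall w in U :\: V, chi_lt chi p w ==> [forall v in V, chi_lt chi v w]]].

Definition absorb (beta : B) (p : 'I_n) (Z : 'I_n -> A) : 'I_n -> A :=
  fun k => if k == p then
    (if chi p then Z p * bbL S beta else bbR S beta * Z p) else Z k.

(* The value of E_pi (Z_1, .., Z_n) does not depend on which union of blocks
   is split off at each step, provided it is a proper chi-interval; here it is
   a single block, so that its own moment is [bbE S] of an ordered product.
   Restrictions are computed in place: [pi] is a partition of [cover pi], and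
   only the values of [Z] on [cover pi] matter.  A non-crossing partition
   with at least two blocks always has such a block; the branch [None] of the
   first match is the one-block case.  [m] is fuel. *)
Fixpoint moment_rec (m : nat) (pi : {set {set 'I_n}}) (Z : 'I_n -> A) : B :=
  let U := finset.cover pi in
  if m is m'.+1 then
    match [pick V in pi | (V != U) && chi_interval U V] with
    | Some V =>
        let beta := bbE S (\prod_(k in V) Z k) in
        let rest := moment_rec m' (pi :\ V) in
        if chi_initial U V then beta * rest Z
        else if chi_terminal U V then rest Z * beta
        else match [pick p | chi_pred U V p] with
             | Some p => rest (absorb beta p Z)
             | None => 0
             end
    | None => bbE S (\prod_(k in U) Z k)
    end
  else bbE S (\prod_(k in U) Z k).

Definition moment (pi : {set {set 'I_n}}) : ('I_n -> A) -> B :=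
  moment_rec #|pi| pi.

Lemma moment1 Z : moment [set [set: 'I_n]] Z = bbE S (\prod_k Z k).
Proof.
rewrite /moment cards1 /= /finset.cover big_set1; case: pickP => [V|_].
  by rewrite !inE; case: eqP.
by congr (bbE S _); apply: eq_bigl => k; rewrite inE.
Qed.

Definition cumulant (pi : {set {set 'I_n}}) (Z : 'I_n -> A) : B :=
  \sum_(sigma in BNC chi | refines sigma pi)
    moment sigma Z *~ moebius (BNC chi) (@refines n) sigma pi.

Definition cumulant1 : ('I_n -> A) -> B := cumulant [set [set: 'I_n]].

End Moments.

Local Open Scope classical_set_scope.

Definition left_comm : set A := [set Z | forall b, Z * bbR S b = bbR S b * Z].
Definition right_comm : set A := [set Z | forall b, Z * bbL S b = bbL S b * Z].

Definition is_subalg (X : set A) : Prop :=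
  [/\ X 1, forall (c : K) x y, X x -> X y -> X (c *: x + y) &
      forall x y, X x -> X y -> X (x * y)].

Record face_pair := FacePair {
  lface : set A;
  rface : set A;
  lface_subalg : is_subalg lface;
  rface_subalg : is_subalg rface;
  lface_sub : range (bbL S) `<=` lface /\ lface `<=` left_comm;
  rface_sub : range (bbR S) `<=` rface /\ rface `<=` right_comm
}.

Definition bifree (I : Type) (F : I -> face_pair) : Prop :=
  forall (n : nat) (chi : 'I_n -> bool) (e : 'I_n -> I) (Z : 'I_n -> A),
    (exists k k', e k <> e k') ->
    (forall k, (if chi k then lface (F (e k)) else rface (F (e k))) (Z k)) ->
    cumulant1 chi Z = 0.

Definition bifree2 (F G : face_pair) : Prop :=
  bifree (fun b : bool => if b then F else G).

Definition gen_subalg (X : set A) : set A := smallest is_subalg X.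

Lemma gen_subalg_subalg X : is_subalg (gen_subalg X).
Proof.
split=> [Y [[Y1 _ _] _] //|c x y Xx Xy Y YP|x y Xx Xy Y YP];
  have [[_ YD YM] _] := YP; [apply: YD|apply: YM];
  by [apply: Xx YP|apply: Xy YP].
Qed.

Lemma left_comm_subalg : is_subalg left_comm.
Proof.
split=> [b|c x y Hx Hy b|x y Hx Hy b]; first by rewrite mul1r mulr1.
- by rewrite mulrDl mulrDr -scalerAl -scalerAr Hx Hy.
- by rewrite -mulrA Hy mulrA Hx mulrA.
Qed.

Lemma right_comm_subalg : is_subalg right_comm.
Proof.
split=> [b|c x y Hx Hy b|x y Hx Hy b]; first by rewrite mul1r mulr1.
- by rewrite mulrDl mulrDr -scalerAl -scalerAr Hx Hy.
- by rewrite -mulrA Hy mulrA Hx mulrA.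
Qed.

Lemma gen_lface_sub X : X `<=` left_comm ->
  range (bbL S) `<=` gen_subalg (range (bbL S) `|` X) /\
  gen_subalg (range (bbL S) `|` X) `<=` left_comm.
Proof.
move=> XL; split=> [x Lx Y [_ XY]|x]; first by apply: XY; left.
apply; split; first exact: left_comm_subalg.
by rewrite subUset; split=> // _ [b _ <-] b'; rewrite bbLRC.
Qed.

Lemma gen_rface_sub X : X `<=` right_comm ->
  range (bbR S) `<=` gen_subalg (range (bbR S) `|` X) /\
  gen_subalg (range (bbR S) `|` X) `<=` right_comm.
Proof.
move=> XR; split=> [x Rx Y [_ XY]|x]; first by apply: XY; left.
apply; split; first exact: right_comm_subalg.
by rewrite subUset; split=> // _ [b _ <-] b'; rewrite bbLRC.
Qed.

Definition gen_faces (X Y : set A) (XL : X `<=` left_comm)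
    (YR : Y `<=` right_comm) : face_pair :=
  FacePair (gen_subalg_subalg _) (gen_subalg_subalg _)
    (gen_lface_sub XL) (gen_rface_sub YR).

End Cumulants.

Section Scalar.
Variables (K : fieldType) (A : algType K).
Variables (phi : {linear A -> K^o}) (phi1 : phi 1 = 1).

Definition scal_in (b : K^o) : A := b%:A.

Fact scal_in_linear : linear scal_in.
Proof. by move=> c x y; rewrite /scal_in scalerDl scalerA. Qed.
HB.instance Definition _ := GRing.isLinear.Build K K^o A *:%R scal_in scal_in_linear.

Fact scal_in_monoid : monoid_morphism scal_in.
Proof. by split=> [|x y]; rewrite /scal_in ?scale1r // -scalerAl mul1r scalerA. Qed.
HB.instance Definition _ := GRing.isMonoidMorphism.Build K^o A scal_in scal_in_monoid.

Fact scal_in1 : scal_in 1 = 1. Proof. exact: scale1r. Qed.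

Fact scal_inM (b b' : K^o) : scal_in (b * b') = scal_in b' * scal_in b.
Proof. by rewrite mulrC rmorphM. Qed.

Fact scal_inC (b b' : K^o) : scal_in b * scal_in b' = scal_in b' * scal_in b.
Proof. by rewrite -!rmorphM mulrC. Qed.

Fact scal_in_inj : injective scal_in.
Proof. by move=> x y /eqP; rewrite (inj_eq (fmorph_inj (in_alg A))) => /eqP. Qed.

Fact phiM (b b' : K^o) Z : phi (scal_in b * scal_in b' * Z) = b * phi Z * b'.
Proof.
by rewrite -rmorphM /scal_in -scalerAl mul1r linearZ /= -mulrA [phi Z * b']mulrC mulrA.
Qed.

Definition scalar_space : bb_space K^o A :=
  @BBSpace K K^o A scal_in scal_in scal_in1 scal_inM scal_inC scal_in_inj scal_in_inj
    phi phi1 phiM (fun _ _ => erefl).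

End Scalar.

(* ['M[A]_d] carries a canonical module structure over [A] only; [mxK] is a
   copy of it that is a module over the base field. *)
Definition mxK (K : fieldType) (A : algType K) (d : nat) : Type := 'M[A]_d.+1.

Section MatrixModule.
Variables (K : fieldType) (A : algType K) (d : nat).
Local Notation V := (mxK A d).

HB.instance Definition _ := GRing.Zmodule.copy V 'M[A]_d.+1.

Definition mxK_scale (c : K) (M : V) : V := map_mx (fun x : A => c *: x) M.

Fact mxK_scaleA a b (M : V) : mxK_scale a (mxK_scale b M) = mxK_scale (a * b) M.
Proof. by apply/matrixP=> i j; rewrite !mxE scalerA. Qed.
Fact mxK_scale1 : left_id 1 mxK_scale.
Proof. by move=> M; apply/matrixP=> i j; rewrite !mxE scale1r. Qed.
Fact mxK_scaleDr : right_distributive mxK_scale +%R.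
Proof. by move=> c M N; apply/matrixP=> i j; rewrite !mxE scalerDr. Qed.
Fact mxK_scaleDl M : {morph mxK_scale^~ M : a b / a + b}.
Proof. by move=> a b; apply/matrixP=> i j; rewrite !mxE scalerDl. Qed.
HB.instance Definition _ := GRing.Zmodule_isLmodule.Build K V
  mxK_scaleA mxK_scale1 mxK_scaleDr mxK_scaleDl.

Record mxop := MxOp { mxop_fun :> V -> V; mxop_linear : linear mxop_fun }.

HB.instance Definition _ := gen_eqMixin mxop.
HB.instance Definition _ := gen_choiceMixin mxop.
HB.instance Definition _ (T : mxop) :=
  GRing.isLinear.Build K V V *:%R (mxop_fun T) (mxop_linear T).

Lemma mxopP (S T : mxop) : S =1 T -> S = T.
Proof.
case: S T => [f Hf] [g Hg] /= /funext fg; subst g.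
by rewrite (Prop_irrelevance Hf Hg).
Qed.

Definition mxop_add (S T : mxop) : mxop := MxOp (linearP (S \+ T)).
Definition mxop_opp (S : mxop) : mxop := MxOp (linearP (\- S)).
Definition mxop_zero : mxop := MxOp (linearP (\0 : V -> V)).
Definition mxop_scale (c : K) (S : mxop) : mxop := MxOp (linearP (c \*: S)).
Definition mxop_one : mxop := MxOp (linearP (idfun : V -> V)).
Definition mxop_mul (S T : mxop) : mxop := MxOp (linearP (S \o T)).

Fact mxop_addA : associative mxop_add.
Proof. by move=> S T U; apply/mxopP=> M /=; rewrite addrA. Qed.
Fact mxop_addC : commutative mxop_add.
Proof. by move=> S T; apply/mxopP=> M /=; rewrite addrC. Qed.
Fact mxop_add0 : left_id mxop_zero mxop_add.
Proof. by move=> S; apply/mxopP=> M /=; rewrite add0r. Qed.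
Fact mxop_addN : left_inverse mxop_zero mxop_opp mxop_add.
Proof. by move=> S; apply/mxopP=> M /=; rewrite addNr. Qed.
HB.instance Definition _ :=
  GRing.isZmodule.Build mxop mxop_addA mxop_addC mxop_add0 mxop_addN.

Fact mxop_mulA : associative mxop_mul.
Proof. by move=> S T U; apply/mxopP. Qed.
Fact mxop_mul1l : left_id mxop_one mxop_mul.
Proof. by move=> S; apply/mxopP. Qed.
Fact mxop_mul1r : right_id mxop_one mxop_mul.
Proof. by move=> S; apply/mxopP. Qed.
Fact mxop_mulDl : left_distributive mxop_mul +%R.
Proof. by move=> S T U; apply/mxopP. Qed.
Fact mxop_mulDr : right_distributive mxop_mul +%R.
Proof. by move=> S T U; apply/mxopP=> M /=; rewrite linearD. Qed.
Fact mxop_1neq0 : mxop_one != 0.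
Proof.
apply/eqP=> /(congr1 (fun T : mxop => T (1%:M : 'M[A]_d.+1))) /matrixP.
by move=> /(_ ord0 ord0) /eqP; rewrite /= !mxE eqxx oner_eq0.
Qed.
HB.instance Definition _ := GRing.Zmodule_isNzRing.Build mxop
  mxop_mulA mxop_mul1l mxop_mul1r mxop_mulDl mxop_mulDr mxop_1neq0.

Fact mxop_scaleA a b S : mxop_scale a (mxop_scale b S) = mxop_scale (a * b) S.
Proof. by apply/mxopP=> M /=; rewrite scalerA. Qed.
Fact mxop_scale1 : left_id 1 mxop_scale.
Proof. by move=> S; apply/mxopP=> M /=; rewrite scale1r. Qed.
Fact mxop_scaleDr : right_distributive mxop_scale +%R.
Proof. by move=> c S T; apply/mxopP=> M /=; rewrite scalerDr. Qed.
Fact mxop_scaleDl S : {morph mxop_scale^~ S : a b / a + b}.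
Proof. by move=> a b; apply/mxopP=> M /=; rewrite scalerDl. Qed.
HB.instance Definition _ := GRing.Zmodule_isLmodule.Build K mxop
  mxop_scaleA mxop_scale1 mxop_scaleDr mxop_scaleDl.

Fact mxop_scaleAl (c : K) (S T : mxop) : c *: (S * T) = c *: S * T.
Proof. exact/mxopP. Qed.
HB.instance Definition _ := GRing.Lmodule_isLalgebra.Build K mxop mxop_scaleAl.

Fact mxop_scaleAr (c : K) (S T : mxop) : c *: (S * T) = S * (c *: T).
Proof. by apply/mxopP=> M /=; rewrite [RHS]linearZ. Qed.
HB.instance Definition _ := GRing.Lalgebra_isAlgebra.Build K mxop mxop_scaleAr.

Lemma mxopE_mul (S T : mxop) M : (S * T) M = S (T M). Proof. by []. Qed.
Lemma mxopE_add (S T : mxop) M : (S + T) M = S M + T M. Proof. by []. Qed.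
Lemma mxopE_scale c (S : mxop) M : (c *: S) M = c *: S M. Proof. by []. Qed.
Lemma mxopE_one M : (1 : mxop) M = M. Proof. by []. Qed.
Lemma mxKE_scale c (M : V) i j : (c *: M : V) i j = c *: M i j.
Proof. by rewrite mxE. Qed.

Definition mxL_fun (Z : 'M[A]_d.+1) (T : V) : V := \matrix_(i, j) \sum_k Z i k * T k j.
Definition mxR_fun (Z : 'M[A]_d.+1) (T : V) : V := \matrix_(i, j) \sum_k Z k j * T i k.

Fact mxL_fun_linear Z : linear (mxL_fun Z).
Proof.
move=> c S T; apply/matrixP=> i j; rewrite !mxE scaler_sumr -big_split /=.
by apply: eq_bigr => k _; rewrite !mxE mulrDr scalerAr.
Qed.

Fact mxR_fun_linear Z : linear (mxR_fun Z).
Proof.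
move=> c S T; apply/matrixP=> i j; rewrite !mxE scaler_sumr -big_split /=.
by apply: eq_bigr => k _; rewrite !mxE mulrDr scalerAr.
Qed.

Definition mxL (Z : 'M[A]_d.+1) : mxop := MxOp (mxL_fun_linear Z).
Definition mxR (Z : 'M[A]_d.+1) : mxop := MxOp (mxR_fun_linear Z).

Lemma mxLE Z (T : V) i j : mxL Z T i j = \sum_k Z i k * T k j.
Proof. by rewrite mxE. Qed.
Lemma mxRE Z (T : V) i j : mxR Z T i j = \sum_k Z k j * T i k.
Proof. by rewrite mxE. Qed.

Definition scal_mx (a : 'M[K]_d.+1) : 'M[A]_d.+1 := map_mx (in_alg A) a.

End MatrixModule.

Section Diagonal.
Variables (K : fieldType) (d : nat).

Definition diag_pred : {pred 'M[K]_d.+1} := fun a => is_diag_mx a.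

Fact diag_subalg_closed : GRing.subalg_closed diag_pred.
Proof.
split; first exact: scalar_mx_is_diag.
- move=> c a b /is_diag_mxP ha /is_diag_mxP hb; apply/is_diag_mxP => i j nij.
  by rewrite !mxE ha // hb // mulr0 addr0.
- move=> a b /diag_mxP[u ->] /diag_mxP[v ->]; apply/diag_mxP.
  by exists (\row_j (u 0 j * v 0 j)); exact: mulmx_diag.
Qed.
HB.instance Definition _ := GRing.isSubalgClosed.Build K 'M[K]_d.+1 diag_pred
  diag_subalg_closed.

Record diagmx := DiagMx { diagmx_val :> 'M[K]_d.+1; _ : diagmx_val \in diag_pred }.
HB.instance Definition _ := [isSub for diagmx_val].
HB.instance Definition _ := [Choice of diagmx by <:].
HB.instance Definition _ := [SubChoice_isSubAlgebra of diagmx by <:].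

Definition diag_cond_exp (a : 'M[K]_d.+1) : diagmx :=
  DiagMx (diag_mx_is_diag (\row_i a i i)).

End Diagonal.

Section ScalarMatrices.
Variables (K : fieldType) (A : algType K) (d : nat).
Local Notation scal := (@scal_mx K A d).
Local Notation Op := (mxop A d).

Lemma scal_mxE a i j : scal a i j = (a i j)%:A.
Proof. by rewrite mxE. Qed.

Lemma scal_mxM a b : scal (a *m b) = scal a *m scal b.
Proof. exact: map_mxM. Qed.

Lemma scal_mx1 : scal 1%:M = 1%:M.
Proof. exact: map_mx1. Qed.

Lemma scal_mxP (c : K) a b : scal (c *: a + b) = c *: (scal a : mxK A d) + scal b.
Proof.
by apply/matrixP=> i j; rewrite !mxE !in_algE scalerDl scalerA.
Qed.

Lemma scal_mx_inj : injective scal.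
Proof.
move=> a b eab; apply/matrixP=> i j; apply: (fmorph_inj (in_alg A)).
by move/matrixP: eab => /(_ i j); rewrite !scal_mxE.
Qed.

Definition scalL (a : 'M[K]_d.+1) : Op := mxL (scal a).
Definition scalR (a : 'M[K]_d.+1) : Op := mxR (scal a).

Lemma mxLE_mul (Z : 'M[A]_d.+1) (T : 'M[A]_d.+1) : mxL Z T = Z *m T.
Proof. by apply/matrixP=> i j; rewrite !mxE. Qed.

Lemma scalLE a (T : 'M[A]_d.+1) : scalL a T = scal a *m T.
Proof. exact: mxLE_mul. Qed.

Lemma scalRE a (T : 'M[A]_d.+1) : scalR a T = T *m scal a.
Proof.
apply/matrixP=> i j; rewrite !mxE; apply: eq_bigr => k _.
by rewrite !mxE -scalerAl -scalerAr mul1r mulr1.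
Qed.

Lemma scalL_linear : linear scalL.
Proof.
move=> c a b; apply/mxopP=> T; apply/matrixP=> i j.
rewrite mxopE_add mxopE_scale /scalL scal_mxP !mxE scaler_sumr -big_split /=.
by apply: eq_bigr => k _; rewrite !mxE mulrDl scalerAl.
Qed.

Lemma scalR_linear : linear scalR.
Proof.
move=> c a b; apply/mxopP=> T; apply/matrixP=> i j.
rewrite mxopE_add mxopE_scale /scalR scal_mxP !mxE scaler_sumr -big_split /=.
by apply: eq_bigr => k _; rewrite !mxE mulrDl scalerAl.
Qed.

Lemma scalL_monoid : monoid_morphism scalL.
Proof.
split=> [|a b]; apply/mxopP=> T; rewrite ?mxopE_mul !scalLE.
  by rewrite scal_mx1 mul1mx.
by rewrite scal_mxM mulmxA.
Qed.

Lemma scalR1 : scalR 1 = 1.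
Proof. by apply/mxopP=> T; rewrite scalRE scal_mx1 mulmx1. Qed.

Lemma scalRM a b : scalR (a * b) = scalR b * scalR a.
Proof. by apply/mxopP=> T; rewrite mxopE_mul !scalRE scal_mxM mulmxA. Qed.

Lemma mxL_scalR Z b : mxL Z * scalR b = scalR b * mxL Z.
Proof. by apply/mxopP=> T; rewrite !mxopE_mul !scalRE !mxLE_mul mulmxA. Qed.

Lemma mxR_scalL Z b : mxR Z * scalL b = scalL b * mxR Z.
Proof.
apply/mxopP=> T; rewrite !mxopE_mul !scalLE; apply/matrixP=> i j; rewrite !mxE.
under eq_bigr do rewrite !mxE mulr_sumr.
under [RHS]eq_bigr do rewrite !mxE mulr_sumr.
rewrite exchange_big; apply: eq_bigr => k _; apply: eq_bigr => l _ /=.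
by rewrite mxE -!scalerAl !mul1r scalerAr.
Qed.

Lemma scalL_one a : scalL a (1%:M : 'M[A]_d.+1) = scal a.
Proof. by rewrite scalLE mulmx1. Qed.

Lemma scalR_one a : scalR a (1%:M : 'M[A]_d.+1) = scal a.
Proof. by rewrite scalRE mul1mx. Qed.

Lemma scalL_inj : injective scalL.
Proof. by move=> a b eab; apply: scal_mx_inj; rewrite -!scalL_one eab. Qed.

Lemma scalR_inj : injective scalR.
Proof. by move=> a b eab; apply: scal_mx_inj; rewrite -!scalR_one eab. Qed.

End ScalarMatrices.

Section DiagonalSpace.
Variables (K : fieldType) (A : algType K).
Variables (phi : {linear A -> K^o}) (phi1 : phi 1 = 1) (d : nat).
Local Notation D := (diagmx K d).
Local Notation Op := (mxop A d).

Definition matE (T : Op) : 'M[K]_d.+1 :=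
  \matrix_(i, j) phi ((T (1%:M : 'M[A]_d.+1) : 'M[A]_d.+1) i j).

Definition diagL (b : D) : Op := scalL A (diagmx_val b).
Definition diagR (b : D) : Op := scalR A (diagmx_val b).
Definition diagE (T : Op) : D := diag_cond_exp (matE T).

Fact diagL_linear : linear diagL.
Proof. by move=> c a b; rewrite -scalL_linear. Qed.
HB.instance Definition _ := GRing.isLinear.Build K D Op *:%R diagL diagL_linear.

Fact diagL_monoid : monoid_morphism diagL.
Proof.
have [L1 LM] := scalL_monoid A d.
by split=> [|a b]; [rewrite -L1|rewrite -LM].
Qed.
HB.instance Definition _ := GRing.isMonoidMorphism.Build D Op diagL diagL_monoid.

Fact diagR_linear : linear diagR.
Proof. by move=> c a b; rewrite -scalR_linear. Qed.
HB.instance Definition _ := GRing.isLinear.Build K D Op *:%R diagR diagR_linear.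

Fact diagE_linear : linear diagE.
Proof.
move=> c S T; apply/val_inj/matrixP=> i j /=.
by rewrite !mxE linearP mulrnDl /= mulrnAr.
Qed.
HB.instance Definition _ := GRing.isLinear.Build K Op D *:%R diagE diagE_linear.

Fact diagR1 : diagR 1 = 1. Proof. exact: scalR1. Qed.
Fact diagRM b b' : diagR (b * b') = diagR b' * diagR b.
Proof. exact: scalRM. Qed.
Fact diagLRC b b' : diagL b * diagR b' = diagR b' * diagL b.
Proof. exact: mxL_scalR. Qed.
Fact diagL_inj : injective diagL.
Proof. by move=> a b /scalL_inj /val_inj. Qed.
Fact diagR_inj : injective diagR.
Proof. by move=> a b /scalR_inj /val_inj. Qed.

Fact diagE1 : diagE 1 = 1.
Proof.
apply/val_inj/matrixP=> i j /=; rewrite !mxE eqxx phi1.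
by case: eqP.
Qed.

Fact diagEM b b' Z : diagE (diagL b * diagR b' * Z) = b * diagE Z * b'.
Proof.
have /diag_mxP[u eu] : is_diag_mx (diagmx_val b) := valP b.
have /diag_mxP[v ev] : is_diag_mx (diagmx_val b') := valP b'.
have eX : (diagL b * diagR b' * Z) (1%:M : 'M[A]_d.+1) =
    map_mx (in_alg A) (diag_mx u) *m
      ((Z (1%:M : 'M[A]_d.+1) : 'M[A]_d.+1) *m map_mx (in_alg A) (diag_mx v)).
  by rewrite /diagL /diagR eu ev !mxopE_mul scalLE scalRE.
have eM k : matE (diagL b * diagR b' * Z) k k = u 0 k * matE Z k k * v 0 k.
  rewrite [LHS]mxE [in RHS]mxE eX !map_diag_mx mul_mx_diag mul_diag_mx.
  set z := (Z _ : 'M_d.+1); rewrite !mxE /= -scalerAr mulr1 -scalerAl mul1r.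
  rewrite !linearZ /=.
  by rewrite -mulrA; congr (_ * _); exact: mulrC.
apply/val_inj/matrixP=> i j; rewrite /diagE /= -!mulmxE eu ev.
move: (matE _) (matE Z) eM => M N eM.
rewrite mul_mx_diag mul_diag_mx !mxE eM.
by case: eqP => [<-|_]; rewrite ?mulr1n // !mulr0n mulr0 mul0r.
Qed.

Fact diagELR Z b : diagE (Z * diagL b) = diagE (Z * diagR b).
Proof.
apply/val_inj/matrixP=> i j /=.
by rewrite !mxE !mxopE_mul /diagL /diagR scalL_one scalR_one.
Qed.

Definition diag_space : bb_space D Op :=
  @BBSpace K D Op diagL diagR diagR1 diagRM diagLRC diagL_inj diagR_inj
    diagE diagE1 diagEM diagELR.

Local Open Scope classical_set_scope.

Lemma mxL_left_comm (I : Type) (Z : I -> 'M[A]_d.+1) :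
  range (fun k => mxL (Z k)) `<=` left_comm diag_space.
Proof. by move=> _ [k _ <-] b; exact: mxL_scalR. Qed.

Lemma mxR_right_comm (J : Type) (Z : J -> 'M[A]_d.+1) :
  range (fun k => mxR (Z k)) `<=` right_comm diag_space.
Proof. by move=> _ [k _ <-] b; exact: mxR_scalL. Qed.

Definition matrix_faces (I J : Type) (ZI : I -> 'M[A]_d.+1) (ZJ : J -> 'M[A]_d.+1) :
    face_pair diag_space :=
  gen_faces (@mxL_left_comm I ZI) (@mxR_right_comm J ZJ).

Fact scalL_subalg : is_subalg (range (scalL A (d := d))).
Proof.
have [L1 LM] := scalL_monoid A d.
split=> [|c _ _ [a _ <-] [b _ <-]|_ _ [a _ <-] [b _ <-]].
- by exists 1.
- by exists (c *: a + b); rewrite ?scalL_linear.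
- by exists (a * b); rewrite ?LM.
Qed.

Fact scalR_subalg : is_subalg (range (scalR A (d := d))).
Proof.
split=> [|c _ _ [a _ <-] [b _ <-]|_ _ [a _ <-] [b _ <-]].
- by exists 1; rewrite ?scalR1.
- by exists (c *: a + b); rewrite ?scalR_linear.
- by exists (b * a); rewrite ?scalRM.
Qed.

Fact scalL_sub : range (bbL diag_space) `<=` range (scalL A (d := d)) /\
  range (scalL A (d := d)) `<=` left_comm diag_space.
Proof.
split=> [_ [b _ <-]|_ [a _ <-] b]; first by exists (diagmx_val b).
exact: mxL_scalR.
Qed.

Fact scalR_sub : range (bbR diag_space) `<=` range (scalR A (d := d)) /\
  range (scalR A (d := d)) `<=` right_comm diag_space.
Proof.
split=> [_ [b _ <-]|_ [a _ <-] b]; first by exists (diagmx_val b).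
exact: mxR_scalL.
Qed.

Definition scalar_faces : face_pair diag_space :=
  FacePair scalL_subalg scalR_subalg scalL_sub scalR_sub.

End DiagonalSpace.

Definition is_inl (I J : Type) (w : I + J) : bool :=
  if w is inl _ then true else false.

Definition sum_family (I J T : Type) (ZI : I -> T) (ZJ : J -> T) (w : I + J) : T :=
  match w with inl k => ZI k | inr k => ZJ k end.

Definition R_cyclic (K : fieldType) (A : algType K) (phi : {linear A -> K^o})
    (phi1 : phi 1 = 1) (d : nat) (I J : Type)
    (ZI : I -> 'M[A]_d.+1) (ZJ : J -> 'M[A]_d.+1) : Prop :=
  forall (n : nat) (omega : 'I_n -> I + J) (i j : 'I_n -> 'I_d.+1),
    (0 < n)%N ->
    let chi := fun k => is_inl (omega k) in
    (exists q : 'I_n, j (schi chi q) <> i (schi chi (ordS q))) ->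
    cumulant1 (scalar_space phi1) chi
      (fun k => sum_family ZI ZJ (omega k) (i k) (j k)) = 0.

(* Main.v *)
Require Import Defs.
From HB Require Import structures.
From mathcomp Require Import boolp classical_sets reals.
From mathcomp Require Import all_boot all_order all_algebra.
From mathcomp Require Import complex zify.

Set Implicit Arguments.
Unset Strict Implicit.
Unset Printing Implicit Defensive.

Import GRing.Theory.
Local Open Scope ring_scope.

(** Idea.  A letter L(x (x) E_ij) or R(x (x) E_ij) is an edge from i to j; read in
    the order [chi_lt], a moment over the diagonal of a word of such letters along
    a bi-non-crossing partition s is the scalar moment along s when the edges of
    the word and the edges inside each block of s form closed chains, and 0
    otherwise.  Expanding scalar moments into cumulants, the diagonal cumulant of
    the word is the sum over t of the scalar cumulant along t times the sum of
    mu(s, 1) over the s above t all of whose blocks are closed.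

    If t has an isolated block V of closed edges and V is not everything, that
    second sum is 0: closedness of s is unchanged by meeting s with the partition
    into V and the cyclic gaps of V, and a function F with F(s) = F(s /\ w), w < 1,
    satisfies sum F(s) mu(s, 1) = 0.

    Direct implication: entries of scalar matrices are multiples of 1, hence are
    singletons in every t that contributes, so that every t is of this kind.  Products of
    generators are treated as groups of consecutive letters of a longer word, and
    V is taken minimal among the unions of groups saturated by t.

    Converse: by induction on the length.  If a word of entries does not close up,
    insert a scalar matrix unit at each place where its chain breaks; the diagonal
    cumulant of the new word is 0 by bi-freeness, and by the induction hypothesis
    the only t left has the original word as a block, with coefficient 1. *)

(** Closedness is asked block by block, and in that form its behaviour under coarsening or cutting
    is not evident. For a closed word it is equivalent to a condition on arcs: whenever the open arc
    from p to q is a union of blocks, the edge p ends where the edge q begins. A coarser partition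
    has fewer such arcs, so closedness passes from the meet up to s. Downwards, cutting s along the
    gaps of V preserves closedness because V is closed and lies inside one block of s. The minimal
    choice of V supplies both facts: a saturated proper piece of V would be a smaller candidate, and
    so would a proper intersection of V with a block of s.

    All these conditions live on a circle, whereas the order is linear; the circle is therefore cut
    open at a point that turns the arc under study into an initial segment.

    Scalar cumulants enter as an unknown function of subsets of positions solving the
    moment-cumulant equations; only later is its value at a subset recognised as the cumulant of a
    subword. *)

(** * Möbius inversion in a finite poset *)

Section MoebiusInversion.
Variables (T : finType) (P : {set T}) (le : rel T).
Hypotheses (le_refl : {in P, reflexive le}) (le_trans : {in P & &, transitive le}).
Hypothesis le_anti : {in P &, antisymmetric le}.
Local Notation mu := (moebius P le).

Lemma sum_moebius x y : x \in P -> y \in P ->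
  \sum_(z in P | le x z && le z y) mu x z = (x == y)%:R.
Proof.
move=> xP yP; have [xy|nxy] := boolP (le x y); last first.
  rewrite big_pred0 => [|z].
    by case: eqP => // exy; rewrite exy le_refl in nxy.
  apply/negbTE; apply: contra nxy => /and3P[zP xz zy].
  exact: (le_trans zP xP yP xz zy).
rewrite (bigD1 y) /=; last by rewrite yP xy le_refl.
rewrite (moebiusE le_trans le_anti xP yP xy).
case: eqP => [exy|nexy].
  rewrite big_pred0 ?addr0 // => z; apply/negbTE/negP => /andP[/and3P[zP xz zy]].
  by rewrite -exy in zy *; rewrite (le_anti zP xP) ?xz ?zy // eqxx.
by rewrite [X in _ + X](eq_bigl (fun z => (z \in P) && [&& le x z, le z y & z != y]))
  ?addNr // => z; rewrite -!andbA.
Qed.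

(** The recursion for [mu] varies its second argument, so summing over the first is not immediate.
    It works because [M] is a left inverse of the zeta matrix [Z], and a left inverse of a square
    integer matrix is also a right inverse. *)
Lemma sum_moebius_dual x y : x \in P -> y \in P ->
  \sum_(z in P | le x z && le z y) mu z y = (x == y)%:R.
Proof.
move=> xP yP.
pose ev (i : 'I_#|P|) : T := enum_val i.
pose Z := \matrix_(i < #|P|, j < #|P|) ((le (ev i) (ev j))%:R : int).
pose M := \matrix_(i < #|P|, j < #|P|)
  (if le (ev i) (ev j) then mu (ev i) (ev j) else 0).
have MZ : M *m Z = 1%:M.
  apply/matrixP=> i j; rewrite !mxE.
  have evP k : ev k \in P by exact: enum_valP.
  rewrite -(inj_eq enum_val_inj) -[in RHS](sum_moebius (evP i) (evP j)).
  rewrite [RHS]big_mkcondr [RHS]big_enum_val; apply: eq_bigr => k _.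
  rewrite !mxE -/(ev k).
  by case: (le (ev i) _); case: (le _ (ev j)); rewrite ?mulr1 ?mulr0 ?mul0r.
have := mulmx1C MZ => /matrixP /(_ (enum_rank_in xP x) (enum_rank_in yP y)).
rewrite !mxE -(inj_eq enum_val_inj) !enum_rankK_in // => <-.
rewrite big_mkcondr big_enum_val; apply: eq_bigr => k _.
rewrite !mxE /ev !enum_rankK_in //.
by case: (le x _); case: (le _ y); rewrite ?mul1r ?mulr0 ?mul0r.
Qed.

(* The Moebius transform of an [F] invariant under [meet w] is supported below
   [w], and [top] is not below [w]. *)
Lemma sum_moebius_meet (V : zmodType) (F : T -> V) (meet : T -> T) (w top : T) :
  w \in P -> top \in P -> w != top -> {in P, forall x, le x top} ->
  {in P, forall x, meet x \in P} ->
  {in P &, forall x y, le x (meet y) = le x y && le x w} ->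
  {in P, forall x, F (meet x) = F x} ->
  \sum_(x in P) F x *~ mu x top = 0.
Proof.
move=> wP tP nwt letop meetP meetE Fmeet.
pose u y := \sum_(x in P | le x y) F x *~ mu x y.
have FE y : y \in P -> F y = \sum_(x in P | le x y) u x.
  move=> yP; rewrite /u (exchange_big_dep (fun x => (x \in P) && le x y)) /=; last first.
    move=> i j /andP[iP iy] /andP[jP ji]; rewrite jP /=.
    exact: (le_trans iP jP yP ji iy).
  under eq_bigr => x /andP[xP xy].
    rewrite -mulrz_sumr (eq_bigl (fun z => (z \in P) && (le x z && le z y))); last first.
      by move=> z; rewrite xP /= -!andbA; congr (_ && _); rewrite andbC.
    rewrite sum_moebius //; over.
  rewrite (bigD1 y) /=; last by rewrite yP le_refl.
  rewrite eqxx /= mulr1z big1 ?addr0 // => x /andP[_ /negbTE ->].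
  by rewrite mulr0z.
under eq_bigr => x xP.
  rewrite -Fmeet // FE ?meetP //.
  rewrite (eq_bigl (fun z => (z \in P) && (le z x && le z w))); last first.
    by move=> z; case: (boolP (z \in P)) => //= zP; rewrite meetE.
  rewrite mulrz_suml; over.
rewrite (exchange_big_dep (fun z => (z \in P) && le z w)) /=; last first.
  by move=> i j _ /and3P[-> _ ->].
apply: big1 => z /andP[zP zw].
rewrite -mulrz_sumr (eq_bigl (fun x => (x \in P) && (le z x && le x top))); last first.
  move=> x; rewrite zP /= zw andbT.
  by case: (boolP (x \in P)) => //= xP; rewrite letop ?andbT.
rewrite sum_moebius_dual //; case: eqP => // zt.
case/negP: nwt; apply/eqP; apply: le_anti => //.
by rewrite letop //= -zt.
Qed.

End MoebiusInversion.

(** * Partitions of finite sets, their meets and refinement *)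

Section Partitions.
Variable T : finType.
Implicit Types (s t : {set {set T}}) (U V W : {set T}).

Lemma partition_intro s U :
  {in s, forall V, V \subset U} -> {in s, forall V, exists x, x \in V} ->
  {in U, forall x, exists2 V, V \in s & x \in V} ->
  {in s &, forall V W x, x \in V -> x \in W -> V = W} ->
  finset.partition s U.
Proof.
move=> sub ne cov dis; apply/and3P; split.
- apply/eqP/setP=> x; apply/bigcupP/idP=> [[V Vs xV]|/cov[V Vs xV]]; last by exists V.
  exact: (subsetP (sub _ Vs)).
- apply/trivIsetP=> V W Vs Ws; apply: contraNT => /pred0Pn[x /andP[/= xV xW]].
  by apply/eqP/(dis _ _ Vs Ws x).
- by apply/negP=> /ne[x]; rewrite inE.
Qed.

Lemma partition_ne s U V : finset.partition s U -> V \in s -> V != finset.set0.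
Proof. by case/and3P=> _ _ s0 Vs; apply: contraNneq s0 => <-. Qed.

Lemma partition_ex s U V : finset.partition s U -> V \in s -> exists x, x \in V.
Proof. by move=> sP /(partition_ne sP)/set0Pn. Qed.

Lemma partition_sub s U V : finset.partition s U -> V \in s -> V \subset U.
Proof. by case/and3P=> /eqP <- _ _ Vs; exact: bigcup_sup. Qed.

Lemma partition_in s U V x : finset.partition s U -> V \in s -> x \in V -> x \in U.
Proof. by move=> sP Vs; apply: subsetP; exact: partition_sub sP Vs. Qed.

Lemma partition_cover s U x : finset.partition s U -> x \in U ->
  exists2 V, V \in s & x \in V.
Proof. by case/and3P=> /eqP <- _ _ /bigcupP[V Vs xV]; exists V. Qed.

Lemma partition_eq s U V W x : finset.partition s U ->
  V \in s -> W \in s -> x \in V -> x \in W -> V = W.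
Proof.
case/and3P=> _ sT _ Vs Ws xV xW; apply/eqP; apply: contraTT xW => nVW.
by rewrite (disjointFr (trivIsetP sT _ _ Vs Ws nVW) xV).
Qed.

Lemma partition1 U : U != finset.set0 -> finset.partition [set U] U.
Proof.
case/set0Pn=> x xU; apply: partition_intro => [V|V|y yU|V W] /=.
- by move/set1P->.
- by move/set1P->; exists x.
- by exists U; rewrite ?set11.
- by move=> /set1P-> /set1P->.
Qed.

Definition pmeet s t : {set {set T}} :=
  [set V :&: W | V in s, W in t] :\ finset.set0.

Lemma pmeetP s t X :
  reflect (exists V W, [/\ V \in s, W \in t, X = V :&: W & X != finset.set0])
          (X \in pmeet s t).
Proof.
apply: (iffP setD1P) => [[X0 /imset2P[V W Vs Wt eX]]|[V [W [Vs Wt eX X0]]]].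
  by exists V, W.
by split=> //; apply/imset2P; exists V W.
Qed.

Lemma pmeet_partition s t U : finset.partition s U -> finset.partition t U ->
  finset.partition (pmeet s t) U.
Proof.
move=> sP tP; apply: partition_intro.
- move=> X /pmeetP[V [W [Vs _ -> _]]].
  by apply: subset_trans (partition_sub sP Vs); exact: subsetIl.
- by move=> X /pmeetP[_ [_ [_ _ _ /set0Pn]]].
- move=> x xU; have [V Vs xV] := partition_cover sP xU.
  have [W Wt xW] := partition_cover tP xU.
  exists (V :&: W); last by rewrite inE xV.
  by apply/pmeetP; exists V, W; split=> //; apply/set0Pn; exists x; rewrite inE xV.
- move=> _ _ /pmeetP[V [W [Vs Wt -> _]]] /pmeetP[V' [W' [Vs' Wt' -> _]]] x.
  move=> /setIP[xV xW] /setIP[xV' xW'].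
  by rewrite (partition_eq sP Vs Vs' xV xV') (partition_eq tP Wt Wt' xW xW').
Qed.

(* Empty intersections drop out of the meet, whence [m set0 = 1]. *)
Lemma prod_pmeet (R : comNzRingType) s t U (m : {set T} -> R) :
  finset.partition s U -> finset.partition t U -> m finset.set0 = 1 ->
  \prod_(X in pmeet s t) m X = \prod_(V in s) \prod_(W in t) m (V :&: W).
Proof.
move=> sP tP m0; rewrite pair_big /=.
rewrite [RHS](bigID (fun p : {set T} * {set T} => p.1 :&: p.2 == finset.set0)) /=.
rewrite [X in X * _]big1 ?mul1r => [|p /andP[_ /eqP->] //].
have -> : pmeet s t = (fun p => p.1 :&: p.2) @:
    [set p : {set T} * {set T} | (p.1 \in s) && (p.2 \in t) &&
       (p.1 :&: p.2 != finset.set0)].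
  apply/setP=> X; apply/pmeetP/imsetP=> [[V [W [Vs Wt eX X0]]]|[[V W]]].
    by exists (V, W) => //; rewrite inE /= Vs Wt -eX X0.
  by rewrite inE /= => /andP[/andP[Vs Wt] n0 ->]; exists V, W.
rewrite big_imset /=; first by apply: eq_bigl => p; rewrite inE.
move=> [V W] [V' W']; rewrite !inE /= => /andP[/andP[Vs Wt] /set0Pn[x xX]].
move=> /andP[/andP[Vs' Wt'] _] eX; have := xX; rewrite eX.
case/setIP: xX => xV xW /setIP[xV' xW'].
by rewrite (partition_eq sP Vs Vs' xV xV') (partition_eq tP Wt Wt' xW xW').
Qed.

End Partitions.

Section Refines.
Variable n : nat.
Implicit Types s t u : {set {set 'I_n}}.

Lemma refinesP s t : reflect (forall V, V \in s -> exists2 W, W \in t & V \subset W)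
  (refines s t).
Proof.
apply: (iffP forallP) => H V; first by move=> Vs; apply/exists_inP; exact: (implyP (H V)).
by apply/implyP=> Vs; apply/exists_inP; exact: H.
Qed.

Lemma refines_refl : reflexive (@refines n).
Proof. by move=> s; apply/refinesP=> V Vs; exists V. Qed.

Lemma refines_trans : transitive (@refines n).
Proof.
move=> t s u /refinesP st /refinesP tu; apply/refinesP=> V /st[W /tu[X Xu WX] VW].
by exists X => //; exact: subset_trans WX.
Qed.

Lemma refines_anti s t U : finset.partition s U -> finset.partition t U ->
  refines s t -> refines t s -> s = t.
Proof.
have half s' t' : finset.partition s' U -> finset.partition t' U ->
    refines s' t' -> refines t' s' -> s' \subset t'.
  move=> sP tP /refinesP st /refinesP ts; apply/subsetP=> V Vs.
  have [W Wt VW] := st V Vs; have [V' Vs' WV'] := ts W Wt.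
  have [x xV] := partition_ex sP Vs.
  have eV : V = V'.
    by apply: (partition_eq sP Vs Vs' xV); apply: (subsetP WV'); exact: (subsetP VW).
  by have -> : V = W by apply/eqP; rewrite eqEsubset VW eV.
by move=> sP tP st ts; apply/eqP; rewrite eqEsubset !half.
Qed.

Lemma refines_top s U : finset.partition s U -> refines s [set U].
Proof.
by move=> sP; apply/refinesP=> V Vs; exists U; rewrite ?set11 ?(partition_sub sP).
Qed.

Lemma refines_pmeet s t u U : finset.partition s U ->
  finset.partition t U -> finset.partition u U ->
  refines s (pmeet t u) = refines s t && refines s u.
Proof.
move=> sP tP uP; apply/idP/andP=> [sm|[/refinesP st /refinesP su]].
  split; apply/refinesP=> V Vs; move/refinesP: sm => /(_ V Vs)
    [_ /pmeetP[W [X [Wt Xu -> _]]]]; rewrite subsetI => /andP[VW VX].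
  - by exists W.
  - by exists X.
apply/refinesP=> V Vs; have [W Wt VW] := st V Vs; have [X Xu VX] := su V Vs.
exists (W :&: X); last by rewrite subsetI VW.
apply/pmeetP; exists W, X; split=> //; have [x xV] := partition_ex sP Vs.
by apply/set0Pn; exists x; rewrite inE (subsetP VW) ?(subsetP VX).
Qed.

End Refines.

(** * Non-crossing partitions and the moment-cumulant equations *)

Section Noncrossing.
Variables (n : nat) (chi : 'I_n -> bool).
Implicit Types (s t : {set {set 'I_n}}) (U V W : {set 'I_n}).

Definition NC U : {set {set {set 'I_n}}} :=
  [set s | finset.partition s U && noncrossing chi s].

Lemma BNC_NC : BNC chi = NC [set: 'I_n]. Proof. by []. Qed.

Lemma noncrossingP s :
  reflect (forall V W a b c d, V \in s -> W \in s -> a \in V -> b \in W ->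
             c \in V -> d \in W -> chi_lt chi a b -> chi_lt chi b c ->
             chi_lt chi c d -> V = W)
          (noncrossing chi s).
Proof.
apply: (iffP forallP) => [H V W a b c d Vs Ws aV bW cV dW ab bc cd|H V].
  have /forallP/(_ W) := implyP (H V) Vs; rewrite Ws /= => /implyP VW.
  apply/eqP; apply: contraT => /VW/negP[].
  apply/exists_inP; exists a => //; apply/exists_inP; exists b => //.
  apply/exists_inP; exists c => //; apply/exists_inP; exists d => //.
  by rewrite ab bc cd.
apply/implyP=> Vs; apply/forallP=> W; apply/implyP=> Ws; apply/implyP=> /eqP nVW.
apply/negP=> /exists_inP[a aV /exists_inP[b bW /exists_inP[c cV /exists_inP[d dW]]]].
by case/and3P=> ab bc cd; apply: nVW; exact: (H V W a b c d).
Qed.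

Lemma NC_partition U s : s \in NC U -> finset.partition s U.
Proof. by rewrite inE => /andP[]. Qed.

Lemma NC_noncrossing U s : s \in NC U -> noncrossing chi s.
Proof. by rewrite inE => /andP[]. Qed.

Lemma NC1 U : U != finset.set0 -> [set U] \in NC U.
Proof.
move=> U0; rewrite inE partition1 //=; apply/noncrossingP=> V W a b c d.
by move=> /set1P-> /set1P->.
Qed.

Lemma NC_pmeet U s t : s \in NC U -> t \in NC U -> pmeet s t \in NC U.
Proof.
move=> sN tN; have [sP tP] := (NC_partition sN, NC_partition tN).
rewrite inE pmeet_partition //=; apply/noncrossingP=> X Y a b c d.
move=> /pmeetP[V [W [Vs Wt -> _]]] /pmeetP[V' [W' [Vs' Wt' -> _]]].
move=> /setIP[aV aW] /setIP[bV bW] /setIP[cV cW] /setIP[dV dW] ab bc cd.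
have /noncrossingP sC := NC_noncrossing sN; have /noncrossingP tC := NC_noncrossing tN.
have eV := sC V V' a b c d Vs Vs' aV bV cV dV ab bc cd.
have eW := tC W W' a b c d Wt Wt' aW bW cW dW ab bc cd.
by rewrite eV eW.
Qed.

Lemma NC_restrict U V s t : s \in NC U -> t \in NC U -> refines t s -> V \in s ->
  [set W in t | W \subset V] \in NC V.
Proof.
move=> sN tN /refinesP ts Vs; have [sP tP] := (NC_partition sN, NC_partition tN).
rewrite inE; apply/andP; split.
  apply: partition_intro.
  - by move=> W; rewrite inE => /andP[].
  - by move=> W; rewrite inE => /andP[/(partition_ex tP)].
  - move=> x xV; have [W Wt xW] := partition_cover tP (partition_in sP Vs xV).
    exists W; rewrite // inE Wt /=; have [V' Vs' WV'] := ts W Wt.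
    by rewrite (partition_eq sP Vs Vs' xV (subsetP WV' _ xW)).
  - by move=> W W'; rewrite !inE => /andP[Wt _] /andP[Wt' _] x; exact: (partition_eq tP).
have /noncrossingP tC := NC_noncrossing tN; apply/noncrossingP=> W W' a b c d.
by rewrite !inE => /andP[Wt _] /andP[Wt' _]; exact: tC.
Qed.

(** Two crossing pieces would lie in crossing blocks of [s], hence in the same block [V], where
    [f V] itself is non-crossing. *)
Lemma NC_bigcup U s (f : {set 'I_n} -> {set {set 'I_n}}) : s \in NC U ->
  {in s, forall V, f V \in NC V} ->
  \bigcup_(V in s) f V \in NC U /\ refines (\bigcup_(V in s) f V) s.
Proof.
move=> sN fN; have sP := NC_partition sN.
have fP V (Vs : V \in s) := NC_partition (fN V Vs).
have same V V' W W' x : V \in s -> V' \in s -> W \in f V -> W' \in f V' ->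
    x \in W -> x \in W' -> V = V'.
  move=> Vs Vs' Wf Wf' xW xW'.
  exact: (partition_eq sP Vs Vs' (partition_in (fP _ Vs) Wf xW) (partition_in (fP _ Vs') Wf' xW')).
split; last first.
  by apply/refinesP=> W /bigcupP[V Vs Wf]; exists V; rewrite ?(partition_sub (fP _ Vs)).
rewrite inE; apply/andP; split.
  apply: partition_intro.
  - move=> W /bigcupP[V Vs Wf]; apply: subset_trans (partition_sub sP Vs).
    exact: partition_sub (fP _ Vs) Wf.
  - by move=> W /bigcupP[V Vs Wf]; exact: partition_ex (fP _ Vs) Wf.
  - move=> x xU; have [V Vs xV] := partition_cover sP xU.
    have [W Wf xW] := partition_cover (fP _ Vs) xV.
    by exists W => //; apply/bigcupP; exists V.
  - move=> W W' /bigcupP[V Vs Wf] /bigcupP[V' Vs' Wf'] x xW xW'.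
    have eV := same _ _ _ _ _ Vs Vs' Wf Wf' xW xW'; rewrite -eV in Wf'.
    exact: (partition_eq (fP _ Vs) Wf Wf' xW xW').
apply/noncrossingP=> W W' a b c d /bigcupP[V Vs Wf] /bigcupP[V' Vs' Wf'].
move=> aW bW cW dW ab bc cd.
have inV x : x \in W -> x \in V by exact: partition_in (fP _ Vs) Wf.
have inV' x : x \in W' -> x \in V' by exact: partition_in (fP _ Vs') Wf'.
have /noncrossingP sC := NC_noncrossing sN.
have eV : V = V' by apply: (sC V V' a b c d); rewrite ?inV ?inV'.
rewrite -eV in Wf'; have /noncrossingP fC := NC_noncrossing (fN _ Vs).
exact: (fC W W' a b c d).
Qed.

Section MomentCumulant.
Variables (R : comNzRingType) (m c : {set 'I_n} -> R).

Lemma prod_refines U s t : finset.partition s U -> finset.partition t U ->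
  refines t s ->
  \prod_(V in s) \prod_(W in [set W in t | W \subset V]) c W = \prod_(W in t) c W.
Proof.
move=> sP tP /refinesP ts.
rewrite [RHS](partition_big (fun W => odflt finset.set0 [pick V in s | W \subset V])
  (mem s)) /=; last first.
  move=> W /ts[V Vs WV]; case: pickP => [V' /andP[]//|/(_ V)].
  by rewrite Vs WV.
apply: eq_bigr => V Vs; apply: eq_bigl => W; rewrite inE.
case: (boolP (W \in t)) => //= Wt; have [x xW] := partition_ex tP Wt.
case: pickP => [V' /andP[Vs' WV']|/=]; last first.
  by case: (ts W Wt) => V' Vs' WV' /(_ V'); rewrite Vs' WV'.
apply/idP/eqP=> [WV|/= <- //]; apply: (partition_eq sP Vs' Vs (x := x)).
  exact: (subsetP WV').
exact: (subsetP WV).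
Qed.

(** Expanding the product means choosing a non-crossing partition of each block of [s]; such
    families correspond to the refinements of [s], by restriction to the blocks ([h]) and by union
    ([h']). *)
Lemma prod_moments U s : s \in NC U ->
  {in s, forall V, m V = \sum_(t in NC V) \prod_(W in t) c W} ->
  \prod_(V in s) m V = \sum_(t in NC U | refines t s) \prod_(W in t) c W.
Proof.
move=> sN mE; have sP := NC_partition sN.
rewrite (eq_bigr _ mE) (big_distr_big_dep finset.set0) /=.
(* Off [s] the families take the default value [set0] imposed by the distributive law, and [h] has
   to agree with them there. *)
pose h (t : {set {set 'I_n}}) : {ffun {set 'I_n} -> {set {set 'I_n}}} :=
  [ffun V => if V \in s then [set W in t | W \subset V] else finset.set0].
pose h' (f : {ffun {set 'I_n} -> {set {set 'I_n}}}) := \bigcup_(V in s) f V.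
rewrite (reindex_onto h h') /=; last first.
  move=> f /pfamilyP[/subsetP fs fN]; apply/ffunP=> V; rewrite ffunE.
  have fP X (Xs : X \in s) := NC_partition (fN X Xs).
  case: ifP => Vs; last first.
    by apply/esym/eqP; apply: contraFT Vs => ?; apply: fs.
  apply/setP=> W; rewrite inE; apply/andP/idP=> [[/bigcupP[V' Vs' Wf] WV]|Wf].
    have [x xW] := partition_ex (fP _ Vs') Wf.
    by rewrite (partition_eq sP Vs Vs' (subsetP WV _ xW) (partition_in (fP _ Vs') Wf xW)).
  by split; [apply/bigcupP; exists V|exact: partition_sub (fP _ Vs) Wf].
apply: eq_big => [t|t /andP[/pfamilyP[_ htN] /eqP htE]].
  apply/andP/andP=> [[/pfamilyP[_ htN] /eqP htE]|[tN ts]].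
    by rewrite -htE; apply: NC_bigcup.
  have tP := NC_partition tN; split.
    apply/pfamilyP; split=> [|V Vs]; last by rewrite /= ffunE Vs (NC_restrict sN).
    by apply/subsetP=> V; rewrite inE ffunE; case: ifP; rewrite ?eqxx.
  apply/eqP/setP=> W; apply/bigcupP/idP=> [[V Vs]|Wt].
    by rewrite ffunE Vs inE => /andP[].
  have /refinesP /(_ W Wt)[V Vs WV] := ts.
  by exists V; rewrite // ffunE Vs inE Wt.
have [htN' hts] := NC_bigcup sN htN; rewrite [\bigcup_(_ in _) _]htE in htN' hts.
rewrite -(prod_refines sP (NC_partition htN') hts); apply: eq_bigr => V Vs.
by rewrite ffunE Vs.
Qed.

End MomentCumulant.

(** The equation for [U] contains [c U] only through the one-block partition, so it can be solved
    for [c U] once [c] is known on smaller sets; stage [k] settles the sets with at most [k]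
    elements. *)
Lemma cumulants_exist (R : comNzRingType) (m : {set 'I_n} -> R) :
  exists c : {set 'I_n} -> R, forall U, U != finset.set0 ->
    m U = \sum_(t in NC U) \prod_(W in t) c W.
Proof.
suff /(_ n)[c cE] : forall k, exists c : {set 'I_n} -> R,
    forall U, U != finset.set0 -> (#|U| <= k)%N ->
    m U = \sum_(t in NC U) \prod_(W in t) c W.
  by exists c => U U0; apply: cE => //; rewrite -[n in leqRHS]card_ord max_card.
elim=> [|k [c IH]].
  by exists m => U; rewrite leqn0 cards_eq0 => /negbTE ->.
exists (fun V => if (#|V| <= k)%N then c V else
   m V - \sum_(t in NC V | t != [set V]) \prod_(W in t) c W) => U U0 leU.
rewrite (bigD1 [set U]) ?NC1 //= big_set1.
rewrite [X in _ + X](eq_bigr (fun t => \prod_(W in t) c W)) => [|t /andP[tN nt1]]; last first.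
  have tP := NC_partition tN; apply: eq_bigr => W Wt /=; case: (leqP #|W| k) => // ltW.
  (* [W] has more than [k] elements and [U] at most [k.+1], so [W] is [U] and [t] is the excluded
     one-block partition. *)
  case/negP: nt1; have WU := partition_sub tP Wt.
  have eWU : W = U.
    by apply/eqP; rewrite eqEcard WU (leq_trans leU).
  apply/eqP/setP=> W'; rewrite inE; apply/idP/eqP=> [Wt'|->]; last by rewrite -eWU.
  have [x xW'] := partition_ex tP Wt'.
  rewrite -eWU; apply: (partition_eq tP Wt' Wt xW'); rewrite eWU.
  exact: partition_in tP Wt' xW'.
case: ifP => [kU|_]; last by rewrite subrK.
by rewrite {1}IH // (bigD1 [set U]) ?NC1 //= big_set1.
Qed.

Lemma BNC_refines_refl : {in BNC chi, reflexive (@refines n)}.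
Proof. by move=> s _; exact: refines_refl. Qed.

Lemma BNC_refines_trans : {in BNC chi & &, transitive (@refines n)}.
Proof. by move=> t s u _ _ _; exact: refines_trans. Qed.

Lemma BNC_refines_anti : {in BNC chi &, antisymmetric (@refines n)}.
Proof.
move=> s t; rewrite BNC_NC => sN tN /andP[].
exact: refines_anti (NC_partition sN) (NC_partition tN).
Qed.

End Noncrossing.

(** * The order of the positions and its restriction to subwords *)

Section ChiOrder.
Variables (n : nat) (chi : 'I_n -> bool).

(** This form depends only on the colours and the natural order of the two positions, hence is
    inherited by subwords. *)
Lemma chi_ltE (a b : 'I_n) : chi_lt chi a b =
  if chi a then chi b ==> (a < b)%N else ~~ chi b && (b < a)%N.
Proof.
pose lt (x y : 'I_n) := if chi x then chi y ==> (x < y)%N else ~~ chi y && (y < x)%N.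
have lt_trans : transitive lt.
  move=> y x z; rewrite /lt; case: (chi x) (chi y) (chi z) => [] [] [] //=;
  [exact: ltn_trans|move=> yx zy; exact: ltn_trans zy yx].
have enumS : pairwise (fun x y : 'I_n => (x < y)%N) (enum 'I_n).
  rewrite -(pairwise_map (fun i : 'I_n => i : nat) ltn) val_enum_ord.
  by rewrite -sorted_pairwise ?iota_ltn_sorted //; exact: ltn_trans.
have seqS : sorted lt (schi_seq chi).
  rewrite sorted_pairwise // /schi_seq pairwise_cat; apply/and3P; split.
  - apply/allrelP=> x y; rewrite mem_rev !mem_filter => /andP[cx _] /andP[cy _].
    by rewrite /lt cx (negbTE cy).
  - apply: (@sub_in_pairwise _ chi (fun x y : 'I_n => (x < y)%N)).
    + by move=> x y; rewrite !unfold_in /lt => -> -> ->.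
    + by rewrite all_filter; apply/allP=> x _; exact: implybb.
    + exact: subseq_pairwise (filter_subseq _ _) enumS.
  - rewrite -sorted_pairwise // rev_sorted sorted_pairwise; last first.
      by move=> y x z yx zy; exact: lt_trans zy yx.
    apply: (@sub_in_pairwise _ (predC chi) (fun x y : 'I_n => (x < y)%N)).
    + by move=> x y; rewrite !unfold_in /lt => /negbTE -> /negbTE -> ->.
    + by rewrite all_filter; apply/allP=> x _; exact: implybb.
    + exact: subseq_pairwise (filter_subseq _ _) enumS.
have imp x y : chi_lt chi x y -> lt x y.
  by apply: sorted_ltn_index; rewrite ?mem_schi_seq.
(* One implication suffices: [lt] is a strict order, and distinct positions are always comparable
   under [chi_lt]. *)
apply/idP/idP=> [|ab]; first exact: imp.
rewrite /chi_lt; case: ltngtP => // [/imp ba|eab].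
  have := lt_trans _ _ _ ab ba; rewrite /lt ltnn /=.
  by case: (chi a).
have eab' : a = b by rewrite -(nth_index a (mem_schi_seq chi a)) eab nth_index ?mem_schi_seq.
by move: ab; rewrite eab' ltnn; case: (chi b).
Qed.

End ChiOrder.

Lemma chi_lt_comp (n k : nat) (chi : 'I_n -> bool) (g : 'I_k -> 'I_n) (p q : 'I_k) :
  (forall i j : 'I_k, (i < j)%N -> (g i < g j)%N) ->
  chi_lt (chi \o g) p q = chi_lt chi (g p) (g q).
Proof.
move=> gM; rewrite !chi_ltE /=.
have gE (i j : 'I_k) : (g i < g j)%N = (i < j)%N; last by rewrite !gE.
by case: (ltngtP i j) => [/gM->|/gM|/val_inj->]; rewrite ?ltnn //; case: ltngtP.
Qed.

Lemma increasing_inj (k n : nat) (g : 'I_k -> 'I_n) :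
  (forall i j : 'I_k, (i < j)%N -> (g i < g j)%N) -> injective g.
Proof.
move=> gM i j eg; apply: val_inj; case: (ltngtP i j) => // /gM; by rewrite eg ltnn.
Qed.

Section Restriction.
Variables (n k : nat) (chi : 'I_n -> bool) (g : 'I_k -> 'I_n).
Hypothesis gM : forall i j : 'I_k, (i < j)%N -> (g i < g j)%N.
Let g_inj := increasing_inj gM.

Lemma NC_imset (B : {set 'I_k}) (t : {set {set 'I_k}}) :
  ([set g @: W | W : {set 'I_k} in t] \in NC chi (g @: B)) = (t \in NC (chi \o g) B).
Proof.
have gI := imset_inj g_inj.
apply/idP/idP=> tN; have tP := NC_partition tN; have /noncrossingP tC := NC_noncrossing tN.
  rewrite inE; apply/andP; split.
    apply: partition_intro.
    - move=> V Vt; have := partition_sub tP (imset_f (fun W : {set 'I_k} => g @: W) Vt).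
      by move/subsetP=> VB; apply/subsetP=> x xV; have := VB (g x) (imset_f _ xV);
         rewrite mem_imset.
    - move=> V Vt; have [_ /imsetP[x xV _]] :=
        partition_ex tP (imset_f (fun W : {set 'I_k} => g @: W) Vt).
      by exists x.
    - move=> x xB; have [_ /imsetP[V Vt ->]] := partition_cover tP (imset_f g xB).
      by rewrite mem_imset // => xV; exists V.
    - move=> V W Vt Wt x xV xW; apply: gI.
      by apply: (partition_eq tP _ _ (x := g x)); rewrite ?imset_f.
  apply/noncrossingP=> V W a b c d Vt Wt aV bW cV dW; rewrite !(chi_lt_comp chi _ _ gM) => ab bc cd.
  by apply: gI; apply: (tC _ _ (g a) (g b) (g c) (g d) _ _ _ _ _ _ ab bc cd);
    rewrite ?imset_f.
rewrite inE; apply/andP; split.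
  apply: partition_intro.
  - move=> _ /imsetP[V Vt ->]; apply: imsetS; exact: partition_sub tP Vt.
  - by move=> _ /imsetP[V Vt ->]; have [x xV] := partition_ex tP Vt; exists (g x); rewrite imset_f.
  - move=> _ /imsetP[x xB ->]; have [V Vt xV] := partition_cover tP xB.
    by exists (g @: V); rewrite imset_f.
  - move=> _ _ /imsetP[V Vt ->] /imsetP[W Wt ->] y /imsetP[x xV ->].
    by rewrite mem_imset // => xW; rewrite (partition_eq tP Vt Wt xV xW).
apply/noncrossingP=> _ _ a b c d /imsetP[V Vt ->] /imsetP[W Wt ->].
move=> /imsetP[a' aV ->] /imsetP[b' bW ->] /imsetP[c' cV ->] /imsetP[d' dW ->].
rewrite -!(chi_lt_comp chi _ _ gM) => ab bc cd.
by have -> := tC V W a' b' c' d' Vt Wt aV bW cV dW ab bc cd.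
Qed.

Lemma sum_NC_imset (R : comNzRingType) (c : {set 'I_n} -> R) (B : {set 'I_k}) :
  \sum_(t in NC chi (g @: B)) \prod_(W in t) c W =
  \sum_(t in NC (chi \o g) B) \prod_(W in t) c (g @: W).
Proof.
have gI := imset_inj g_inj; have gII := imset_inj gI.
have -> : NC chi (g @: B) =
    [set [set g @: W | W : {set 'I_k} in t] | t : {set {set 'I_k}} in NC (chi \o g) B].
  apply/setP=> s; apply/idP/imsetP=> [sN|[t tN ->]]; last by rewrite NC_imset.
  have sP := NC_partition sN.
  have eV V : V \in s -> g @: (g @^-1: V) = V.
    move=> Vs; apply/setP=> x; apply/imsetP/idP=> [[y]|xV]; first by rewrite inE => ? ->.
    have /imsetP[y _ exy] := partition_in sP Vs xV; exists y => //.
    by rewrite inE -exy.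
  have es : s = [set g @: W | W : {set 'I_k} in [set g @^-1: V | V : {set 'I_n} in s]].
    apply/setP=> V; apply/idP/imsetP=> [Vs|[_ /imsetP[W Ws ->] ->]]; last by rewrite eV.
    by exists (g @^-1: V); rewrite ?eV ?imset_f.
  by exists [set g @^-1: V | V : {set 'I_n} in s] => //; rewrite -NC_imset -es.
rewrite big_imset /=; last by move=> t t' _ _; exact: gII.
apply: eq_bigr => t _; rewrite big_imset //= => V W _ _; exact: gI.
Qed.

End Restriction.

Section CumulantFormula.
Variables (n : nat) (chi : 'I_n -> bool) (R : comNzRingType) (m c : {set 'I_n} -> R).
Hypothesis mE : forall U, U != finset.set0 -> m U = \sum_(t in NC chi U) \prod_(W in t) c W.

Lemma top_BNC : (0 < n)%N -> [set [set: 'I_n]] \in BNC chi.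
Proof.
move=> n0; rewrite BNC_NC NC1 //; apply/set0Pn; exists (Ordinal n0); exact: in_setT.
Qed.

Lemma prod_moments_NC U s : s \in NC chi U ->
  \prod_(V in s) m V = \sum_(t in NC chi U | refines t s) \prod_(W in t) c W.
Proof.
move=> sN; apply: prod_moments => // V Vs; apply: mE.
exact: partition_ne (NC_partition sN) Vs.
Qed.

(** Each product of moments collects the weights of all refinements of [s]; after exchanging the
    sums, the dual Möbius identity keeps only the one-block partition. *)
Lemma moebius_moments : (0 < n)%N ->
  \sum_(s in BNC chi) (\prod_(V in s) m V) *~
     moebius (BNC chi) (@refines n) s [set [set: 'I_n]] = c [set: 'I_n].
Proof.
move=> n0; have topN := top_BNC n0.
under eq_bigr => s sN do rewrite (prod_moments_NC sN) mulrz_suml.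
rewrite (exchange_big_dep (mem (BNC chi))) /=; last by move=> s t _ /andP[].
transitivity (\sum_(t in BNC chi)
    (\prod_(W in t) c W) *~ (t == [set [set: 'I_n]])%:R).
  apply: eq_bigr => t tN; rewrite -mulrz_sumr; congr (_ *~ _).
  rewrite -(sum_moebius_dual (BNC_refines_refl (chi := chi))
    (BNC_refines_trans (chi := chi)) (BNC_refines_anti (chi := chi)) tN topN).
  apply: eq_bigl => s; rewrite -BNC_NC tN /=; case: (boolP (s \in BNC chi)) => //= sN.
  by rewrite (refines_top (NC_partition sN)) andbT.
rewrite (bigD1 [set [set: 'I_n]]) //= eqxx big_set1 mulr1z big1 ?addr0 // => t.
by case/andP=> _ /negbTE ->; rewrite mulr0z.
Qed.

End CumulantFormula.

(** * Interval blocks and induction along the recursion for moments *)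

Section ChiSeq.
Variables (n : nat) (chi : 'I_n -> bool).
Implicit Types (U V W : {set 'I_n}) (s : {set {set 'I_n}}).

Definition chi_seq U : seq 'I_n := [seq k <- schi_seq chi | k \in U].

Lemma chi_lt_trans : transitive (chi_lt chi).
Proof. by move=> y x z; exact: ltn_trans. Qed.

Lemma chi_ltxx x : chi_lt chi x x = false.
Proof. exact: ltnn. Qed.

Lemma chi_lt_total x y : x != y -> chi_lt chi x y || chi_lt chi y x.
Proof.
rewrite /chi_lt; case: ltngtP => // eq_xy.
by rewrite -(nth_index x (mem_schi_seq chi x)) eq_xy nth_index ?mem_schi_seq ?eqxx.
Qed.

Lemma mem_chi_seq U k : (k \in chi_seq U) = (k \in U).
Proof. by rewrite mem_filter mem_schi_seq andbT. Qed.

Lemma schi_seq_pairwise : pairwise (chi_lt chi) (schi_seq chi).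
Proof.
case: n chi => [|n'] c; first by case: (schi_seq c) => // [[]].
apply/(pairwiseP ord0) => i j; rewrite !inE => ltis ltjs ltij.
by rewrite /chi_lt !index_uniq ?schi_seq_uniq.
Qed.

Lemma chi_seqU V W : {in V & W, forall v w, chi_lt chi v w} ->
  chi_seq (V :|: W) = chi_seq V ++ chi_seq W.
Proof.
rewrite /chi_seq; elim: (schi_seq chi) schi_seq_pairwise => //= k s IH.
case/andP=> /allP ks /IH{}IH ltVW; rewrite inE (IH ltVW).
have [kV|kV] := boolP (k \in V); have [kW|kW] //= := boolP (k \in W).
  by have := ltVW _ _ kV kW; rewrite chi_ltxx.
rewrite [X in _ :: X](_ : _ = [seq x <- s | x \in W]).
  rewrite [X in X ++ _](_ : _ = [::]) //; apply/eqP; rewrite -[_ == _]negbK -has_filter.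
  apply/hasPn=> x xs; apply/negP=> xV.
  by have := chi_lt_trans (ks x xs) (ltVW _ _ xV kW); rewrite chi_ltxx.
rewrite [X in X ++ _](_ : _ = [::]) //; apply/eqP; rewrite -[_ == _]negbK -has_filter.
apply/hasPn=> x xs; apply/negP=> xV.
by have := chi_lt_trans (ks x xs) (ltVW _ _ xV kW); rewrite chi_ltxx.
Qed.

(** A block whose convex hull is smallest is an interval. Otherwise a point of another block [W]
    sits between two points [a], [c] of it; by non-crossing all of [W] lies strictly between them,
    and the hull of [W] is smaller. *)
Lemma interval_block s U : s \in NC chi U -> (1 < #|s|)%N ->
  exists V, [/\ V \in s, V != U & chi_interval chi U V].
Proof.
move=> sN s_gt1; have sP := NC_partition sN.
have /noncrossingP sC := NC_noncrossing sN.
pose hull V := [set x | [exists a in V, exists c in V,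
  ~~ chi_lt chi x a && ~~ chi_lt chi c x]].
have [V0 V0s] : exists V, V \in s by apply/set0Pn; rewrite -card_gt0; exact: ltn_trans s_gt1.
case: (arg_minnP (fun V => #|hull V|) V0s) => V Vs Vmin; exists V; split=> //.
  apply: contraL s_gt1 => /eqP eVU; rewrite -leqNgt -(cards1 U) subset_leq_card //.
  apply/subsetP=> W Ws; rewrite inE -eVU; apply/eqP.
  have [x xW] := partition_ex sP Ws; apply: (partition_eq sP Ws Vs xW).
  by rewrite eVU; exact: partition_in sP Ws xW.
rewrite /chi_interval (partition_sub sP Vs) /=.
apply/forall_inP=> a aV; apply/forall_inP=> c cV; apply/forall_inP=> b bU.
apply/implyP=> /andP[ab bc]; apply: contraT => bV.
have [W Ws bW] := partition_cover sP bU.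
have nVW : V <> W by move=> eVW; rewrite eVW bW in bV.
have inside w : w \in W -> chi_lt chi a w && chi_lt chi w c.
  move=> wW.
  have wa : w != a by apply/eqP=> ewa; apply: nVW; apply: (partition_eq sP Vs Ws aV); rewrite -ewa.
  have wc : w != c by apply/eqP=> ewc; apply: nVW; apply: (partition_eq sP Vs Ws cV); rewrite -ewc.
  case/orP: (chi_lt_total wa) => [ltwa|->].
    by case: nVW; rewrite (sC W V w a b c).
  case/orP: (chi_lt_total wc) => [->//|ltcw].
  by case: nVW; rewrite (sC V W a b c w).
have : (#|hull W| < #|hull V|)%N.
  apply: proper_card; apply/properP; split; last first.
    exists a; rewrite !inE.
      by apply/exists_inP; exists a => //; apply/exists_inP; exists a; rewrite ?chi_ltxx.
    apply/exists_inP=> -[w /inside/andP[aw _] /exists_inP[w' _ /andP[]]].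
    by rewrite aw.
  apply/subsetP=> x; rewrite !inE => /exists_inP[w wW /exists_inP[w' wW' /andP[xw wx]]].
  apply/exists_inP; exists a => //; apply/exists_inP; exists c => //.
  have [/andP[aw _] /andP[_ wc]] := (inside _ wW, inside _ wW').
  apply/andP; split; [apply: contra xw => xa|apply: contra wx => cx].
    exact: chi_lt_trans xa aw.
  exact: chi_lt_trans wc cx.
by rewrite ltnNge Vmin.
Qed.

Lemma NC_rem U V s : s \in NC chi U -> V \in s -> s :\ V \in NC chi (U :\: V).
Proof.
move=> sN Vs; have sP := NC_partition sN; rewrite inE; apply/andP; split.
  apply: partition_intro.
  - move=> W /setD1P[nWV Ws]; rewrite subsetD (partition_sub sP Ws) /=.
    rewrite -setI_eq0; apply: contraR nWV => /set0Pn[x /setIP[xW xV]].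
    by rewrite (partition_eq sP Ws Vs xW xV).
  - by move=> W /setD1P[_ /(partition_ex sP)].
  - move=> x /setDP[/(partition_cover sP)[W Ws xW] xV]; exists W => //.
    by rewrite !inE Ws andbT; apply: contraNneq xV => <-.
  - by move=> W W' /setD1P[_ Ws] /setD1P[_ Ws'] x; exact: (partition_eq sP).
have /noncrossingP sC := NC_noncrossing sN; apply/noncrossingP=> W W' a b c d.
by move=> /setD1P[_ Ws] /setD1P[_ Ws']; exact: sC.
Qed.

End ChiSeq.

Section MomentInd.
Variables (K : fieldType) (B A : algType K) (S : bb_space B A).
Variables (n : nat) (chi : 'I_n -> bool).
Variable Q : {set {set 'I_n}} -> ('I_n -> A) -> B -> Prop.
Let blockE (V : {set 'I_n}) Z := bbE S (\prod_(k in V) Z k).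

Hypothesis Q1 : forall U Z, U != finset.set0 -> Q [set U] Z (blockE U Z).

Hypothesis Qinitial : forall U V s Z b, s \in NC chi U -> V \in s ->
  U :\: V != finset.set0 -> {in V & U :\: V, forall v w, chi_lt chi v w} ->
  Q (s :\ V) Z b -> Q s Z (blockE V Z * b).

Hypothesis Qterminal : forall U V s Z b, s \in NC chi U -> V \in s ->
  U :\: V != finset.set0 -> {in U :\: V & V, forall w v, chi_lt chi w v} ->
  Q (s :\ V) Z b -> Q s Z (b * blockE V Z).

Hypothesis Qinner : forall U V W W' s Z b p, s \in NC chi U -> V \in s ->
  U :\: V = W :|: W' -> {in W & V, forall w v, chi_lt chi w v} ->
  {in V & W', forall v w, chi_lt chi v w} ->
  p \in W -> {in W, forall w, w != p -> chi_lt chi w p} ->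
  Q (s :\ V) (absorb S chi (blockE V Z) p Z) b -> Q s Z b.

(** Hides the fuel and the choice of the split-off block in [moment_rec]. [Q] is a relation on
    partition, tuple and value because the inner case changes the tuple by [absorb]; there [W] and
    [W'] are the positions before and after [V], and [p] is the last one of [W]. *)
Lemma moment_ind s U Z : s \in NC chi U -> U != finset.set0 ->
  Q s Z (moment S chi s Z).
Proof.
rewrite /moment; move: {2 3}#|s| (erefl #|s|) => m.
elim: m s U Z => [|m IH] s U Z sm sN U0; have sP := NC_partition sN.
  have /set0Pn[x xU] := U0; have [V Vs _] := partition_cover sP xU.
  by move/eqP: sm; rewrite cards_eq0 => /eqP s0; rewrite s0 inE in Vs.
rewrite /= (cover_partition sP); case: pickP => [V /and3P[Vs nVU VI]|noV]; last first.
  have s1 : s = [set U].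
    have [V Vs] : exists V, V \in s by apply/set0Pn; rewrite -card_gt0 sm.
    have /cards1P[W sW] : #|s| == 1%N.
      rewrite eqn_leq sm /= -sm; apply/andP; split; last by rewrite sm.
      rewrite leqNgt; apply/negP=> /(interval_block sN)[X [Xs nX XI]].
      by have := noV X; rewrite Xs nX XI.
    by rewrite sW; congr [set _]; rewrite -(cover_partition sP) sW /finset.cover big_set1.
  by rewrite s1; apply: Q1.
have sN' := NC_rem sN Vs.
have sm' : #|s :\ V| = m by have := cardsD1 V s; rewrite Vs sm => -[].
have U0' : U :\: V != finset.set0.
  by rewrite setD_eq0; apply: contra nVU => UV; rewrite eqEsubset UV (partition_sub sP Vs).
case: ifP => [ini|nini].
  apply: (Qinitial sN Vs U0') => [v w vV wW|]; last exact: IH sN' U0'.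
  exact: (forall_inP (forall_inP ini v vV)).
case: ifP => [ter|nter].
  apply: (Qterminal sN Vs U0') => [w v wW vV|]; last exact: IH sN' U0'.
  exact: (forall_inP (forall_inP ter v vV)).
(* Since [V] is an interval of [U], every other point of [U] lies entirely on one side of it. *)
have dich w : w \in U :\: V -> {in V, forall v, chi_lt chi w v} \/ {in V, forall v, chi_lt chi v w}.
  move=> /setDP[wU wV]; have [v vV] := partition_ex sP Vs.
  have neq u : u \in V -> u != w by move=> uV; apply: contraNneq wV => <-.
  have both u u' : u \in V -> u' \in V -> ~~ (chi_lt chi u w && chi_lt chi w u').
    move=> uV uV'; apply: contra wV => uwu.
    case/andP: VI => _ /forall_inP/(_ u uV)/forall_inP/(_ u' uV')/forall_inP/(_ w wU).
    by rewrite uwu.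
  case/orP: (chi_lt_total chi (neq v vV)) => [vw|wv]; [right|left] => u uV.
    case/orP: (chi_lt_total chi (neq u uV)) => // wu.
    by have := both v u vV uV; rewrite vw wu.
  case/orP: (chi_lt_total chi (neq u uV)) => // uw.
  by have := both u v uV vV; rewrite uw wv.
pose W := [set w in U :\: V | [forall v in V, chi_lt chi w v]].
pose W' := [set w in U :\: V | [forall v in V, chi_lt chi v w]].
have WV : {in W & V, forall w v, chi_lt chi w v}.
  by move=> w v; rewrite inE => /andP[_ /forall_inP]; exact.
have VW : {in V & W', forall v w, chi_lt chi v w}.
  by move=> v w vV; rewrite inE => /andP[_ /forall_inP]; exact.
have eW : U :\: V = W :|: W'.
  apply/setP=> w; rewrite in_setU [w \in W]inE [w \in W']inE -andb_orr.
  case: (boolP (w \in U :\: V)) => //= /dich[] H; apply/esym/orP; [left|right];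
  exact/forall_inP.
have [v0 v0V] := partition_ex sP Vs.
(* [V] is not initial, so something precedes it; hence a predecessor exists and the branch with
   value 0 is never reached. *)
have [w0 w0W] : exists w, w \in W.
  move/negbT: nini; rewrite negb_forall_in => /exists_inP[v vV].
  rewrite negb_forall_in => /exists_inP[w wU nvw]; exists w.
  rewrite inE wU; apply/forall_inP; case: (dich w wU) => // /(_ v vV) vw.
  by rewrite vw in nvw.
pose p0 := [arg max_(p > w0 in W) index p (schi_seq chi)].
have [p0W p0max] : p0 \in W /\ {in W, forall w, w != p0 -> chi_lt chi w p0}.
  rewrite /p0; case: arg_maxnP => // p pW pmax; split=> // w wW nwp.
  have := chi_lt_total chi nwp; rewrite {2}/chi_lt ltnNge.
  by have /= -> := pmax w wW; rewrite orbF.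
case: pickP => [p /and3P[pU pV pmax]|/(_ p0)]; last first.
  have p0U : p0 \in U :\: V by rewrite eW inE p0W.
  rewrite /chi_pred p0U /=; have -> /= : [forall v in V, chi_lt chi p0 v].
    by apply/forall_inP=> v vV; exact: WV.
  move/negP; case; apply/forall_inP=> w; rewrite eW => /setUP[wW|wW]; apply/implyP=> p0w.
    have [ewp|/(p0max _ wW) wp] := eqVneq w p0; first by rewrite ewp chi_ltxx in p0w.
    by have := chi_lt_trans p0w wp; rewrite chi_ltxx.
  by apply/forall_inP=> v vV; exact: VW.
have pW : p \in W by rewrite inE pU.
apply: (Qinner (W := W) (W' := W') (p := p) sN Vs) => //; last exact: IH sN' U0'.
move=> w wW nwp; case/orP: (chi_lt_total chi nwp) => // pw.
have wU : w \in U :\: V by rewrite eW inE wW.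
have := implyP (forall_inP pmax w wU) pw => /forall_inP/(_ v0 v0V) v0w.
by have := chi_lt_trans v0w (WV _ _ wW v0V); rewrite chi_ltxx.
Qed.

End MomentInd.

(* [big_enum] requires commutativity. *)
Lemma prod_in_enum (R : pzSemiRingType) (T : finType) (V : {set T}) (F : T -> R) :
  \prod_(k in V) F k = \prod_(k <- enum V) F k.
Proof. by rewrite -big_filter [index_enum T]unlock. Qed.

Lemma prod_in_scale (K : fieldType) (A : algType K) (n : nat) (c : K)
    (x y : 'I_n -> A) (p : 'I_n) (V : {set 'I_n}) :
  p \in V -> y p = c *: x p -> {in V, forall k, k != p -> y k = x k} ->
  \prod_(k in V) y k = c *: \prod_(k in V) x k.
Proof.
rewrite !prod_in_enum; have := enum_uniq V; rewrite -(mem_enum V) => eU pV yp yx.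
have {}yx : {in enum V, forall k, k != p -> y k = x k} by move=> k; rewrite mem_enum; apply: yx.
elim: (enum V) eU pV yx => //= k s IH /andP[ks sU]; rewrite inE !big_cons => pks yx.
have [ekp|nkp] := eqVneq k p.
  rewrite ekp yp scalerAl; congr (_ * _); apply: eq_big_seq => l ls.
  apply: yx; rewrite ?inE ?ls ?orbT //; apply: contraNneq ks => elp.
  by rewrite ekp -elp.
rewrite yx ?mem_head // IH ?scalerAr //.
  by move: pks; rewrite eq_sym (negbTE nkp).
by move=> l ls; apply: yx; rewrite inE ls orbT.
Qed.

(** * Matrix letters as edges, words as chains of edges *)

Section Chains.
Variables (T I : eqType) (a b : T -> I).
Implicit Types (l v w : seq T) (i j z : I).

(* A letter [k] is read as an edge from [a k] to [b k]. *)
Fixpoint chain i l j : bool :=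
  if l is k :: l' then (a k == i) && chain (b k) l' j else i == j.

Fixpoint chain_end i l : I := if l is k :: l' then chain_end (b k) l' else i.

Lemma chain_cat i v w j :
  chain i (v ++ w) j = chain i v (chain_end i v) && chain (chain_end i v) w j.
Proof. by elim: v i => /= [|k v IH] i; rewrite ?eqxx // IH andbA. Qed.

Lemma chainE i v j : chain i v j = chain i v (chain_end i v) && (chain_end i v == j).
Proof. by have := chain_cat i v [::] j; rewrite cats0. Qed.

Lemma chain_rcons i v k j : chain i (rcons v k) j = chain i v (a k) && (b k == j).
Proof.
rewrite -cats1 chain_cat /= [in RHS]chainE -andbA; congr (_ && _).
by rewrite eq_sym.
Qed.

Lemma chain_cat_closed i v w j z : v != [::] -> chain z v z ->
  chain i (v ++ w) j = (i == z) && chain z w j.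
Proof.
case: v => //= k v _; rewrite chainE => /and3P[/eqP az vz /eqP vE].
by rewrite chain_cat vz vE az eq_sym.
Qed.

Lemma chain_start i v j z : v != [::] -> chain z v z -> chain i v j = (i == z) && (z == j).
Proof. by move=> v0 vz; have := chain_cat_closed i [::] j v0 vz; rewrite cats0. Qed.

End Chains.

Section Letters.
Variables (K : fieldType) (A : algType K) (d : nat).
Local Notation ix := 'I_d.+1.

Definition emx (x : A) (a b : ix) : 'M[A]_d.+1 :=
  \matrix_(i, j) if (i == a) && (j == b) then x else 0.

Definition letter (c : bool) (x : A) (a b : ix) : mxop A d :=
  if c then mxL (emx x a b) else mxR (emx x a b).

Lemma mxL_emx x a b (M : mxK A d) i j :
  mxL (emx x a b) M i j = if i == a then x * M b j else 0.
Proof.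
rewrite mxLE (bigD1 b) //= big1 ?addr0 => [|k /negbTE nkb]; rewrite mxE ?nkb ?eqxx ?andbT ?andbF.
  by case: eqP; rewrite ?mul0r.
by rewrite mul0r.
Qed.

Lemma mxR_emx x a b (M : mxK A d) i j :
  mxR (emx x a b) M i j = if j == b then x * M i a else 0.
Proof.
rewrite mxRE (bigD1 a) //= big1 ?addr0 => [|k /negbTE nka]; rewrite mxE ?nka ?eqxx //=.
  by case: eqP; rewrite ?mul0r.
by rewrite mul0r.
Qed.

Lemma mxop_ext (S T : mxop A d) : (forall (M : mxK A d) i j, S M i j = T M i j) -> S = T.
Proof. by move=> ST; apply: mxopP => M; apply/matrixP=> i j; apply: ST. Qed.

Lemma mxop_linE k (S T : mxop A d) (M : mxK A d) i j :
  (k *: S + T) M i j = k *: S M i j + T M i j.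
Proof. by rewrite mxopE_add mxopE_scale [LHS]mxE [X in X + _]mxE. Qed.

Lemma letter_linear c a b : linear (fun x => letter c x a b).
Proof.
move=> k x y; apply: mxop_ext => M i j; rewrite mxop_linE; case: c => /=.
  rewrite !mxL_emx; case: eqP => _; last by rewrite scaler0 addr0.
  by rewrite mulrDl scalerAl.
rewrite !mxR_emx; case: eqP => _; last by rewrite scaler0 addr0.
by rewrite mulrDl scalerAl.
Qed.

Lemma letter0 c a b : letter c 0 a b = 0.
Proof.
apply: mxop_ext => M i j; case: c => /=; rewrite ?mxL_emx ?mxR_emx mul0r if_same;
by rewrite [RHS]mxE.
Qed.

Lemma letterM_left x a b y a' b' :
  letter true x a b * letter true y a' b' =
  if b == a' then letter true (x * y) a b' else 0.
Proof.
apply: mxop_ext => M i j; rewrite mxopE_mul /= !mxL_emx.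
case: (b == a'); rewrite ?mxL_emx ?mulr0 ?if_same ?mulrA //; by rewrite [RHS]mxE.
Qed.

(** Right operators compose backwards on indices, but the entries keep the order [x * y], because
    [mxR] multiplies the entries of its argument from the left. *)
Lemma letterM_right x a b y a' b' :
  letter false x a b * letter false y a' b' =
  if a == b' then letter false (x * y) a' b else 0.
Proof.
apply: mxop_ext => M i j; rewrite mxopE_mul /= !mxR_emx.
case: (a == b'); rewrite ?mxR_emx ?mulr0 ?if_same ?mulrA //; by rewrite [RHS]mxE.
Qed.

Lemma mxop_sumE (J : Type) (r : seq J) (F : J -> mxop A d) (M : mxK A d) i j :
  (\sum_(k <- r) F k) M i j = \sum_(k <- r) F k M i j.
Proof.
elim: r => [|k r IH]; first by rewrite !big_nil [LHS]mxE.
by rewrite !big_cons mxopE_add mxE IH.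
Qed.

Lemma mxL_sum_letter (Z : 'M[A]_d.+1) :
  mxL Z = \sum_(p : ix * ix) letter true (Z p.1 p.2) p.1 p.2.
Proof.
apply: mxop_ext => M i j; rewrite mxop_sumE mxLE.
rewrite -(pair_bigA _ (fun k l => letter true (Z k l) k l M i j)) /=.
rewrite [RHS](bigD1 i) //= [X in _ + X]big1 ?addr0 => [|k /negbTE nki].
  by apply: eq_bigr => l _; rewrite mxL_emx eqxx.
by apply: big1 => l _; rewrite mxL_emx eq_sym nki.
Qed.

Lemma mxR_sum_letter (Z : 'M[A]_d.+1) :
  mxR Z = \sum_(p : ix * ix) letter false (Z p.1 p.2) p.1 p.2.
Proof.
apply: mxop_ext => M i j; rewrite mxop_sumE mxRE.
rewrite -(pair_bigA _ (fun k l => letter false (Z k l) k l M i j)) /=.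
apply: eq_bigr => k _; rewrite (bigD1 j) //= big1 ?addr0 => [|l /negbTE nlj].
  by rewrite mxR_emx eqxx.
by rewrite mxR_emx eq_sym nlj.
Qed.

(** This and [letter_right_diag] show that [absorb] rescales the entry of the letter by the same
    diagonal coefficient, at its end point [b], for either colour. *)
Lemma letter_left_diag x a b (be : diagmx K d) :
  letter true x a b * diagL A be = letter true (diagmx_val be b b *: x) a b.
Proof.
rewrite /diagL /scalL mxL_sum_letter mulr_sumr; under eq_bigr do rewrite letterM_left.
rewrite -(pair_bigA _ (fun k l =>
  if b == k then letter true (x * scal_mx A be k l) a l else 0)) /=.
rewrite (bigD1 b) //= [X in _ + X]big1 ?addr0 => [|k /negbTE nkb]; last first.
  by apply: big1 => l _; rewrite eq_sym nkb.
rewrite (bigD1 b) //= eqxx big1 ?addr0 => [|l nlb].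
  by rewrite scal_mxE -scalerAr mulr1.
have /is_diag_mxP dE := valP be; rewrite scal_mxE dE 1?eq_sym // scale0r mulr0.
exact: (letter0 true).
Qed.

Lemma letter_right_diag x a b (be : diagmx K d) :
  diagR A be * letter false x a b = letter false (diagmx_val be b b *: x) a b.
Proof.
rewrite /diagR /scalR mxR_sum_letter mulr_suml; under eq_bigr do rewrite letterM_right.
rewrite -(pair_bigA _ (fun k l =>
  if k == b then letter false (scal_mx A be k l * x) a l else 0)) /=.
rewrite (bigD1 b) //= [X in _ + X]big1 ?addr0 => [|k /negbTE nkb]; last first.
  by apply: big1 => l _; rewrite nkb.
rewrite (bigD1 b) //= eqxx big1 ?addr0 => [|l nlb].
  by rewrite scal_mxE -scalerAl mul1r.
have /is_diag_mxP dE := valP be; rewrite scal_mxE dE 1?eq_sym // scale0r mul0r.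
exact: (letter0 false).
Qed.

Section Words.
Variables (n : nat) (chi : 'I_n -> bool) (a b : 'I_n -> ix).

(** The outermost letter adds an edge in front of the chain if it is left and behind it if it is
    right. This is the source of the order: left letters forwards, then right letters backwards. *)
Lemma prod_letters (x : 'I_n -> A) (s : seq 'I_n) i j :
  (\prod_(k <- s) letter (chi k) (x k) (a k) (b k)) (1%:M : 'M[A]_d.+1) i j =
  if chain a b i ([seq k <- s | chi k] ++ rev [seq k <- s | ~~ chi k]) j
  then \prod_(k <- s) x k else 0.
Proof.
elim: s i j => [|k s IH] i j.
  by rewrite !big_nil mxopE_one mxE /=; case: eqP.
rewrite !big_cons mxopE_mul /= /letter; case: (chi k) => /=.
  rewrite mxL_emx eq_sym IH; case: eqP => //= _.
  by case: ifP => _; rewrite ?mulr0.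
rewrite mxR_emx IH rev_cons -cats1 catA cats1 chain_rcons andbC eq_sym.
by case: eqP => //= _; case: ifP; rewrite ?mulr0.
Qed.

Definition closed_block (V : {set 'I_n}) : bool :=
  [exists z, chain a b z (chi_seq chi V) z].

Variables (phi : {linear A -> K^o}) (phi1 : phi 1 = 1).
Local Notation D := (diag_space phi1 d).
Local Notation word x := (fun k => letter (chi k) (x k) (a k) (b k)).

Lemma diag_moment1 (x : 'I_n -> A) (V : {set 'I_n}) i :
  diagmx_val (bbE D (\prod_(k in V) word x k)) i i =
  if chain a b i (chi_seq chi V) i then phi (\prod_(k in V) x k) else 0.
Proof.
rewrite !prod_in_enum /= !mxE eqxx mulr1n prod_letters.
rewrite (_ : _ ++ _ = chi_seq chi V); first by case: ifP => // _; rewrite linear0.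
rewrite /chi_seq /schi_seq /enum_mem filter_cat filter_rev -!filter_predI.
by congr (_ ++ rev _); apply: eq_filter => k /=; rewrite andbC //= andbT.
Qed.

End Words.
End Letters.

(** * Scalar and diagonal moments of a word of letters *)

Section MomentFormulas.
Variables (K : fieldType) (A : algType K) (phi : {linear A -> K^o}) (phi1 : phi 1 = 1).
Variables (n : nat) (chi : 'I_n -> bool).
Implicit Types (U V W : {set 'I_n}) (s : {set {set 'I_n}}) (x : 'I_n -> A).

Definition block_moment x V : K^o := phi (\prod_(k in V) x k).

Lemma block_moment0 x : block_moment x finset.set0 = 1.
Proof. by rewrite /block_moment big_set0 phi1. Qed.

Lemma prod_blocks_scale x y U s p (c : K) : finset.partition s U -> p \in U ->
  y p = c *: x p -> (forall k, k != p -> y k = x k) ->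
  \prod_(V in s) block_moment y V = (c : K^o) * \prod_(V in s) block_moment x V.
Proof.
move=> sP pU yp yx; have [V Vs pV] := partition_cover sP pU.
rewrite (bigD1 V) //= [in RHS](bigD1 V) //= mulrA; congr (_ * _).
  rewrite /block_moment (prod_in_scale pV yp) ?linearZ // => k _; exact: yx.
apply: eq_bigr => W /andP[Ws nWV]; congr (phi _); apply: eq_bigr => k kW.
by apply: yx; apply: contraNneq nWV => ekp; rewrite (partition_eq sP Ws Vs kW) ?ekp.
Qed.

Lemma scalar_moment x U s : s \in NC chi U -> U != finset.set0 ->
  moment (scalar_space phi1) chi s x = \prod_(V in s) block_moment x V.
Proof.
move=> sN U0.
apply: (@moment_ind K K^o A (scalar_space phi1) n chi
  (fun s x v => v = \prod_(V in s) block_moment x V) _ _ _ _ s U x sN U0).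
- by move=> V y _; rewrite big_set1.
- move=> U' V s' y v sN' Vs _ _ ->; rewrite [RHS](bigD1 V) //=; congr (_ * _).
  by apply: eq_bigl => W; rewrite !inE andbC.
- move=> U' V s' y v sN' Vs _ _ ->; rewrite [RHS](bigD1 V) //= [LHS]mulrC; congr (_ * _).
  by apply: eq_bigl => W; rewrite !inE andbC.
move=> U' V W W' s' y v p sN' Vs eW _ _ pW _ ->.
rewrite [RHS](bigD1 V) //= (prod_blocks_scale (x := y) (p := p)
  (c := block_moment y V) (NC_partition (NC_rem sN' Vs))).
- by congr (_ * _); apply: eq_bigl => X; rewrite !inE andbC.
- by rewrite eW inE pW.
- rewrite /absorb eqxx /=; case: (chi p); rewrite /scal_in.
    by rewrite -scalerAr mulr1.
  by rewrite -scalerAl mul1r.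
- by move=> k /negbTE nkp; rewrite /absorb nkp.
Qed.

Variables (d : nat) (a b : 'I_n -> 'I_d.+1).
Local Notation D := (diag_space phi1 d).
Local Notation word x := (fun k => letter (chi k) (x k) (a k) (b k)).
Local Notation closed V := (closed_block chi a b V).

Lemma setU_setD V U : V \subset U -> V :|: (U :\: V) = U.
Proof. by move=> VU; rewrite setDE setUIr setUCr setIT; exact/setUidPr. Qed.

(** [chain_initial], [chain_terminal] and [chain_inner] match the three branches of the moment
    recursion: [v] is the split-off block, and its base point is forced by the place where it is
    removed. *)
Lemma chain_initial i v w : v != [::] ->
  chain a b i (v ++ w) i && [exists z, chain a b z v z] = chain a b i v i && chain a b i w i.
Proof.
move=> v0; case: existsP => [[z vz]|nz]; last first.
  by rewrite andbF; case: (boolP (chain _ _ _ v _)) => // vi; case: nz; exists i.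
rewrite andbT (chain_cat_closed _ _ _ v0 vz) (chain_start _ _ v0 vz).
by have [->|nz] := eqVneq i z; rewrite ?eqxx.
Qed.

Lemma chain_terminal i v w : v != [::] ->
  chain a b i (w ++ v) i && [exists z, chain a b z v z] = chain a b i w i && chain a b i v i.
Proof.
move=> v0; case: existsP => [[z vz]|nz]; last first.
  by rewrite andbF; case: (boolP (chain _ _ _ v _)) => [vi|]; rewrite ?andbF //; case: nz; exists i.
rewrite andbT chain_cat !(chain_start _ _ v0 vz) [in RHS]chainE -!andbA; congr (_ && _).
by have [<-|nzi] := eqVneq z i; rewrite ?andbT ?andbF.
Qed.

Lemma chain_inner i l p v w : v != [::] ->
  chain a b i (rcons l p ++ (v ++ w)) i && [exists z, chain a b z v z] =
  chain a b i (rcons l p ++ w) i && chain a b (b p) v (b p).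
Proof.
have lE : chain_end b i (rcons l p) = b p by elim: l i => //= k l IH i; rewrite IH.
move=> v0; rewrite !(chain_cat _ _ _ (rcons l p)) lE; case: existsP => [[z vz]|nz]; last first.
  rewrite andbF; case: (boolP (chain _ _ _ v _)) => [vi|]; rewrite ?andbF //.
  by case: nz; exists (b p).
rewrite andbT (chain_cat_closed _ _ _ v0 vz) !(chain_start _ _ v0 vz) -andbA; congr (_ && _).
by have [->|nz] := eqVneq (b p) z; rewrite ?eqxx ?andbT //= andbF.
Qed.

Lemma chi_seq_neq0 V : V != finset.set0 -> chi_seq chi V != [::].
Proof.
by case/set0Pn=> x xV; apply: contraTneq xV => sV0; rewrite -(mem_chi_seq chi) sV0.
Qed.

Lemma diagM_ii (u v : diagmx K d) i :
  diagmx_val (u * v) i i = diagmx_val u i i * diagmx_val v i i.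
Proof.
have /is_diag_mxP uD := valP u.
rewrite [LHS](_ : _ = \sum_j diagmx_val u i j * diagmx_val v j i); last by rewrite [LHS]mxE.
rewrite (bigD1 i) //= big1 ?addr0 // => j nji.
by rewrite [X in X * _]uD 1?eq_sym // mul0r.
Qed.

(** Only the base point [i] of the whole word has to be tracked: the base point of a closed block is
    determined by its first edge. *)
Lemma diag_moment x U s i : s \in NC chi U -> U != finset.set0 ->
  diagmx_val (moment D chi s (word x)) i i =
  if chain a b i (chi_seq chi U) i && [forall V in s, closed V]
  then \prod_(V in s) block_moment x V else 0.
Proof.
move=> sN U0.
(* Quantifying over the entries [x] is needed because absorbing a diagonal rescales one of them. *)
pose Q s Z (v : diagmx K d) := forall x i, Z = word x -> diagmx_val v i i =
  if chain a b i (chi_seq chi (finset.cover s)) i && [forall V in s, closed V]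
  then \prod_(V in s) block_moment x V else 0.
suff : Q s (word x) (moment D chi s (word x)).
  by move/(_ x i erefl); rewrite (cover_partition (NC_partition sN)).
have closed_rem (t : {set {set 'I_n}}) V : V \in t ->
    [forall W in t, closed W] = closed V && [forall W in t :\ V, closed W].
  move=> Vt; apply/forall_inP/andP=> [cl|[clV /forall_inP cl] W Wt].
    split; first exact: cl.
    by apply/forall_inP=> W /setD1P[_]; exact: cl.
  by have [->//|nWV] := eqVneq W V; apply: cl; rewrite !inE nWV.
have prod_rem (t : {set {set 'I_n}}) V y : V \in t -> \prod_(W in t) block_moment y W =
    block_moment y V * \prod_(W in t :\ V) block_moment y W.
  by move=> Vt; rewrite (bigD1 V) //=; congr (_ * _); apply: eq_bigl => W; rewrite !inE andbC.
apply: (@moment_ind K (diagmx K d) (mxop A d) D n chi Q _ _ _ _ s U _ sN U0).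
- move=> V Z V0 y {}i ->; rewrite diag_moment1 /finset.cover !big_set1.
  have [ch|//] := boolP (chain _ _ _ _ _); have -> // : [forall W in [set V], closed W].
  by apply/forall_inP=> W /set1P->; apply/existsP; exists i.
- move=> U' V t Z v tN Vt W0 VW IH y j eZ; have tP := NC_partition tN.
  have V0 := chi_seq_neq0 (partition_ne tP Vt).
  rewrite diagM_ii (IH y j eZ) eZ diag_moment1 (cover_partition tP).
  rewrite (cover_partition (NC_partition (NC_rem tN Vt))) (closed_rem _ _ Vt).
  rewrite (prod_rem _ _ _ Vt) andbA.
  rewrite (_ : chi_seq chi U' = chi_seq chi V ++ chi_seq chi (U' :\: V)); last first.
    by rewrite -chi_seqU // (setU_setD (partition_sub tP Vt)).
  rewrite chain_initial //; case: (chain _ _ _ (chi_seq chi V) _) => /=; last by rewrite mul0r.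
  by case: ifP; rewrite ?mulr0.
- move=> U' V t Z v tN Vt W0 VW IH y j eZ; have tP := NC_partition tN.
  have V0 := chi_seq_neq0 (partition_ne tP Vt).
  rewrite diagM_ii (IH y j eZ) eZ diag_moment1 (cover_partition tP).
  rewrite (cover_partition (NC_partition (NC_rem tN Vt))) (closed_rem _ _ Vt).
  rewrite (prod_rem _ _ _ Vt) andbA.
  rewrite (_ : chi_seq chi U' = chi_seq chi (U' :\: V) ++ chi_seq chi V); last first.
    by rewrite -chi_seqU // setUC (setU_setD (partition_sub tP Vt)).
  rewrite chain_terminal // [LHS]mulrC andbAC [in RHS]andbC.
  case: (chain _ _ _ (chi_seq chi V) _) => /=; last by rewrite mul0r.
  by rewrite andbC; case: ifP; rewrite ?mulr0.
move=> U' V W W' t Z v p tN Vt eW WV VW pW pmax IH y j eZ; have tP := NC_partition tN.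
have V0 := chi_seq_neq0 (partition_ne tP Vt).
have rP := NC_partition (NC_rem tN Vt).
(* The absorbed diagonal acts through its coefficient at [b p], which is exactly where the chain of
   [V] has to start and end. *)
pose c := diagmx_val (bbE D (\prod_(k in V) word y k)) (b p) (b p).
pose y' k := if k == p then c *: y k else y k.
rewrite (IH y' j); last first.
  apply/funext=> k; rewrite /absorb /y' eZ; case: eqP => // ->.
  by case: (chi p); [exact: letter_left_diag|exact: letter_right_diag].
rewrite (prod_blocks_scale (x := y) (p := p) (c := c) rP); first last.
- by move=> k /negbTE nkp; rewrite /y' nkp.
- by rewrite /y' eqxx.
- by rewrite eW inE pW.
rewrite (cover_partition tP) (cover_partition rP) (closed_rem _ _ Vt) (prod_rem _ _ _ Vt) andbA.
have WW' : {in W & W', forall w w', chi_lt chi w w'}.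
  have [v0 v0V] := partition_ex tP Vt.
  by move=> w w' wW wW'; exact: chi_lt_trans (WV _ _ wW v0V) (VW _ _ v0V wW').
have Wp : chi_seq chi W = rcons (chi_seq chi (W :\ p)) p.
  have {1}-> : W = (W :\ p) :|: [set p] by rewrite setUC setD1K.
  rewrite chi_seqU => [|w w' /setD1P[nwp wW] /set1P->]; last exact: pmax.
  rewrite -cats1 {2}/chi_seq (eq_filter (a2 := pred1 p)) => [|k]; last by rewrite inE.
  by rewrite filter_pred1_uniq ?schi_seq_uniq ?mem_schi_seq.
have UW : U' = W :|: (V :|: W').
  apply/setP=> k; have /setP/(_ k) := eW; rewrite !inE.
  case: (boolP (k \in V)) => [kV _|kV /= <-] //.
  by rewrite (partition_in tP Vt kV) orbT.
rewrite eW UW !chi_seqU //; last first.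
  by move=> w w' wW /setUP[]; [exact: WV|exact: WW'].
rewrite Wp chain_inner // /c diag_moment1.
case: (chain _ _ (b p) _ _); last by rewrite andbF mul0r if_same.
by rewrite andbT.
Qed.

End MomentFormulas.

(** * Multilinearity of cumulants and reduction to spanning sets *)

Section Multilinear.
Variables (K : fieldType) (B A : algType K) (S : bb_space B A).
Variables (n : nat) (chi : 'I_n -> bool).
Implicit Types (Z : 'I_n -> A) (s : {set {set 'I_n}}).

Definition upd Z (k : 'I_n) (x : A) : 'I_n -> A := fun j => if j == k then x else Z j.

Lemma upd_id Z k : upd Z k (Z k) = Z.
Proof. by apply/funext=> j; rewrite /upd; case: eqP => // ->. Qed.

Lemma prod_upd_linear Z (V : {set 'I_n}) k c x y : k \in V ->
  \prod_(j in V) upd Z k (c *: x + y) j =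
  c *: \prod_(j in V) upd Z k x j + \prod_(j in V) upd Z k y j.
Proof.
rewrite !prod_in_enum -(mem_enum V); elim: (enum V) (enum_uniq V) => //= j s IH.
case/andP=> js sU; rewrite inE !big_cons => kjs; have [ejk|njk] := eqVneq j k.
  have same z : \prod_(i <- s) upd Z k z i = \prod_(i <- s) Z i.
    apply: eq_big_seq => i si; rewrite /upd; case: eqP => // eik.
    by rewrite ejk -eik si in js.
  by rewrite !same ejk /upd eqxx mulrDl scalerAl.
rewrite IH //; last by move: kjs; rewrite eq_sym (negbTE njk).
by rewrite /upd (negbTE njk) mulrDr scalerAr.
Qed.

Lemma sub_cover_rem s V : finset.cover (s :\ V) \subset finset.cover s.
Proof.
by apply/bigcupsP=> W /setD1P[_ Ws]; exact: bigcup_sup.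
Qed.

Lemma moment_rec_ext m s Z Z' : {in finset.cover s, Z =1 Z'} ->
  moment_rec S chi m s Z = moment_rec S chi m s Z'.
Proof.
have prodE (V : {set 'I_n}) Y Y' : {in V, Y =1 Y'} ->
    bbE S (\prod_(k in V) Y k) = bbE S (\prod_(k in V) Y' k).
  by move=> YY; congr (bbE S _); exact: eq_bigr.
elim: m s Z Z' => [|m IH] s Z Z' ZZ /=; first exact: prodE.
case: pickP => [V /andP[Vs _]|_]; last exact: prodE.
have bE : bbE S (\prod_(k in V) Z k) = bbE S (\prod_(k in V) Z' k).
  by apply: prodE => k kV; apply: ZZ; apply/bigcupP; exists V.
have rE : {in finset.cover (s :\ V), Z =1 Z'}.
  by move=> k /(subsetP (sub_cover_rem s V)); exact: ZZ.
case: ifP => _; first by rewrite bE (IH _ _ _ rE).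
case: ifP => _; first by rewrite bE (IH _ _ _ rE).
case: pickP => // p _; apply: IH => k ks; rewrite /absorb bE.
by case: eqP => [<-|_]; rewrite rE.
Qed.

(** If [k] lies in the split-off block, its contribution enters through [beta] and is handed over to
    the slot [p] that absorbs it; hence the induction treats all slots at once. *)
Lemma moment_rec_linear m s Z k c x y : trivIset s -> k \in finset.cover s ->
  moment_rec S chi m s (upd Z k (c *: x + y)) =
  c *: moment_rec S chi m s (upd Z k x) + moment_rec S chi m s (upd Z k y).
Proof.
elim: m s Z k c x y => [|m IH] s Z k c x y sT ks /=.
  by rewrite prod_upd_linear // linearP.
case: pickP => [V /andP[Vs _]|_]; last by rewrite prod_upd_linear // linearP.
have sT' : trivIset (s :\ V) by apply: trivIsetS sT; exact: subsetDl.
have [kV|kV] := boolP (k \in V).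
  have kR : k \notin finset.cover (s :\ V).
    apply/bigcupP=> -[W /setD1P[nWV Ws] kW]; move/trivIsetP: sT => /(_ _ _ Ws Vs nWV).
    by move/disjointFr/(_ kW); rewrite kV.
  have rE z : moment_rec S chi m (s :\ V) (upd Z k z) = moment_rec S chi m (s :\ V) Z.
    apply: moment_rec_ext => j jR; rewrite /upd; case: eqP => // ejk.
    by rewrite -ejk jR in kR.
  rewrite prod_upd_linear // linearP !rE; case: ifP => _; first by rewrite mulrDl scalerAl.
  case: ifP => _; first by rewrite mulrDr scalerAr.
  case: pickP => [p /andP[/setDP[pU pV] _]|_]; last by rewrite scaler0 addr0.
  have pR : p \in finset.cover (s :\ V).
    case/bigcupP: pU => W Ws pW; apply/bigcupP; exists W => //; rewrite !inE Ws andbT.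
    by apply: contraNneq pV => <-.
  pose f be := if chi p then Z p * bbL S be else bbR S be * Z p.
  have aE be z : moment_rec S chi m (s :\ V) (absorb S chi be p (upd Z k z)) =
      moment_rec S chi m (s :\ V) (upd Z p (f be)).
    apply: moment_rec_ext => j jR; rewrite /absorb /upd /f; case: (eqVneq j p) => [_|_].
      by case: eqP => // epk; rewrite -epk pR in kR.
    by case: eqP => // ejk; rewrite -ejk jR in kR.
  rewrite !aE -IH //; congr (moment_rec _ _ _ _ (upd _ _ _)); rewrite /f.
  by case: (chi p); rewrite linearP; [rewrite mulrDr scalerAr|rewrite mulrDl scalerAl].
have kR : k \in finset.cover (s :\ V).
  case/bigcupP: ks => W Ws kW; apply/bigcupP; exists W => //; rewrite !inE Ws andbT.
  by apply: contraNneq kV => <-.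
have bE z : \prod_(j in V) upd Z k z j = \prod_(j in V) Z j.
  by apply: eq_bigr => j jV; rewrite /upd; case: eqP => // ejk; rewrite -ejk jV in kV.
rewrite !bE IH //; case: ifP => _; first by rewrite mulrDr scalerAr.
case: ifP => _; first by rewrite mulrDl scalerAl.
case: pickP => [p _|_]; last by rewrite scaler0 addr0.
set be := bbE S _; pose f z := if k == p then
  (if chi p then z * bbL S be else bbR S be * z) else z.
have aE z : absorb S chi be p (upd Z k z) = upd (absorb S chi be p Z) k (f z).
  apply/funext=> j; rewrite /absorb /upd /f; have [->|njk] := eqVneq j k.
    by case: eqP => // ->; rewrite eqxx.
  by case: (eqVneq j p) => [ejp|//]; rewrite -ejp (negbTE njk).
rewrite !aE -IH //; congr (moment_rec _ _ _ _ (upd _ _ _)); rewrite /f.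
by case: eqP => // _; case: (chi p); [rewrite mulrDl scalerAl|rewrite mulrDr scalerAr].
Qed.

Lemma cumulant1_linear Z k c x y :
  cumulant1 S chi (upd Z k (c *: x + y)) =
  c *: cumulant1 S chi (upd Z k x) + cumulant1 S chi (upd Z k y).
Proof.
rewrite /cumulant1 /cumulant scaler_sumr -big_split /=; apply: eq_bigr => s /andP[].
rewrite BNC_NC => sN _; have sP := NC_partition sN.
rewrite /moment moment_rec_linear.
- by rewrite mulrzDl scalerMzr.
- by case/and3P: sP.
- by rewrite (cover_partition sP) inE.
Qed.

Inductive lin_span (G : A -> Prop) : A -> Prop :=
| lin_span0 : lin_span G 0
| lin_spanD c x y : G x -> lin_span G y -> lin_span G (c *: x + y).

Lemma cumulant1_span (G : 'I_n -> A -> Prop) :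
  (forall Z, (forall k, G k (Z k)) -> cumulant1 S chi Z = 0) ->
  forall Z, (forall k, lin_span (G k) (Z k)) -> cumulant1 S chi Z = 0.
Proof.
move=> G0 Z ZG.
(* Slots from [r] on already hold generators; each step expands slot [r] and lowers the bound. *)
suff H (r : nat) : forall Z, (forall k, lin_span (G k) (Z k)) ->
    (forall k : 'I_n, (r <= k)%N -> G k (Z k)) -> cumulant1 S chi Z = 0.
  by apply: (H n) => // k; rewrite leqNgt ltn_ord.
elim: r => [|r IH] {ZG}Z ZG Zr; first by apply: G0 => k; exact: Zr.
have [ltrn|lenr] := ltnP r n; last first.
  by apply: IH => // k lek; have := leq_ltn_trans lek (ltn_ord k); rewrite ltnNge lenr.
pose k := Ordinal ltrn; rewrite -(upd_id Z k).
elim: (ZG k) => [|c x y Gx _ IHy].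
  by have := cumulant1_linear Z k (-1) 0 0; rewrite scaler0 addr0 scaleN1r addNr.
rewrite cumulant1_linear IHy addr0 IH ?scaler0 // => j.
  rewrite /upd; case: eqP => // ->; rewrite -[x]scale1r -[_ *: x]addr0.
  by apply: lin_spanD => //; exact: lin_span0.
rewrite /upd; case: (eqVneq j k) => [->//|njk lerj]; apply: Zr.
by rewrite ltn_neqAle lerj andbT; apply: contra njk => /eqP erj; apply/eqP/val_inj.
Qed.

End Multilinear.

Section LinSpan.
Variables (K : fieldType) (A : algType K) (G : A -> Prop).

Lemma lin_span_sub x : G x -> lin_span G x.
Proof.
move=> Gx; rewrite -[x]scale1r -[_ *: x]addr0.
by apply: lin_spanD => //; exact: lin_span0.
Qed.

Lemma lin_span_comb c x y : lin_span G x -> lin_span G y -> lin_span G (c *: x + y).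
Proof.
move=> Gx Gy; elim: Gx => [|c' x' y' Gx' _ IH]; first by rewrite scaler0 add0r.
by rewrite scalerDr scalerA -addrA; apply: lin_spanD.
Qed.

Lemma lin_span_add x y : lin_span G x -> lin_span G y -> lin_span G (x + y).
Proof. by move=> Gx Gy; rewrite -[x]scale1r; apply: lin_span_comb. Qed.

Lemma lin_span_scale c x : lin_span G x -> lin_span G (c *: x).
Proof. by move=> Gx; rewrite -[_ *: x]addr0; apply: lin_span_comb => //; exact: lin_span0. Qed.

Lemma lin_span_sum (I : finType) (F : I -> A) :
  (forall i, lin_span G (F i)) -> lin_span G (\sum_i F i).
Proof.
by move=> GF; elim/big_ind: _ => // [|x y]; [exact: lin_span0|exact: lin_span_add].
Qed.

Lemma lin_span_mul x y : (forall u v, G u -> G v -> lin_span G (u * v)) ->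
  lin_span G x -> lin_span G y -> lin_span G (x * y).
Proof.
move=> GM Gx Gy; elim: Gx => [|c u x' Gu _ IH]; first by rewrite mul0r; exact: lin_span0.
rewrite mulrDl -scalerAl; apply: lin_span_comb => //.
elim: Gy => [|c' v y' Gv _ IH']; first by rewrite mulr0; exact: lin_span0.
by rewrite mulrDr -scalerAr; apply: lin_span_comb => //; exact: GM.
Qed.

End LinSpan.

(** * Cumulants as Möbius sums, cumulants of subwords *)

Lemma enum_ltn_sorted n (V : {set 'I_n}) : sorted (fun i j : 'I_n => (i < j)%N) (enum V).
Proof.
have tr : transitive (fun i j : 'I_n => (i < j)%N) by move=> y x z; exact: ltn_trans.
apply: (@subseq_sorted _ _ tr _ (enum 'I_n)).
  by rewrite /enum_mem [X in subseq _ X](eq_filter (a2 := predT)) // filter_predT filter_subseq.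
by have := iota_ltn_sorted 0 n; rewrite -val_enum_ord sorted_map.
Qed.

Lemma prod_imset (R : pzSemiRingType) (n k : nat) (g : 'I_k -> 'I_n) (x : 'I_n -> R)
    (B : {set 'I_k}) :
  (forall i j : 'I_k, (i < j)%N -> (g i < g j)%N) ->
  \prod_(p in g @: B) x p = \prod_(j in B) x (g j).
Proof.
move=> gM; rewrite !prod_in_enum -(big_map g predT x); congr (\big[_/_]_(i <- _ | _) _).
apply: (irr_sorted_eq (leT := fun i j : 'I_n => (i < j)%N)).
- by move=> y x' z; exact: ltn_trans.
- by move=> y; exact: ltnn.
- exact: enum_ltn_sorted.
- by apply: (homo_sorted gM); exact: enum_ltn_sorted.
- move=> p; rewrite mem_enum; apply/imsetP/mapP=> -[j jB ->]; exists j => //.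
    by rewrite mem_enum.
  by rewrite -mem_enum.
Qed.

Lemma enum_val_increasing (n : nat) (V : {set 'I_n}) (i j : 'I_#|V|) :
  (i < j)%N -> (enum_val i < enum_val j)%N.
Proof.
have x0 : 'I_n by exact: (enum_val i).
rewrite !(enum_val_nth x0) => ij.
have := ltn_ord i; have := ltn_ord j; move: (i : nat) (j : nat) ij => {}i {}j ij jV iV.
apply: (sorted_ltn_nth _ _ (enum_ltn_sorted V)) => //; rewrite ?inE -?cardE //.
by move=> y x' z; exact: ltn_trans.
Qed.

Lemma enum_val_imset (T : finType) (V : {set T}) :
  [set enum_val i | i in [set: 'I_#|V|]] = V.
Proof.
apply/setP=> x; apply/imsetP/idP=> [[i _ ->]|xV]; first exact: enum_valP.
by exists (enum_rank_in xV x); rewrite ?inE ?enum_rankK_in.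
Qed.

Lemma cumulant1E (K : fieldType) (B A : algType K) (S : bb_space B A)
    (n : nat) (chi : 'I_n -> bool) Z :
  cumulant1 S chi Z = \sum_(s in BNC chi)
    moment S chi s Z *~ moebius (BNC chi) (@refines n) s [set [set: 'I_n]].
Proof.
apply: eq_bigl => s; case: (boolP (s \in BNC chi)) => //=; rewrite BNC_NC => sN.
exact: refines_top (NC_partition sN).
Qed.

Section CumulantSums.
Variables (K : fieldType) (A : algType K).
Variables (phi : {linear A -> K^o}) (phi1 : phi 1 = 1).
Local Notation C := (scalar_space phi1).

Lemma ord_setT_neq0 n : (0 < n)%N -> [set: 'I_n] != finset.set0.
Proof. by move=> n0; apply/set0Pn; exists (Ordinal n0); exact: in_setT. Qed.

Lemma scalar_cumulantE n (chi : 'I_n -> bool) x : (0 < n)%N ->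
  cumulant1 C chi x = \sum_(s in BNC chi)
    (\prod_(V in s) block_moment phi x V) *~
      moebius (BNC chi) (@refines n) s [set [set: 'I_n]].
Proof.
move=> n0; rewrite cumulant1E; apply: eq_bigr => s; rewrite BNC_NC => sN.
by rewrite (scalar_moment phi1 x sN) ?ord_setT_neq0.
Qed.

Lemma diag_cumulantE n (chi : 'I_n -> bool) x d (a b : 'I_n -> 'I_d.+1) i : (0 < n)%N ->
  diagmx_val (cumulant1 (diag_space phi1 d) chi
    (fun k => letter (chi k) (x k) (a k) (b k))) i i =
  \sum_(s in BNC chi)
    (if chain a b i (chi_seq chi [set: 'I_n]) i && [forall V in s, closed_block chi a b V]
     then \prod_(V in s) block_moment phi x V else 0) *~
      moebius (BNC chi) (@refines n) s [set [set: 'I_n]].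
Proof.
move=> n0; rewrite cumulant1E.
have entry_sum (P : pred {set {set 'I_n}}) (F : _ -> diagmx K d) :
    diagmx_val (\sum_(s | P s) F s) i i = \sum_(s | P s) diagmx_val (F s) i i.
  by elim/big_ind2: _ => [|u u' v v' <- <-|//]; rewrite [LHS]mxE.
rewrite entry_sum; apply: eq_bigr => s; rewrite BNC_NC => sN.
rewrite -(diag_moment phi1) ?ord_setT_neq0 //; move: (moment _ _ _ _) (moebius _ _ _ _) => u m.
have natE k : diagmx_val (u *+ k) i i = diagmx_val u i i *+ k.
  by elim: k => [|k IH]; rewrite ?mulrS ?mulr0n [LHS]mxE ?IH.
case: m => k; first by rewrite -!pmulrn natE.
by rewrite NegzE !mulrNz -!pmulrn [LHS]mxE natE.
Qed.

Section Restrict.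
Variables (n k : nat) (chi : 'I_n -> bool) (x : 'I_n -> A) (c : {set 'I_n} -> K^o).
Hypothesis cE : forall U, U != finset.set0 ->
  block_moment phi x U = \sum_(t in NC chi U) \prod_(W in t) c W.

(** Identifies the abstract solution [c] on subsets with actual cumulants: transported along [g],
    the equations of [c] are the moment-cumulant equations of the subword, which Möbius inversion
    solves. *)
Lemma cumulant_restrict (g : 'I_k -> 'I_n) : (0 < k)%N ->
  (forall i j : 'I_k, (i < j)%N -> (g i < g j)%N) ->
  cumulant1 C (chi \o g) (x \o g) = c (g @: [set: 'I_k]).
Proof.
move=> k0 gM; rewrite scalar_cumulantE //.
apply: (moebius_moments (c := fun B => c (g @: B))) => // U U0.
rewrite /block_moment -(prod_imset _ _ gM) [LHS]cE.
  exact (@sum_NC_imset n k chi g gM K^o c U).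
by case/set0Pn: U0 => u uU; apply/set0Pn; exists (g u); rewrite imset_f.
Qed.

End Restrict.

(** Isolating [k] leaves every product of block moments unchanged, since a factor 1 drops out of its
    block and has moment 1 alone. The summand is thus invariant under the meet with [w]. *)
Lemma cumulant_one n (chi : 'I_n -> bool) x k : (1 < n)%N -> x k = 1 ->
  cumulant1 C chi x = 0.
Proof.
move=> n1 xk; have n0 := ltnW n1; rewrite scalar_cumulantE //.
pose w : {set {set 'I_n}} := [set [set k]; ~: [set k]].
have k0 : ~: [set k] != finset.set0.
  by rewrite -card_gt0 cardsC1 card_ord -subn1 subn_gt0.
have nw : [set k] != ~: [set k].
  by apply/eqP=> /setP/(_ k); rewrite !inE eqxx.
have wP : finset.partition w [set: 'I_n].
  apply: partition_intro => [V _|V|y _|V W].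
  - exact: subsetT.
  - by case/set2P=> ->; [exists k; rewrite inE|exact/set0Pn].
  - have [->|nyk] := eqVneq y k; first by exists [set k]; rewrite !inE ?eqxx.
    by exists (~: [set k]); rewrite !inE ?eqxx ?orbT.
  - by case/set2P=> -> /set2P[] -> y //; rewrite !inE; case: eqP.
have wN : w \in BNC chi.
  rewrite BNC_NC inE wP /=; apply/noncrossingP=> V W a b c e.
  case/set2P=> -> /set2P[] -> //.
    by move=> /set1P-> _ /set1P-> _ kb bk; have := chi_lt_trans kb bk; rewrite chi_ltxx.
  by move=> _ /set1P-> _ /set1P-> _ kc ck; have := chi_lt_trans kc ck; rewrite chi_ltxx.
apply: (@sum_moebius_meet _ (BNC chi) (@refines n) (@BNC_refines_refl n chi)
  (@BNC_refines_trans n chi) (@BNC_refines_anti n chi) K^o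
  (fun s => \prod_(V in s) block_moment phi x V) (fun s => pmeet s w) w _ wN (top_BNC chi n0)).
- apply/eqP=> /setP/(_ [set: 'I_n]); rewrite !inE eqxx => /orP[]/eqP/setP.
    case/set0Pn: k0 => y; rewrite !inE => nyk /(_ y); by rewrite !inE (negbTE nyk).
  by move=> /(_ k); rewrite !inE eqxx.
- by move=> s; rewrite BNC_NC => sN; exact: refines_top (NC_partition sN).
- by move=> s sN; exact: NC_pmeet.
- move=> s t; rewrite BNC_NC => sN tN.
  exact: refines_pmeet (NC_partition sN) (NC_partition tN) wP.
move=> s sN; rewrite (prod_pmeet (NC_partition sN) wP (block_moment0 phi1 x)).
apply: eq_bigr => V _; rewrite big_setU1 /=; last by rewrite inE.
rewrite big_set1.
have -> : block_moment phi x (V :&: [set k]) = 1.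
  rewrite /block_moment big1 // => j; rewrite !inE => /andP[_ /eqP->//].
rewrite mul1r /block_moment; congr (phi _).
rewrite [RHS](eq_bigr (fun j => if j \in ~: [set k] then x j else 1)) => [|j _]; last first.
  by rewrite !inE; case: eqP => [->|].
by rewrite -big_mkcondr; apply: eq_bigl => j; rewrite !inE.
Qed.

End CumulantSums.
(* [arc x z y]: going round the circle from [x] to [y], one meets [z] strictly
   in between; for [x = y] the arc is the whole circle minus [x]. *)
Definition arc (x z y : nat) : bool :=
  ((x < z) && (z < y) || (y <= x) && ((x < z) || (z < y)))%N.

(** Pairs that separate each other on the circle alternate linearly in one of four rotations, to
    each of which linear non-crossing applies. *)
Lemma arc_interlaced x y x' y' : x != x' -> arc x y x' -> arc x' y' x ->
  [\/ [&& x < y, y < x' & x' < y']%N, [&& y' < x, x < y & y < x']%N,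
      [&& x' < y', y' < x & x < y]%N | [&& y < x', x' < y' & y' < x]%N].
Proof.
rewrite /arc => nxx xyx xyx'; have [ltxx|lexx] := ltnP x x'.
  have [y'x|xy'] := ltnP y' x; [constructor 2|constructor 1]; lia.
have [y'x|xy'] := ltnP x y; [constructor 3|constructor 4]; lia.
Qed.

(** * Walks through blocks, and the gaps of a set on the circle *)

Section Walk.
Variables (T : finType) (I : Type) (a b : T -> I) (rho : T -> nat) (Y : {set T}) (sm : rel T).
Hypotheses (sm_refl : reflexive sm) (sm_sym : symmetric sm) (sm_trans : transitive sm).
Hypothesis rho_inj : {in Y &, injective rho}.
Hypothesis sm_sub : forall x y, x \in Y -> sm x y -> y \in Y.
Hypothesis sm_nc : forall s q t p, s \in Y -> q \in Y -> sm s t -> sm q p ->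
  (rho s < rho q)%N -> (rho q < rho t)%N -> (rho t < rho p)%N -> sm s q.
Hypothesis sm_closed : forall p q, p \in Y -> sm p q ->
  (forall z, sm p z -> (rho q <= rho z <= rho p)%N) -> a q = b p.
Let saturated p := forall s t, s \in Y -> (rho s <= rho p)%N -> sm s t -> (rho t <= rho p)%N.
Hypothesis link : forall u q, u \in Y -> q \in Y -> (rho u < rho q)%N ->
  (forall z, z \in Y -> ~~ (rho u < rho z < rho q)%N) -> saturated u -> a q = b u.

(** The walk goes backwards. By saturation [p] is the last point of its block, so closedness leads
    from [b p] to the first point [q] of that block; [link] then leads to the point [u] of [Y]
    before [q], where the argument repeats until [f] is reached. *)
Lemma walk f p : f \in Y -> (forall z, z \in Y -> (rho f <= rho z)%N) ->
  p \in Y -> saturated p -> b p = a f.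
Proof.
move=> fY fmin; have [m] := ubnP (rho p); elim: m p => // m IH p ltpm pY satp.
case: (arg_minnP rho (sm_refl p)) => q pq qmin.
have qY := sm_sub pY pq.
have bq : a q = b p.
  by apply: sm_closed => // z pz; rewrite qmin //= (satp p z).
have [eqf|nqf] := eqVneq q f; first by rewrite -bq eqf.
have ltfq : (rho f < rho q)%N.
  by rewrite ltn_neqAle fmin // andbT; apply: contra nqf => /eqP/rho_inj->.
have fP : (f \in Y) && (rho f < rho q)%N by rewrite fY.
case: (@arg_maxnP _ f (fun z => (z \in Y) && (rho z < rho q)%N) rho fP) => u /andP[uY ltuq] umax.
have adj z : z \in Y -> ~~ (rho u < rho z < rho q)%N.
  move=> zY; apply/negP=> /andP[uz zq].
  by have /= := umax z; rewrite zY zq leqNgt uz => /(_ isT).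
have leqp : (rho q <= rho p)%N := satp p q pY (leqnn _) pq.
(* A block leaving the segment up to [u] would jump over [q] and stop before [p], so it would cross
   the block of [p]. *)
have satu : saturated u.
  move=> s t sY su st; rewrite leqNgt; apply/negP=> ut; have tY := sm_sub sY st.
  have nps : ~~ sm p s.
    by apply/negP=> /qmin qs; have := leq_trans qs su; rewrite leqNgt ltuq.
  have ntp z : sm p z -> rho t != rho z.
    move=> pz; apply: contra nps => /eqP/(rho_inj tY (sm_sub pY pz)) etz.
    by apply: (sm_trans pz); rewrite -etz sm_sym.
  have qt : (rho q < rho t)%N.
    rewrite ltn_neqAle eq_sym ntp //= leqNgt; apply/negP=> tq.
    by have := adj t tY; rewrite ut tq.
  have tp : (rho t < rho p)%N.
    rewrite ltn_neqAle ntp //= (satp s) //.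
    exact: leq_trans su (leq_trans (ltnW ltuq) leqp).
  case/negP: nps; apply: (sm_trans pq); rewrite sm_sym.
  by apply: (@sm_nc s q t p) => //; [rewrite sm_sym|exact: leq_ltn_trans su ltuq].
rewrite -bq (link uY qY ltuq adj satu); apply: IH => //.
by rewrite -ltnS; apply: leq_trans ltpm; exact: leq_trans ltuq leqp.
Qed.

End Walk.

Section Gaps.
Variables (T : finType) (r : T -> nat).
Hypothesis r_inj : injective r.
Implicit Types (V B : {set T}) (x y z : T).

(** The classes are [V] itself and its gaps, the maximal arcs of the circle avoiding [V]: distinct
    points share a gap when one of the two arcs between them misses [V]. *)
Definition gapeq V x y : bool :=
  ((x \in V) == (y \in V)) &&
  [|| x \in V, x == y, [forall v in V, ~~ arc (r x) (r v) (r y)]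
             | [forall v in V, ~~ arc (r y) (r v) (r x)]].

Lemma gapeqP V x y : x \notin V -> y \notin V ->
  reflect [\/ x = y, {in V, forall v, ~~ arc (r x) (r v) (r y)} |
              {in V, forall v, ~~ arc (r y) (r v) (r x)}] (gapeq V x y).
Proof.
move=> xV yV; rewrite /gapeq (negbTE xV) (negbTE yV) /=.
by apply: (iffP or3P) => -[/eqP|/forall_inP|/forall_inP] H;
  [constructor 1|constructor 2|constructor 3|constructor 1|constructor 2|constructor 3].
Qed.

Lemma gapeq_refl V : reflexive (gapeq V).
Proof. by move=> x; rewrite /gapeq !eqxx /= orbT. Qed.

Lemma gapeq_sym V : symmetric (gapeq V).
Proof.
move=> x y; rewrite /gapeq eq_sym [x == y]eq_sym; case: eqP => //= ->.
by congr [|| _, _ | _]; rewrite orbC.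
Qed.

Lemma gapeq_trans V : transitive (gapeq V).
Proof.
move=> y x z xy yz; have [xV|xV] := boolP (x \in V).
  have yV : y \in V by case/andP: xy => /eqP <-.
  have zV : z \in V by case/andP: yz => /eqP <-.
  by rewrite /gapeq xV zV.
have yV : y \notin V by case/andP: xy => /eqP <-.
have zV : z \notin V by case/andP: yz => /eqP <-.
have nx v : v \in V -> r v != r x by move=> vV; apply: contraNneq xV => /r_inj <-.
have ny v : v \in V -> r v != r y by move=> vV; apply: contraNneq yV => /r_inj <-.
have nz v : v \in V -> r v != r z by move=> vV; apply: contraNneq zV => /r_inj <-.
have [->|nxz] := eqVneq x z; first exact: gapeq_refl.
have {}nxz : r x != r z by rewrite (inj_eq r_inj).
case/(gapeqP xV yV): xy => [->//|xy|yx]; case/(gapeqP yV zV): yz => [eyz|yz|zy];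
  apply/(gapeqP xV zV).
- by rewrite -eyz; constructor 2.
- have [xyz|xyz] := boolP (arc (r x) (r y) (r z)); [constructor 2|constructor 2] => v vV;
  move: (xy v vV) (yz v vV) (nx v vV) (ny v vV) (nz v vV); rewrite /arc in xyz *; lia.
- have [xyz|xyz] := boolP (arc (r x) (r z) (r y)); [constructor 2|constructor 3] => v vV;
  move: (xy v vV) (zy v vV) (nx v vV) (ny v vV) (nz v vV); rewrite /arc in xyz *; lia.
- by rewrite -eyz; constructor 3.
- have [xyz|xyz] := boolP (arc (r y) (r z) (r x)); [constructor 3|constructor 2] => v vV;
  move: (yx v vV) (yz v vV) (nx v vV) (ny v vV) (nz v vV); rewrite /arc in xyz *; lia.
- have [xyz|xyz] := boolP (arc (r z) (r y) (r x)); [constructor 3|constructor 3] => v vV;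
  move: (yx v vV) (zy v vV) (nx v vV) (ny v vV) (nz v vV); rewrite /arc in xyz *; lia.
Qed.

(** Together with [gapeq_intro], the working criterion: distinct points off [V] are in different
    gaps exactly when [V] meets both arcs between them. *)
Lemma gapeq_elim V x y v v' : x \notin V -> y \notin V -> gapeq V x y -> x != y ->
  v \in V -> v' \in V -> arc (r x) (r v) (r y) -> arc (r y) (r v') (r x) -> False.
Proof.
move=> xV yV xy nxy vV vV'; case/(gapeqP xV yV): xy => [exy|xy|xy].
- by rewrite exy eqxx in nxy.
- by rewrite (negbTE (xy v vV)).
- by rewrite (negbTE (xy v' vV')).
Qed.

Lemma gapeq_intro V x y : x \notin V -> y \notin V ->
  (x != y -> forall v v', v \in V -> v' \in V ->
     arc (r x) (r v) (r y) -> arc (r y) (r v') (r x) -> False) ->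
  gapeq V x y.
Proof.
move=> xV yV H; apply/(gapeqP xV yV); have [->|nxy] := eqVneq x y; first by constructor 1.
have [/exists_inP[v vV xvy]|] := boolP [exists v in V, arc (r x) (r v) (r y)].
  constructor 3 => v' vV'; apply/negP; exact: (H nxy v v').
by rewrite negb_exists_in => /forall_inP; constructor 2.
Qed.

Lemma gapeq_sub V V' x y : V' \subset V -> x \notin V -> y \notin V ->
  gapeq V x y -> gapeq V' x y.
Proof.
move=> VV xV yV xy; apply: gapeq_intro.
- by apply: contra xV; exact: (subsetP VV).
- by apply: contra yV; exact: (subsetP VV).
- move=> nxy v v' /(subsetP VV) vV /(subsetP VV) vV'.
  exact: (gapeq_elim xV yV xy nxy vV vV').
Qed.

Definition gap_part V := equivalence_partition (gapeq V) [set: T].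

Lemma gapeq_equiv V : {in [set: T] & &, equivalence_rel (gapeq V)}.
Proof.
move=> x y z _ _ _; split=> [|xy]; first exact: gapeq_refl.
apply/idP/idP=> [xz|yz]; last exact: gapeq_trans xy yz.
by apply: gapeq_trans xz; rewrite gapeq_sym.
Qed.

Lemma gap_partition V : finset.partition (gap_part V) [set: T].
Proof. exact/equivalence_partitionP/gapeq_equiv. Qed.

Lemma gap_blockE V B x y : B \in gap_part V -> x \in B -> (y \in B) = gapeq V x y.
Proof.
move=> BV xB; have tr : trivIset (gap_part V) by case/and3P: (gap_partition V).
rewrite -(def_pblock tr BV xB) (pblock_equivalence_partition (@gapeq_equiv V)) //.
Qed.

Lemma gap_part_self V : V != finset.set0 -> V \in gap_part V.
Proof.
case/set0Pn=> v vV; have [B BV vB] := partition_cover (gap_partition V) (in_setT v).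
suff eVB : V = B by rewrite {1}eVB.
apply/setP=> y; rewrite (gap_blockE _ BV vB) /gapeq vV /= andbT.
by rewrite eq_sym; case: (y \in V).
Qed.

Lemma gapeq_nc V x y x' y' : gapeq V x x' -> gapeq V y y' ->
  (r x < r y)%N -> (r y < r x')%N -> (r x' < r y')%N -> gapeq V x y.
Proof.
move=> xx yy xy yx xy'; have [xV|xV] := boolP (x \in V).
  have xV' : x' \in V by case/andP: xx => /eqP <-.
  have [yV|yV] := boolP (y \in V); first by rewrite /gapeq xV yV.
  have yV' : y' \notin V by case/andP: yy => /eqP <-.
  case/(gapeqP yV yV'): yy => [eyy|/(_ _ xV')|/(_ _ xV)].
  - by move: xy'; rewrite -eyy; lia.
  - by rewrite /arc; lia.
  - by rewrite /arc; lia.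
have xV' : x' \notin V by case/andP: xx => /eqP <-.
have [yV|yV] := boolP (y \in V).
  have yV' : y' \in V by case/andP: yy => /eqP <-.
  case/(gapeqP xV xV'): xx => [exx|/(_ _ yV)|/(_ _ yV')].
  - by move: yx; rewrite -exx; lia.
  - by rewrite /arc; lia.
  - by rewrite /arc; lia.
have yV' : y' \notin V by case/andP: yy => /eqP <-.
have nx v : v \in V -> r v != r x by move=> vV; apply: contraNneq xV => /r_inj <-.
have nx' v : v \in V -> r v != r x' by move=> vV; apply: contraNneq xV' => /r_inj <-.
case/(gapeqP xV xV'): xx => [exx|xx|xx]; first by move: yx; rewrite -exx; lia.
  apply/(gapeqP xV yV); constructor 2 => v vV.
  by have := xx v vV; rewrite /arc; lia.
rewrite gapeq_sym; apply: gapeq_trans yy _; apply/(gapeqP yV' xV).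
by constructor 2 => v vV; move: (xx v vV) (nx v vV); rewrite /arc; lia.
Qed.

End Gaps.

Section RankedNoncrossing.
Variables (n : nat) (chi : 'I_n -> bool) (r : 'I_n -> nat).
Hypothesis rE : forall x y, chi_lt chi x y = (r x < r y)%N.

Lemma rank_inj : injective r.
Proof.
move=> x y exy; apply/eqP; apply: contraT => /(chi_lt_total chi).
by rewrite !rE exy ltnn.
Qed.

(** The rotation-invariant form of non-crossing: distinct blocks cannot separate each other on the
    circle. *)
Lemma nc_arc U s V W x x' y y' : s \in NC chi U -> V \in s -> W \in s ->
  x \in V -> x' \in V -> y \in W -> y' \in W -> x != x' ->
  arc (r x) (r y) (r x') -> arc (r x') (r y') (r x) -> V = W.
Proof.
move=> sN Vs Ws xV xV' yW yW' nxx xyx xyx'.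
have /noncrossingP sC := NC_noncrossing sN.
have nrx : r x != r x' by rewrite (inj_eq rank_inj).
case: (arc_interlaced nrx xyx xyx') => /and3P[lt1 lt2 lt3].
- by apply: (sC V W x y x' y'); rewrite ?rE.
- by apply/esym/(sC W V y' x y x'); rewrite ?rE.
- by apply: (sC V W x' y' x y); rewrite ?rE.
- by apply/esym/(sC W V y x' y' x); rewrite ?rE.
Qed.

Variable d : nat.
Variables (a b : 'I_n -> 'I_d.+1).

(** The last premise says that [q] is the cyclic successor of [p] in [B]. For [p = q] it forces [B]
    to be a singleton, so a closed singleton is a loop. *)
Definition cclosed (B : {set 'I_n}) : Prop := forall p q, p \in B -> q \in B ->
  (forall z, z \in B -> ~~ arc (r p) (r z) (r q)) -> a q = b p.

Lemma closed_blockP V : V != finset.set0 -> reflect (cclosed V) (closed_block chi a b V).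
Proof.
move=> V0; have lE := mem_chi_seq chi V.
have lP : pairwise (fun x y => (r x < r y)%N) (chi_seq chi V).
  apply: (@sub_pairwise _ (chi_lt chi)) => [x y|]; first by rewrite rE.
  exact: subseq_pairwise (filter_subseq _ _) (schi_seq_pairwise _).
have l0 := chi_seq_neq0 chi V0; rewrite /closed_block.
move: (chi_seq chi V) lE lP l0 => l lE lP l0.
apply: (iffP existsP) => [[i ci] p q pV qV adj|cl].
  have pl : p \in l by rewrite lE.
  have ql : q \in l by rewrite lE.
  have {}adj z : z \in l -> ~~ arc (r p) (r z) (r q) by rewrite lE; exact: adj.
  case/splitPr: pl ci ql adj lP => l1 l2; rewrite pairwise_cat chain_cat mem_cat inE /=.
  move=> /and3P[ci cp ci2] ql adj /and3P[/allrelP l12 l1P /andP[/allP pl2 l2P]].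
  have {}l1p x : x \in l1 -> (r x < r p)%N by move=> xl; apply: l12 => //; exact: mem_head.
  (* If nothing follows [p], its cyclic successor is the first letter of the word; otherwise it is
     the head of [l2]. *)
  case: l2 ci2 ql adj pl2 l2P {l12} => [/eqP bpi|y l2 /andP[/eqP ayb _]] ql adj pl2 l2P.
    case: l1 l1P ci cp l1p ql adj => [|x l1] /= l1P ci cp l1p ql adj.
      by move: ql; rewrite orbF bpi => /eqP ->; exact: eqP cp.
    case/andP: ci => /eqP axi _; rewrite bpi -axi; congr a.
    apply/eqP; apply: contraT => nqx; have := adj x; rewrite !inE eqxx => /(_ isT).
    have xp : (r x < r p)%N by apply: l1p; exact: mem_head.
    case/negP; move: ql; rewrite !inE (negbTE nqx) orbF /= => /orP[ql1|/eqP->].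
      have /allP/(_ q ql1) xq : all (fun y => (r x < r y)%N) l1 by case/andP: l1P.
      have qp : (r q < r p)%N by apply: l1p; rewrite inE ql1 orbT.
      by move: xq qp; clear; rewrite /arc; lia.
    by move: xp; clear; rewrite /arc; lia.
  have py : (r p < r y)%N by apply: pl2; exact: mem_head.
  suff -> : q = y by [].
  apply/eqP; apply: contraT => nqy; have := adj y; rewrite mem_cat !inE eqxx !orbT => /(_ isT).
  case/negP; rewrite /arc py /=; move: ql; rewrite !inE (negbTE nqy) /=.
  case/or3P=> [/l1p/ltnW->|/eqP->|ql2]; rewrite ?orbT ?leqnn ?orbT //.
  by move: l2P => /= /andP[/allP/(_ q ql2) -> _].
have [x [l' el]] : exists x l', l = x :: l' by case: (l) l0 => // x l'; exists x, l'.
have ax : x \in V by rewrite -lE el mem_head.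
exists (a x).
(* The chain is rebuilt from the tail after [k]; at the empty tail, the successor of [k] is the
   first letter [x]. *)
suff H l2 : forall l1 k, l = l1 ++ k :: l2 -> chain a b (b k) l2 (a x).
  by rewrite el /= eqxx; exact: (H l' [::] x).
elim: l2 => [|y l2 IH] l1 k elk.
  rewrite /= eq_sym; apply/eqP/cl => //; first by rewrite -lE elk mem_cat mem_head orbT.
  move=> z; rewrite -lE => zl.
  have zk : (r z <= r k)%N.
    move: lP zl; rewrite elk pairwise_cat mem_cat inE => /and3P[/allrelP l12 _ _].
    by case/orP=> [zl1|/eqP->//]; apply/ltnW/l12; rewrite // mem_head.
  have xz : (r x <= r z)%N.
    move: lP zl; rewrite el inE /= => /andP[/allP xl _].
    by case/orP=> [/eqP->//|/xl/ltnW].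
  by move: zk xz; clear; rewrite /arc; lia.
rewrite /=; apply/andP; split; last by apply: (IH (rcons l1 k)); rewrite cat_rcons.
apply/eqP/cl; first by rewrite -lE elk mem_cat mem_head orbT.
  by rewrite -lE elk mem_cat !inE eqxx !orbT.
move=> z; rewrite -lE elk mem_cat !inE; move: lP; rewrite elk pairwise_cat /=.
case/and3P=> /allrelP l12 _ /and3P[/andP[ky _] /allP yl2 _].
have l1k u : u \in l1 -> (r u < r k)%N by move=> ul; apply: l12; rewrite // mem_head.
case/or4P=> [/l1k|/eqP->|/eqP->|/yl2]; move: ky; clear; rewrite /arc; lia.
Qed.

End RankedNoncrossing.

(** * Cutting the circle open, and closedness in terms of arcs *)

Definition rotate (M base v : nat) : nat := if (base <= v)%N then v else (v + M)%N.

(** [rotate] cuts the circle just before [base], by lifting the smaller values by the strict bound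
    [M]. Cyclic notions survive; taking [base] to be a point makes it first, its successor makes it
    last. *)
Lemma arc_rotate M base x z y : (x < M)%N -> (z < M)%N -> (y < M)%N ->
  arc (rotate M base x) (rotate M base z) (rotate M base y) = arc x z y.
Proof.
by move=> xM zM yM; rewrite /rotate; case: (leqP base x) => ?; case: (leqP base z) => ?;
  case: (leqP base y) => ?; rewrite /arc; lia.
Qed.

Lemma rotate_inj M base x y : (x < M)%N -> (y < M)%N ->
  rotate M base x = rotate M base y -> x = y.
Proof.
by rewrite /rotate => xM yM; case: (leqP base x) => ?; case: (leqP base y) => ?; lia.
Qed.

Lemma rotate_max M x y : (x < M)%N -> (y < M)%N ->
  (rotate M x.+1 y <= rotate M x.+1 x)%N.
Proof.
by rewrite /rotate ltnn => xM yM; case: (leqP x.+1 y) => ?; lia.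
Qed.

Lemma rotate_min M x y : (x < M)%N -> (rotate M x x <= rotate M x y)%N.
Proof. by rewrite /rotate leqnn => xM; case: (leqP x y) => ?; lia. Qed.

Lemma pblock_memE (T : finType) (s : {set {set T}}) U x :
  finset.partition s U -> x \in U -> pblock s x \in s /\ x \in pblock s x.
Proof.
case/and3P=> /eqP sU _ _ xU; have xs : x \in finset.cover s by rewrite sU.
by split; [exact: pblock_mem|rewrite mem_pblock].
Qed.

Lemma pblock_eqP (T : finType) (s : {set {set T}}) U V x y : finset.partition s U ->
  V \in s -> x \in V -> (pblock s x == pblock s y) = (y \in V).
Proof.
move=> sP Vs xV; have sT : trivIset s by case/and3P: sP.
apply/eqP/idP=> [exy|yV]; last by rewrite (def_pblock sT Vs yV) (def_pblock sT Vs xV).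
rewrite -(def_pblock sT Vs xV) exy mem_pblock; apply: contraT => yn.
have := partition_ne sP Vs; rewrite -(def_pblock sT Vs xV) exy => /set0Pn[z].
by rewrite /pblock; case: pickP => [B /andP[Bs yB] _|_]; rewrite ?inE //;
  case/bigcupP: yn; exists B.
Qed.

Section ArcClosed.
Variables (n : nat) (chi : 'I_n -> bool) (r : 'I_n -> nat).
Hypothesis rE : forall x y, chi_lt chi x y = (r x < r y)%N.
Variable d : nat.
Variables (a b : 'I_n -> 'I_d.+1).
Implicit Types (s : {set {set 'I_n}}) (U V W : {set 'I_n}).
Local Notation closed := (cclosed r a b).
Let r_inj := rank_inj rE.

Definition rank_bound := (\max_z r z).+1.

Lemma rank_lt z : (r z < rank_bound)%N.
Proof. by rewrite ltnS (leq_bigmax z). Qed.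

(** The premise says that the open arc from [p] to [q] is a union of blocks. In this form closedness
    is monotone: an arc saturated by a coarser partition is saturated by a finer one. *)
Definition arc_closed s := forall p q,
  (forall V x y, V \in s -> x \in V -> y \in V ->
     arc (r p) (r x) (r q) -> arc (r p) (r y) (r q)) -> a q = b p.

Lemma arc_closed_mono s t : refines s t -> arc_closed s -> arc_closed t.
Proof.
move/refinesP=> st sC p q pq; apply: sC => V x y Vs xV yV; have [W Wt VW] := st V Vs.
by apply: (pq W) => //; exact: (subsetP VW).
Qed.

(** The arc between consecutive points of a block contains no point of that block, and by
    non-crossing it cuts no other block. Empty arcs give the closedness of the whole word. *)
Lemma arc_closed_blocks s : s \in BNC chi -> arc_closed s ->
  closed [set: 'I_n] /\ {in s, forall V, closed V}.
Proof.
rewrite BNC_NC => sN sC; have sP := NC_partition sN; split=> [p q _ _ adj|V Vs p q pV qV adj].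
  by apply: sC => V x y _ _ _; rewrite (negbTE (adj x (in_setT x))).
apply: sC => W x y Ws xW yW pxq.
have [eWV|nWV] := eqVneq W V; first by move: (adj x); rewrite -eWV xW pxq => /(_ isT).
have neq u w : u \in V -> w \in W -> r u != r w.
  move=> uV wW; rewrite (inj_eq r_inj); apply: contra nWV => /eqP euw.
  by rewrite (partition_eq sP Ws Vs wW) -?euw.
have [epq|npq] := eqVneq p q.
  by move: (neq q y qV yW); rewrite epq /arc; clear; lia.
apply: contraT => pyq; case/eqP: nWV.
apply/esym/(nc_arc rE sN Vs Ws pV qV xW yW npq pxq).
have nrpq : r p != r q by rewrite (inj_eq r_inj).
by move: (neq p y pV yW) (neq q y qV yW) pyq nrpq; rewrite /arc; clear; lia.
Qed.

(** Closedness of the whole word joins [p] to the first point [f] of the saturated arc and the last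
    point [l] to [q]; [walk] crosses the arc from [l] to [f], using the blocks it contains. *)
Lemma blocks_arc_closed s : s \in BNC chi ->
  closed [set: 'I_n] -> {in s, forall V, closed V} -> arc_closed s.
Proof.
rewrite BNC_NC => sN Tc sc p q pq; have sP := NC_partition sN.
(* With [p] last, the arc from [p] to [q] is the initial segment below [q]. *)
pose R z := rotate rank_bound (r p).+1 (r z).
have RE x y z : arc (R x) (R y) (R z) = arc (r x) (r y) (r z).
  by rewrite arc_rotate ?rank_lt.
have Rinj : injective R by move=> x y /rotate_inj/r_inj; apply; exact: rank_lt.
have Rp z : (R z <= R p)%N by apply: rotate_max; exact: rank_lt.
have pE z y : arc (r p) (r z) (r y) = (R z < R y)%N.
  by rewrite -RE; move: (Rp z) (Rp y); rewrite /arc; clear; lia.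
have [z0 z0q|noz] := pickP (fun z => R z < R q)%N; last first.
  by apply: Tc => // z _; rewrite pE noz.
case: (@arg_minnP _ z0 (fun z => R z < R q)%N R z0q) => f fq fmin.
case: (@arg_maxnP _ z0 (fun z => R z < R q)%N R z0q) => l lq lmax.
have -> : b p = a f.
  apply/esym/Tc => // z _; rewrite pE -leqNgt leqNgt; apply/negP=> zf.
  by have := fmin z (ltn_trans zf fq); rewrite leqNgt zf.
have -> : a q = b l.
  apply: Tc => // z _; rewrite -RE; apply/negP=> lzq.
  have /andP[lz zq] : (R l < R z)%N && (R z < R q)%N.
    by move: lq lzq; rewrite /arc; clear; lia.
  by have /= := lmax z zq; rewrite leqNgt lz.
have inV x y : pblock s x == pblock s y -> exists V, [/\ V \in s, x \in V & y \in V].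
  move=> xy; have [Vs xV] := pblock_memE sP (in_setT x).
  by exists (pblock s x); rewrite -(pblock_eqP y sP Vs xV).
apply: (walk (Y := [set z | R z < R q]%N) (rho := R)
             (sm := fun x y => pblock s x == pblock s y)).
- by move=> x; exact: eqxx.
- by move=> x y; exact: eq_sym.
- by move=> y x z /eqP-> .
- by move=> x y _ _; exact: Rinj.
- move=> x y; rewrite !inE => xq /inV[V [Vs xV yV]]; rewrite -pE.
  by apply: (pq V x y) => //; rewrite pE.
- move=> x y t z _ _ /inV[V [Vs xV tV]] /inV[W [Ws yW zW]] xy yt tz.
  rewrite (pblock_eqP y sP Vs xV); suff -> : V = W by [].
  apply: (nc_arc rE sN Vs Ws xV tV yW zW).
  - by apply: contraTneq xy => ->; rewrite -leqNgt ltnW.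
  - by rewrite -RE /arc xy yt.
  - by rewrite -RE /arc; move: xy yt tz; clear; lia.
- move=> x y _ /inV[V [Vs xV yV]] xy; apply: (sc V) => // z zV.
  have /andP[yz zx] : (R y <= R z <= R x)%N by apply: xy; rewrite (pblock_eqP z sP Vs xV).
  by rewrite -RE /arc; move: yz zx; clear; lia.
- move=> u v; rewrite !inE => uq vq uv adj _; apply: Tc => // z _; rewrite -RE.
  apply/negP=> uzv; have /andP[uz zv] : (R u < R z)%N && (R z < R v)%N.
    by move: uv uzv; rewrite /arc; clear; lia.
  by have := adj z; rewrite inE (ltn_trans zv vq) uz zv => /(_ isT).
- by rewrite inE.
- by move=> z; rewrite inE; exact: fmin.
- by rewrite inE.
- move=> x y; rewrite inE => xq _ /inV[V [Vs xV yV]]; apply: lmax => /=; rewrite -pE.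
  by apply: (pq V x y) => //; rewrite pE.
Qed.

(** Off [V], let [q] follow [p] in [U :&: C] but not in [U]. The first and last points [f], [l] of
    [U] between them lie in [V], so [U] contains [V]; and [f] follows [l] in [V], as the arc from
    [q] back to [p] misses [V]. Closedness of [U] at [p], [f] and at [l], [q], and of [V] at [l],
    [f], gives the claim. *)
Lemma gap_piece_closed s V W U C : s \in BNC chi -> {in s, forall X, closed X} ->
  closed V -> W \in s -> V \subset W -> U \in s -> C \in gap_part r V ->
  closed (U :&: C).
Proof.
rewrite BNC_NC => sN sc Vc Ws VW Us CV p q; have sP := NC_partition sN.
move=> /setIP[pU pC] /setIP[qU qC] adj.
have pqgap : gapeq r V p q by rewrite -(gap_blockE r_inj _ CV pC).
have [pV|pV] := boolP (p \in V).
  have CE z : (z \in C) = (z \in V).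
    by rewrite (gap_blockE r_inj _ CV pC) /gapeq pV andbT eq_sym; case: (z \in V).
  apply: Vc => // [|z zV]; first by rewrite -CE.
  apply: adj; rewrite inE CE zV andbT.
  by rewrite (partition_eq sP Us Ws pU) ?(subsetP VW).
have qV : q \notin V by case/andP: pqgap => /eqP <-.
pose R z := rotate rank_bound (r p).+1 (r z).
have RE x y z : arc (R x) (R y) (R z) = arc (r x) (r y) (r z).
  by rewrite arc_rotate ?rank_lt.
have Rinj : injective R by move=> x y /rotate_inj/r_inj; apply; exact: rank_lt.
have Rp z : (R z <= R p)%N by apply: rotate_max; exact: rank_lt.
have pE z y : arc (r p) (r z) (r y) = (R z < R y)%N.
  by rewrite -RE; move: (Rp z) (Rp y); rewrite /arc; clear; lia.
have [z0 z0P|noz] := pickP (fun z => (z \in U) && (R z < R q)%N); last first.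
  by apply: (sc U) => // z zU; have := noz z; rewrite pE zU => /= ->.
case: (@arg_minnP _ z0 (fun z => (z \in U) && (R z < R q)%N) R z0P) => f /andP[fU fq] fmin.
case: (@arg_maxnP _ z0 (fun z => (z \in U) && (R z < R q)%N) R z0P) => l /andP[lU lq] lmax.
have UW v : v \in U -> v \in V -> U = W.
  by move=> vU vV; apply: (partition_eq sP Us Ws vU); exact: (subsetP VW).
have sep x : x \in U -> x \notin V -> arc (r p) (r x) (r q) -> gapeq r V p x = false.
  move=> xU xV pxq; apply: contraTF pxq => px; apply: adj.
  by rewrite inE xU (gap_blockE r_inj _ CV pC).
have nosep x v v' : x \in U -> v \in V -> v' \in V -> p != x ->
    arc (r p) (r v) (r x) -> arc (r x) (r v') (r p) -> U = W.
  move=> xU vV vV' px pvx xvp.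
  by apply: (nc_arc rE sN Us Ws pU xU _ _ px pvx xvp); exact: (subsetP VW).
(* If not, [V] separates [p] from [f]; non-crossing gives [U = W], and then a point of [V] precedes
   [f] in [U]. *)
have fV : f \in V.
  apply: contraT => fV; have := sep f fU fV; rewrite pE fq => /(_ isT) /negbT/negP[].
  apply: gapeq_intro => // npf v v' vV vV' pvf fvp.
  have eUW := nosep f v v' fU vV vV' npf pvf fvp.
  have vU : v \in U by rewrite eUW; exact: (subsetP VW).
  rewrite pE in pvf; have := fmin v; rewrite vU (ltn_trans pvf fq) => /(_ isT).
  by rewrite leqNgt pvf.
have eUW := UW f fU fV; have VU v : v \in V -> v \in U by rewrite eUW; exact: (subsetP VW).
have lV : l \in V.
  apply: contraT => lV; have := sep l lU lV; rewrite pE lq => /(_ isT) /negbT/negP[].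
  apply: (gapeq_trans r_inj (y := q)) => //; rewrite gapeq_sym.
  apply: gapeq_intro => // nlq v v' vV vV' lvq qvl.
  have /andP[lv vq] : (R l < R v)%N && (R v < R q)%N.
    by move: lvq lq; rewrite -RE /arc; clear; lia.
  by have /= := lmax v; rewrite VU // vq leqNgt lv => /(_ isT).
have nfp : p != f by apply: contraNneq pV => ->.
have -> : a q = b l.
  apply: (sc U) => // z zU; rewrite -RE; apply/negP=> lzq.
  have /andP[lz zq] : (R l < R z)%N && (R z < R q)%N.
    by move: lzq lq; rewrite /arc; clear; lia.
  by have /= := lmax z; rewrite zU zq leqNgt lz => /(_ isT).
have -> : b p = a f.
  apply/esym/(sc U) => // z zU; rewrite pE -leqNgt leqNgt; apply/negP=> zf.
  by have := fmin z; rewrite zU (ltn_trans zf fq) leqNgt zf => /(_ isT).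
apply/esym/Vc => // w wV; apply/negP; rewrite -RE => lwf.
have wU := VU w wV.
have nwp : R w != R p by rewrite (inj_eq Rinj); apply: contraNneq pV => <-.
have nwq : R w != R q by rewrite (inj_eq Rinj); apply: contraNneq qV => <-.
have wf : (R f <= R w)%N.
  rewrite leqNgt; apply/negP=> wf; have := fmin w; rewrite wU (ltn_trans wf fq).
  by rewrite leqNgt wf => /(_ isT).
have wl : (R w < R q)%N -> (R w <= R l)%N.
  by move=> wq; apply: lmax; rewrite wU.
have qw : (R q < R w)%N.
  have fl : (R f <= R l)%N by apply: fmin; rewrite lU.
  by move: lwf wf wl nwq lq fl; rewrite /arc; clear; lia.
have npq : p != q.
  by apply: contraTneq qw => <-; rewrite -leqNgt.
apply: (gapeq_elim pV qV pqgap npq fV wV); first by rewrite pE.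
by rewrite -RE /arc; move: (Rp w) nwp qw; clear; lia.
Qed.

End ArcClosed.

(** * Groups of letters and minimal isolated sets of groups *)

Lemma pblock_pmeet (T : finType) (s t : {set {set T}}) U x :
  finset.partition s U -> finset.partition t U -> x \in U ->
  pblock (pmeet s t) x = pblock s x :&: pblock t x.
Proof.
move=> sP tP xU; have [sB xs] := pblock_memE sP xU; have [tB xt] := pblock_memE tP xU.
have /and3P[_ mT _] := pmeet_partition sP tP.
apply: (def_pblock mT); last by rewrite inE xs.
apply/pmeetP; exists (pblock s x), (pblock t x); split=> //.
by apply/set0Pn; exists x; rewrite inE xs.
Qed.

Section Grouping.
Variables (n N d : nat) (chi : 'I_n -> bool) (chi' : 'I_N -> bool).
Variables (r : 'I_n -> nat) (r' : 'I_N -> nat).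
Hypothesis rE : forall x y, chi_lt chi x y = (r x < r y)%N.
Hypothesis rE' : forall x y, chi_lt chi' x y = (r' x < r' y)%N.
Variables (a b : 'I_n -> 'I_d.+1) (a' b' : 'I_N -> 'I_d.+1).
Variables (U : {set 'I_N}) (h : 'I_N -> 'I_n).
Hypothesis h_mono : {in U &, forall p q, (r (h p) < r (h q))%N -> (r' p < r' q)%N}.
Hypothesis h_surj : forall k, exists2 p, p \in U & h p = k.
Hypothesis a_first : forall p, p \in U ->
  (forall q, q \in U -> h q = h p -> (r' p <= r' q)%N) -> a' p = a (h p).
Hypothesis b_last : forall p, p \in U ->
  (forall q, q \in U -> h q = h p -> (r' q <= r' p)%N) -> b' p = b (h p).
Hypothesis h_link : forall u q, u \in U -> q \in U -> h u = h q -> (r' u < r' q)%N ->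
  (forall z, z \in U -> h z = h q -> ~~ (r' u < r' z < r' q)%N) -> a' q = b' u.
Variables (t : {set {set 'I_N}}) (tN : t \in NC chi' U).
Variable Tr : {set 'I_n}.
Hypothesis t_single : forall B p q, B \in t -> p \in B -> q \in B ->
  h p \notin Tr -> p = q.
Hypothesis t_closed : forall B, B \in t -> (forall p, p \in B -> h p \in Tr) ->
  cclosed r' a' b' B.

Let r_inj := rank_inj rE.
Let r'_inj := rank_inj rE'.
Let tP := NC_partition tN.

(** Isolation at the level of groups: seen through [h], each block of [t] stays inside [V] or inside
    a single gap of [V]. *)
Definition admissible (V : {set 'I_n}) : bool :=
  [&& V != finset.set0, V \subset Tr &
      [forall p in U, forall q in U, (pblock t p == pblock t q) ==> gapeq r V (h p) (h q)]].

Lemma admissibleP V : reflect [/\ V != finset.set0, V \subset Tr &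
    forall B p q, B \in t -> p \in B -> q \in B -> gapeq r V (h p) (h q)]
  (admissible V).
Proof.
apply: (iffP and3P) => -[V0 VT tV]; split=> //.
  move=> B p q Bt pB qB; have pU := partition_in tP Bt pB.
  have qU := partition_in tP Bt qB.
  apply: (implyP (forall_inP (forall_inP tV p pU) q qU)).
  by rewrite (pblock_eqP q tP Bt pB).
apply/forall_inP=> p pU; apply/forall_inP=> q qU; apply/implyP.
have [Bt pB] := pblock_memE tP pU; rewrite (pblock_eqP q tP Bt pB) => qB.
exact: tV Bt pB qB.
Qed.

(** A candidate exists, so a minimal one does: positions of groups outside [Tr] are alone in their
    blocks and can join nothing. *)
Lemma admissible_true : Tr != finset.set0 -> admissible Tr.
Proof.
move=> T0; apply/admissibleP; split=> // B p q Bt pB qB.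
have [pT|pT] := boolP (h p \in Tr); last first.
  by rewrite (t_single Bt pB qB pT); exact: gapeq_refl.
have [qT|qT] := boolP (h q \in Tr); first by rewrite /gapeq pT qT.
by rewrite (t_single Bt qB pB qT); exact: gapeq_refl.
Qed.

(** Compatibility puts the images of a block of [t] in one block of [s]. If that block is not [W],
    non-crossing prevents points of [V :&: W] from separating them. *)
Lemma admissible_block V s W x :
  s \in BNC chi -> (forall B p q, B \in t -> p \in B -> q \in B ->
    pblock s (h p) = pblock s (h q)) ->
  admissible V -> W \in s -> x \in V -> x \in W -> admissible (V :&: W).
Proof.
rewrite BNC_NC => sN ts /admissibleP[V0 VT tV] Ws xV xW; have sP := NC_partition sN.
apply/admissibleP; split.
- by apply/set0Pn; exists x; rewrite inE xV.
- by apply: subset_trans VT; exact: subsetIl.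
move=> B p q Bt pB qB; have pq := tV B p q Bt pB qB.
have [pV|pV] := boolP (h p \in V); last first.
  have qV : h q \notin V by case/andP: pq => /eqP <-.
  exact: (gapeq_sub (subsetIl V W) pV qV).
have qV : h q \in V by case/andP: pq => /eqP <-.
have spq := ts B p q Bt pB qB.
have [Xs pX] := pblock_memE sP (in_setT (h p)).
have qX : h q \in pblock s (h p) by rewrite -(pblock_eqP _ sP Xs pX) spq.
have [pW|pW] := boolP (h p \in W).
  have qW : h q \in W by rewrite (partition_eq sP Ws Xs pW pX).
  by rewrite /gapeq !inE pV qV pW qW.
have qW : h q \notin W.
  by apply: contra pW => qW; rewrite (partition_eq sP Ws Xs qW qX).
apply: gapeq_intro; rewrite ?inE ?negb_and ?pW ?qW ?orbT //.
move=> npq v v' /setIP[_ vW] /setIP[_ vW'] pvq qvp; case/negP: pW.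
by rewrite -(nc_arc rE sN Xs Ws pX qX vW vW' npq pvq qvp).
Qed.

Section Minimal.
Variable V : {set 'I_n}.
Hypothesis Vadm : admissible V.
Hypothesis Vmin : forall V', admissible V' -> (#|V| <= #|V'|)%N.

(** For [k'] following [k] in [V], the walk runs over the positions above [V], from the last
    position of group [k] back to the first of group [k']. Links inside a group are given by
    [h_link]; links between groups are excluded by minimality. *)
Lemma minimal_closed : cclosed r a b V.
Proof.
move=> k k' kV kV' adj; have [V0 VT tV] := admissibleP V Vadm.
have tV' B p q : B \in t -> p \in B -> q \in B -> h p \in V -> h q \in V.
  by move=> Bt pB qB pV; case/andP: (tV B p q Bt pB qB) => /eqP <-.
have [f0 f0U hf0] := h_surj k'; have [l0 l0U hl0] := h_surj k.
have f0P : (f0 \in U) && (h f0 == k') by rewrite f0U hf0 eqxx.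
have l0P : (l0 \in U) && (h l0 == k) by rewrite l0U hl0 eqxx.
case: (@arg_minnP _ f0 (fun p => (p \in U) && (h p == k')) r' f0P) => f /andP[fU /eqP hf] fmin.
case: (@arg_maxnP _ l0 (fun p => (p \in U) && (h p == k)) r' l0P) => l /andP[lU /eqP hl] lmax.
have {f0 f0U hf0 f0P l0 l0U hl0 l0P} _ := I.
(* Both circles are cut at corresponding places: before the group [k'], and before its first
   position. *)
pose R x := rotate (rank_bound r) (r k') (r x).
pose R' p := rotate (rank_bound r') (r' f) (r' p).
have RE x y z : arc (R x) (R y) (R z) = arc (r x) (r y) (r z).
  by rewrite arc_rotate ?rank_lt.
have RE' x y z : arc (R' x) (R' y) (R' z) = arc (r' x) (r' y) (r' z).
  by rewrite arc_rotate ?rank_lt.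
have Rinj : injective R by move=> x y /rotate_inj/r_inj; apply; exact: rank_lt.
have Rinj' : injective R' by move=> x y /rotate_inj/r'_inj; apply; exact: rank_lt.
have side p : p \in U -> (r' f <= r' p)%N = (r k' <= r (h p))%N.
  move=> pU; have [ehp|nhp] := eqVneq (h p) k'.
    by rewrite ehp leqnn fmin // pU ehp /=.
  have : r (h p) != r k' by rewrite (inj_eq r_inj).
  rewrite neq_ltn => /orP[lt|lt].
    by rewrite [RHS]leqNgt lt leqNgt h_mono // hf.
  by rewrite [RHS]ltnW // ltnW // h_mono // hf.
have R_mono p q : p \in U -> q \in U -> (R (h p) < R (h q))%N -> (R' p < R' q)%N.
  move=> pU qU; rewrite /R /R' /rotate !side //.
  have hM := h_mono pU qU; have pM := rank_lt r' p; have qM := rank_lt r (h q).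
  case: ifP => _; case: ifP => _ //.
  - by move=> _; exact: leq_trans pM (leq_addl _ _).
  - by rewrite ltnNge => /negP[]; apply: leq_trans (ltnW qM) (leq_addl _ _).
  - by rewrite !ltn_add2r.
have R_same p q : p \in U -> q \in U -> h p = h q -> (R' p < R' q)%N = (r' p < r' q)%N.
  move=> pU qU hpq; rewrite /R' /rotate !side // hpq.
  by case: ifP; rewrite ?ltn_add2r.
have R_le p q : p \in U -> q \in U -> (R' p <= R' q)%N -> (R (h p) <= R (h q))%N.
  by move=> pU qU; apply: contraTT; rewrite -!ltnNge; exact: R_mono.
pose Y := [set p in U | h p \in V].
have YE p : (p \in Y) = (p \in U) && (h p \in V) by rewrite inE.
pose sm p q := pblock t p == pblock t q.
have inB p q : p \in Y -> sm p q -> exists B, [/\ B \in t, p \in B & q \in B].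
  rewrite YE => /andP[pU _] pq; have [Bt pB] := pblock_memE tP pU.
  by exists (pblock t p); rewrite -(pblock_eqP q tP Bt pB).
have smE B p q : B \in t -> p \in B -> sm p q = (q \in B) by move=> Bt; exact: (pblock_eqP q tP Bt).
have Rk x : x \in V -> (R x <= R k)%N.
  move=> xV; have := adj x xV; rewrite -RE.
  have : (R k' <= R x)%N by apply: rotate_min; exact: rank_lt.
  have : (R k' <= R k)%N by apply: rotate_min; exact: rank_lt.
  by rewrite /arc; clear; lia.
have <- : b' l = b k.
  by rewrite -hl; apply: b_last => // q qU hq; apply: lmax; rewrite /= qU hq hl eqxx.
have <- : a' f = a k'.
  by rewrite -hf; apply: a_first => // q qU hq; apply: fmin; rewrite qU hq hf eqxx.
have satl q : q \in Y -> (R' q <= R' l)%N.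
  rewrite YE => /andP[qU qV]; rewrite leqNgt; apply/negP=> lq.
  have [ehq|nhq] := eqVneq (h q) k.
    move: lq; rewrite R_same ?hl ?ehq // ltnNge; apply/negP; rewrite negbK.
    by apply: lmax; rewrite qU ehq eqxx.
  have : (R (h q) < R (h l))%N by rewrite hl ltn_neqAle (inj_eq Rinj) nhq Rk.
  by move/(R_mono _ _ qU lU); rewrite ltnNge ltnW.
have Ysub p q : p \in Y -> sm p q -> q \in Y.
  move=> pY pq; have [B [Bt pB qB]] := inB p q pY pq; move: pY.
  by rewrite !YE (partition_in tP Bt qB) => /andP[_]; exact: tV' Bt pB qB.
apply/esym/(walk (Y := Y) (rho := R') (sm := sm)).
- by move=> p; exact: eqxx.
- by move=> p q; exact: eq_sym.
- by move=> q p z /eqP; rewrite /sm => ->.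
- by move=> p q _ _; exact: Rinj'.
- exact: Ysub.
- move=> p q p' q' pY qY /(inB _ _ pY)[B [Bt pB pB']] /(inB _ _ qY)[C [Ct qC qC']] pq qp qp'.
  rewrite (smE B) //; suff -> : B = C by [].
  apply: (nc_arc rE' tN Bt Ct pB pB' qC qC').
  - by apply: contraTneq pq => ->; rewrite -leqNgt ltnW.
  - by rewrite -RE' /arc pq qp.
  - by rewrite -RE' /arc; move: pq qp qp'; clear; lia.
- move=> p q pY /(inB _ _ pY)[B [Bt pB qB]] pq.
  apply: (t_closed Bt) => // [z zB|z zB].
    apply: (subsetP VT); apply: (tV' B p z) => //.
    by move: pY; rewrite YE => /andP[].
  have /andP[qz zp] : (R' q <= R' z <= R' p)%N by apply: pq; rewrite (smE B).
  by rewrite -RE' /arc; move: qz zp; clear; lia.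
- move=> u q uY qY uq uqadj satu.
  have /andP[uU uV] : (u \in U) && (h u \in V) by rewrite -YE.
  have /andP[qU qV] : (q \in U) && (h q \in V) by rewrite -YE.
  have [ehu|nhu] := eqVneq (h u) (h q).
    apply: h_link => //; first by rewrite -R_same.
    by move=> z zU hz; rewrite -!R_same ?hz // uqadj // YE zU hz.
  have ltuq : (R (h u) < R (h q))%N.
    by rewrite ltn_neqAle (inj_eq Rinj) nhu R_le // ltnW.
  (* As [u] is saturated, this initial part of [V] is again admissible; it misses [h q], against
     minimality. *)
  pose V' := [set x in V | R x <= R (h u)]%N.
  have VE' x : (x \in V') = (x \in V) && (R x <= R (h u))%N by rewrite inE.
  have V'V : V' \subset V by apply/subsetP=> x; rewrite VE' => /andP[].
  have up p B : B \in t -> p \in B -> h p \in V' -> forall p', p' \in B -> h p' \in V'.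
    move=> Bt pB; rewrite VE' => /andP[pV pu] p' pB'; have pU := partition_in tP Bt pB.
    rewrite VE' (tV' B p p') //=; apply: R_le => //; first exact: partition_in tP Bt pB'.
    apply: (satu p p'); rewrite ?YE ?pU ?(smE B) // leqNgt; apply/negP=> lup.
    have pq : (R' p < R' q)%N.
      apply: R_mono => //; exact: leq_ltn_trans pu ltuq.
    by have := uqadj p; rewrite YE pU pV lup pq => /(_ isT).
  have : admissible V'.
    apply/admissibleP; split.
    - by apply/set0Pn; exists (h u); rewrite VE' uV leqnn.
    - exact: subset_trans V'V VT.
    move=> B p p' Bt pB pB'; have pp := tV B p p' Bt pB pB'.
    have [pV|pV] := boolP (h p \in V); last first.
      have pV' : h p' \notin V by case/andP: pp => /eqP <-.
      exact: (gapeq_sub V'V pV pV').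
    have pV' := tV' B p p' Bt pB pB' pV.
    have [p1|p1] := boolP (h p \in V').
      by rewrite /gapeq p1 (up p B Bt pB p1).
    have [p2|p2] := boolP (h p' \in V').
      by rewrite (up p' B Bt pB' p2) in p1.
    apply: gapeq_intro => // npp v v'; rewrite !VE' -!RE => /andP[_ vu] /andP[_ vu'].
    have : (R (h u) < R (h p))%N by move: p1; rewrite VE' pV /= -ltnNge.
    have : (R (h u) < R (h p'))%N by move: p2; rewrite VE' pV' /= -ltnNge.
    have : R (h p) != R (h p') by rewrite (inj_eq Rinj).
    by move: vu vu'; rewrite /arc; clear; lia.
  move/Vmin; rewrite leqNgt => /negP[]; apply: proper_card; apply/properP; split=> //.
  by exists (h q); rewrite // VE' qV -ltnNge.
- by rewrite YE fU hf.
- by move=> z _; apply: rotate_min; exact: rank_lt.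
- by rewrite YE lU hl.
- by move=> p q pY _ pq; apply: satl; exact: Ysub pq.
Qed.

Lemma minimal_subset s W x :
  s \in BNC chi -> (forall B p q, B \in t -> p \in B -> q \in B ->
    pblock s (h p) = pblock s (h q)) ->
  W \in s -> x \in V -> x \in W -> V \subset W.
Proof.
move=> sN ts Ws xV xW; have /Vmin := admissible_block sN ts Vadm Ws xV xW.
move=> le; apply/setIidPl/eqP; by rewrite eqEcard subsetIl.
Qed.

End Minimal.

Definition compatible (s : {set {set 'I_n}}) : bool :=
  [forall B in t, forall p in B, forall q in B, pblock s (h p) == pblock s (h q)].

Lemma compatibleP s : reflect (forall B p q, B \in t -> p \in B -> q \in B ->
    pblock s (h p) = pblock s (h q)) (compatible s).
Proof.
apply: (iffP forall_inP) => [H B p q Bt pB qB|H B Bt].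
  exact/eqP/(forall_inP (forall_inP (H B Bt) p pB)).
by apply/forall_inP=> p pB; apply/forall_inP=> q qB; apply/eqP/(H B).
Qed.

(* With [V] minimal admissible, [s] and its meet with the partition of ['I_n]
   into [V] and its gaps have the same summand. *)
Lemma sum_compatible_closed (A : zmodType) (z : A) :
  cclosed r a b [set: 'I_n] -> Tr != finset.set0 -> Tr != [set: 'I_n] ->
  \sum_(s in BNC chi)
    (if [forall V in s, closed_block chi a b V] && compatible s then z else 0) *~
      moebius (BNC chi) (@refines n) s [set [set: 'I_n]] = 0.
Proof.
move=> Tc T0 nT.
case: (arg_minnP (fun V : {set 'I_n} => #|V|) (admissible_true T0)) => V Vadm Vmin.
have [V0 VT tV] := admissibleP V Vadm; have Vc := minimal_closed Vadm Vmin.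
have n0 : (0 < n)%N by case/set0Pn: V0 => -[m mn] _; exact: leq_ltn_trans mn.
have wP := gap_partition r_inj V.
pose w := gap_part r V.
have wN : w \in BNC chi.
  rewrite BNC_NC inE wP; apply/noncrossingP=> X W x y x' y' Xw Ww xX yW xX' yW'.
  rewrite !rE => xy yx xy'; apply: (partition_eq wP Xw Ww (x := y)) => //.
  rewrite (gap_blockE r_inj _ Xw xX).
  apply: (gapeq_nc r_inj (x' := x') (y' := y')) => //.
    by rewrite -(gap_blockE r_inj _ Xw xX).
  by rewrite -(gap_blockE r_inj _ Ww yW).
apply: (@sum_moebius_meet _ (BNC chi) (@refines n) (@BNC_refines_refl n chi)
  (@BNC_refines_trans n chi) (@BNC_refines_anti n chi) A
  (fun s => if [forall V in s, closed_block chi a b V] && compatible s then z else 0)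
  (fun s => pmeet s w) w _ wN (top_BNC chi n0)).
- apply: contraNneq nT => w1; have := gap_part_self r_inj V0; rewrite -/w w1 inE => /eqP VE.
  by rewrite eqEsubset subsetT -VE.
- by move=> s; rewrite BNC_NC => sN; exact: refines_top (NC_partition sN).
- by move=> s sN; exact: NC_pmeet.
- move=> s u; rewrite BNC_NC => sN uN.
  exact: refines_pmeet (NC_partition sN) (NC_partition uN) wP.
move=> s sB; congr (if _ then _ else _).
have mB : pmeet s w \in BNC chi by exact: NC_pmeet.
have BP u : u \in BNC chi -> finset.partition u [set: 'I_n].
  by rewrite BNC_NC; exact: NC_partition.
have [sP mP] := (BP s sB, BP _ mB).
have blockP u : u \in BNC chi ->
    reflect {in u, forall W, cclosed r a b W} [forall W in u, closed_block chi a b W].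
  rewrite BNC_NC => uN; have uP := NC_partition uN.
  apply: (iffP forall_inP) => H W Wu; have W0 := partition_ne uP Wu.
    exact/(closed_blockP rE a b W0)/H.
  exact/(closed_blockP rE a b W0)/H.
(* By admissibility the images of a block of [t] already lie in one class of [w]. *)
have -> : compatible (pmeet s w) = compatible s.
  apply/compatibleP/compatibleP=> H B p q Bt pB qB.
    have [Xs pX] := pblock_memE sP (in_setT (h p)).
    have [Xw pw] := pblock_memE wP (in_setT (h p)).
    have := H B p q Bt pB qB; rewrite !(pblock_pmeet sP wP) ?inE // => /setP/(_ (h p)).
    rewrite !inE pX pw /= => /esym/andP[pq _].
    have [Ys qY] := pblock_memE sP (in_setT (h q)).
    exact: (partition_eq sP Xs Ys pX pq).
  rewrite !(pblock_pmeet sP wP) ?inE // (H B p q) //; congr (_ :&: _).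
  have [Xw pw] := pblock_memE wP (in_setT (h p)).
  apply/eqP; rewrite (pblock_eqP _ wP Xw pw) (gap_blockE r_inj _ Xw pw).
  exact: (tV B).
have [/compatibleP ts|_] := boolP (compatible s); last by rewrite !andbF.
(* From the meet to [s]: the arc form of closedness is monotone. From [s] to the meet: minimality
   puts [V] inside one block of [s], and the gaps of [V] cut the blocks of [s] into closed
   pieces. *)
rewrite !andbT; apply/(blockP _ mB)/(blockP _ sB) => [mc|sc].
  have mC := blocks_arc_closed rE mB Tc mc.
  have ms : refines (pmeet s w) s.
    have := refines_refl (pmeet s w).
    by rewrite {2}/is_true (refines_pmeet mP sP wP) => /andP[].
  by have [] := arc_closed_blocks rE sB (arc_closed_mono ms mC).
move=> X /pmeetP[W [C [Ws Cw -> _]]]; have [x xV] := set0Pn _ V0.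
have [W0 W0s xW0] := partition_cover sP (in_setT x).
exact: (gap_piece_closed rE sB sc Vc W0s (minimal_subset Vadm Vmin sB ts W0s xV xW0)).
Qed.

End Grouping.

(** * Pulling partitions back to the longer word *)

Section Pull.
Variables (n N : nat) (chi : 'I_n -> bool) (chi' : 'I_N -> bool).
Variables (U : {set 'I_N}) (h : 'I_N -> 'I_n).
Hypothesis h_mono : {in U &, forall p q, chi_lt chi (h p) (h q) -> chi_lt chi' p q}.
Hypothesis h_surj : forall k, exists2 p, p \in U & h p = k.
Implicit Types (s : {set {set 'I_n}}) (t : {set {set 'I_N}}).

Definition pull (V : {set 'I_n}) : {set 'I_N} := U :&: h @^-1: V.

Lemma mem_pull V p : (p \in pull V) = (p \in U) && (h p \in V).
Proof. by rewrite !inE. Qed.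

Lemma pull_inj s : finset.partition s [set: 'I_n] -> {in s &, injective pull}.
Proof.
move=> sP V W Vs Ws eVW; have [x xV] := partition_ex sP Vs; have [p pU hp] := h_surj x.
apply: (partition_eq sP Vs Ws xV).
have : p \in pull V by rewrite mem_pull pU hp.
by rewrite eVW mem_pull pU hp.
Qed.

Lemma pull_NC s : s \in BNC chi -> pull @: s \in NC chi' U.
Proof.
rewrite BNC_NC => sN; have sP := NC_partition sN; rewrite inE; apply/andP; split.
  apply: partition_intro.
  - by move=> _ /imsetP[V _ ->]; exact: subsetIl.
  - move=> _ /imsetP[V Vs ->]; have [x xV] := partition_ex sP Vs.
    by have [p pU hp] := h_surj x; exists p; rewrite mem_pull pU hp.
  - move=> p pU; have [V Vs pV] := partition_cover sP (in_setT (h p)).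
    by exists (pull V); [exact: imset_f|rewrite mem_pull pU].
  - move=> _ _ /imsetP[V Vs ->] /imsetP[W Ws ->] p.
    by rewrite !mem_pull => /andP[_ pV] /andP[_ pW]; rewrite (partition_eq sP Vs Ws pV pW).
have /noncrossingP sC := NC_noncrossing sN.
apply/noncrossingP=> _ _ a b c d /imsetP[V Vs ->] /imsetP[W Ws ->]; rewrite !mem_pull.
move=> /andP[aU aV] /andP[bU bW] /andP[cU cV] /andP[dU dW] ab bc cd.
have [->//|nVW] := eqVneq V W.
have VW x y : x \in V -> y \in W -> x != y.
  by move=> xV yW; apply: contraNneq nVW => exy; rewrite (partition_eq sP Vs Ws xV) ?exy.
have lt p q : p \in U -> q \in U -> h p != h q -> chi_lt chi' p q -> chi_lt chi (h p) (h q).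
  move=> pU qU npq pq; case/orP: (chi_lt_total chi npq) => // /(h_mono qU pU) qp.
  by have := chi_lt_trans pq qp; rewrite chi_ltxx.
congr pull; apply: (sC V W (h a) (h b) (h c) (h d)) => //; apply: lt => //;
  by [exact: VW|rewrite eq_sym; exact: VW].
Qed.

Lemma compatible_refines s t : s \in BNC chi -> t \in NC chi' U ->
  compatible h t s = refines t (pull @: s).
Proof.
rewrite BNC_NC => sN tN; have sP := NC_partition sN; have tP := NC_partition tN.
apply/compatibleP/refinesP=> [H B Bt|H B p q Bt pB qB].
  have [p pB] := partition_ex tP Bt; have [Xs pX] := pblock_memE sP (in_setT (h p)).
  exists (pull (pblock s (h p))); first exact: imset_f.
  apply/subsetP=> q qB; rewrite mem_pull (partition_in tP Bt qB) /=.
  by rewrite -(pblock_eqP _ sP Xs pX) (H B p q).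
have [_ /imsetP[V Vs ->] /subsetP BV] := H B Bt.
have [_ pV] : p \in U /\ h p \in V by apply/andP; rewrite -mem_pull BV.
have [_ qV] : q \in U /\ h q \in V by apply/andP; rewrite -mem_pull BV.
by apply/eqP; rewrite (pblock_eqP _ sP Vs pV).
Qed.

Variables (K : fieldType) (A : algType K) (phi : {linear A -> K^o}) (phi1 : phi 1 = 1).
Variables (d : nat) (a b : 'I_n -> 'I_d.+1) (x : 'I_n -> A) (x' : 'I_N -> A).
Variable c : {set 'I_N} -> K^o.
Hypothesis cE : forall V, V != finset.set0 ->
  block_moment phi x' V = \sum_(t in NC chi' V) \prod_(W in t) c W.
Hypothesis xE : forall V, block_moment phi x V = block_moment phi x' (pull V).

(** Block moments of the short word are block moments of the long word over pulled-back blocks.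
    Expanding these into cumulants yields the [t] refining the pull-back of [s], that is, those with
    which [s] is compatible. *)
Lemma diag_cumulant_expand i : (0 < n)%N ->
  diagmx_val (cumulant1 (diag_space phi1 d) chi
    (fun k => letter (chi k) (x k) (a k) (b k))) i i =
  if chain a b i (chi_seq chi [set: 'I_n]) i then
    \sum_(t in NC chi' U) \sum_(s in BNC chi)
      (if [forall V in s, closed_block chi a b V] && compatible h t s
       then \prod_(W in t) c W else 0) *~
      moebius (BNC chi) (@refines n) s [set [set: 'I_n]]
  else 0.
Proof.
move=> n0; rewrite diag_cumulantE //; case: (chain _ _ _ _ _) => /=; last first.
  by apply: big1 => s _; rewrite mul0rz.
rewrite exchange_big /=; apply: eq_bigr => s sN.
rewrite -mulrz_suml; congr (_ *~ _); case: (boolP [forall V in s, _]) => _ /=; last first.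
  by rewrite big1.
rewrite (eq_bigr _ (fun V _ => xE V)).
have sP : finset.partition s [set: 'I_n] by move: sN; rewrite BNC_NC; exact: NC_partition.
rewrite -(big_imset (fun V => block_moment phi x' V) (pull_inj sP)) /=.
rewrite (prod_moments_NC cE (pull_NC sN)) big_mkcondr /=.
by apply: eq_bigr => t tN; rewrite (compatible_refines sN tN).
Qed.

End Pull.

Lemma arc_embed (T : Type) (f g : T -> nat) (x z y : T) :
  (forall u v, (f u < f v)%N = (g u < g v)%N) ->
  arc (f x) (f z) (f y) = arc (g x) (g z) (g y).
Proof.
move=> fg; have fg' u v : (f u <= f v)%N = (g u <= g v)%N.
  by rewrite [LHS]leqNgt [RHS]leqNgt fg.
by rewrite /arc !fg fg'.
Qed.

(** * Cyclic index conditions and vanishing scalar cumulants *)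

Section CyclicWords.
Variables (m d : nat) (chi : 'I_m -> bool) (i j : 'I_m -> 'I_d.+1).

Lemma index_schi_ex (k : 'I_m) : exists q : 'I_m, k = schi chi q.
Proof.
have lt : (index k (schi_seq chi) < m)%N.
  by rewrite -[X in (_ < X)%N](size_schi_seq chi) index_mem mem_schi_seq.
by exists (Ordinal lt); rewrite /schi nth_index ?mem_schi_seq.
Qed.

Lemma cclosed_schi : (forall q, j (schi chi q) = i (schi chi (ordS q))) ->
  cclosed (fun k => index k (schi_seq chi)) i j [set: 'I_m].
Proof.
move=> ij p q _ _; have [p0 ->] := index_schi_ex p; have [q0 ->] := index_schi_ex q => adj.
rewrite ij; congr (i (schi chi _)); apply/val_inj => /=.
have {}adj (z : 'I_m) : ~~ arc p0 z q0 by rewrite -!(index_schi chi) adj // in_setT.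
have := ltn_ord p0; rewrite leq_eqVlt => /orP[/eqP p0m|p0m].
  have m0 : (0 < m)%N by rewrite -p0m.
  have := adj (Ordinal m0); have := ltn_ord q0; rewrite p0m modnn /arc /=.
  by move: p0m; clear; lia.
rewrite modn_small //; have := adj (Ordinal p0m); rewrite /arc /=.
by clear; lia.
Qed.

End CyclicWords.

Section BlockCumulants.
Variables (K : fieldType) (A : algType K) (phi : {linear A -> K^o}) (phi1 : phi 1 = 1).
Variables (d : nat) (I J : Type) (ZI : I -> 'M[A]_d.+1) (ZJ : J -> 'M[A]_d.+1).

(* [None] encodes the entries of scalar matrix units. *)
Definition entry (l : option (I + J)) (i j : 'I_d.+1) : A :=
  if l is Some w then sum_family ZI ZJ w i j else 1.

Variables (N : nat) (chi : 'I_N -> bool) (l : 'I_N -> option (I + J)).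
Variables (a b : 'I_N -> 'I_d.+1).
Hypothesis l_color : forall p w, l p = Some w -> is_inl w = chi p.
Let x p := entry (l p) (a p) (b p).
Variable c : {set 'I_N} -> K^o.
Hypothesis cE : forall V, V != finset.set0 ->
  block_moment phi x V = \sum_(t in NC chi V) \prod_(W in t) c W.

Lemma block_cumulantE (B : {set 'I_N}) : B != finset.set0 ->
  c B = cumulant1 (scalar_space phi1) (chi \o (@enum_val _ (mem B)))
          (x \o (@enum_val _ (mem B))).
Proof.
move=> B0; rewrite (cumulant_restrict phi1 cE) ?enum_val_imset //.
  by rewrite card_gt0.
by move=> i j; exact: enum_val_increasing.
Qed.

Lemma block_cumulant_None (B : {set 'I_N}) p q : p \in B -> q \in B -> p != q ->
  l p = None -> c B = 0.
Proof.
move=> pB qB npq lp; have B0 : B != finset.set0 by apply/set0Pn; exists p.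
rewrite block_cumulantE //.
apply: (@cumulant_one _ _ _ phi1 _ _ _ (enum_rank_in pB p)); last first.
  by rewrite /= enum_rankK_in // /x lp.
by apply/card_gt1P; exists p, q.
Qed.

(** Cyclicity is assumed only for words as long as [B], so that both [R_cyclic] and the induction
    hypothesis of the converse can be supplied. *)
Lemma block_cumulant_closed (B : {set 'I_N}) : B != finset.set0 ->
  (forall (omega : 'I_#|B| -> I + J) (i j : 'I_#|B| -> 'I_d.+1),
    let chi := fun k => is_inl (omega k) in
    (exists q, j (schi chi q) <> i (schi chi (ordS q))) ->
    cumulant1 (scalar_space phi1) chi
      (fun k => sum_family ZI ZJ (omega k) (i k) (j k)) = 0) ->
  (forall p, p \in B -> l p <> None) -> c B != 0 ->
  cclosed (fun k => index k (schi_seq chi)) a b B.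
Proof.
move=> B0 cyc Bsome cB; have [p0 p0B] := set0Pn _ B0.
case l0 : (l p0) => [w0|]; last by case: (Bsome p0 p0B).
pose ev := @enum_val _ (mem B).
have evB k : ev k \in B by exact: enum_valP.
(* [w0] is a mere default, since no label in [B] is [None]. *)
pose omega (k : 'I_#|B|) := odflt w0 (l (ev k)).
have lE k : l (ev k) = Some (omega k).
  by rewrite /omega; case le : (l (ev k)) => //; case: (Bsome _ (evB k)).
have chiE : (fun k => is_inl (omega k)) = chi \o ev.
  by apply/funext=> k /=; apply: l_color; exact: lE.
have xE : (fun k => sum_family ZI ZJ (omega k) (a (ev k)) (b (ev k))) = x \o ev.
  by apply/funext=> k /=; rewrite /x lE.
have cl : cclosed (fun k => index k (schi_seq (chi \o ev))) (a \o ev) (b \o ev) [set: 'I_#|B|].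
  apply: cclosed_schi => q; apply: contrapT => nq; case/negP: cB; apply/eqP.
  rewrite block_cumulantE //; have := cyc omega (a \o ev) (b \o ev).
  by rewrite /= chiE xE; apply; exists q.
move=> p q pB qB adj.
rewrite -(enum_rankK_in p0B pB) -(enum_rankK_in p0B qB).
apply: (cl (enum_rank_in p0B p) (enum_rank_in p0B q)); rewrite ?in_setT // => z _.
have /= -> := @arc_embed _ (fun k => index k (schi_seq (chi \o ev)))
  (fun k => index (ev k) (schi_seq chi)) (enum_rank_in p0B p) z (enum_rank_in p0B q).
  by rewrite /ev !enum_rankK_in // adj.
move=> u v; rewrite -!/(chi_lt _ _ _); apply: chi_lt_comp => i j.
exact: enum_val_increasing.
Qed.

End BlockCumulants.

(** * Products of generators as groups of letters *)

Lemma cumulant1_0 (K : fieldType) (B A : algType K) (S : bb_space B A) n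
    (chi : 'I_n -> bool) (Z : 'I_n -> A) k : Z k = 0 -> cumulant1 S chi Z = 0.
Proof.
move=> Zk; have := cumulant1_linear S chi Z k (-1) 0 0.
by rewrite scaler0 addr0 scaleN1r addNr -{1}Zk upd_id.
Qed.

Lemma big_mkord_mul (R : pzSemiRingType) n M (F : nat -> R) :
  \prod_(p < n * M) F p = \prod_(k < n) \prod_(j < M) F (k * M + j)%N.
Proof.
elim: n => [|n IH]; first by rewrite mul0n !big_ord0.
rewrite big_ord_recr /= -IH mulSn addnC big_split_ord /=.
by [].
Qed.

Section Words.
Variables (K : fieldType) (A : algType K) (phi : {linear A -> K^o}) (phi1 : phi 1 = 1).
Variables (d : nat) (I J : Type) (ZI : I -> 'M[A]_d.+1) (ZJ : J -> 'M[A]_d.+1).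

Definition sym : Type := option (I + J) * 'I_d.+1 * 'I_d.+1.
Definition sym_entry (l : sym) : A := entry ZI ZJ l.1.1 l.1.2 l.2.
Definition srow (l : sym) := l.1.2.
Definition scol (l : sym) := l.2.
Definition sym0 : sym := (None, ord0, ord0).

Definition word_op (c : bool) (w : seq sym) : mxop A d :=
  \prod_(l <- w) letter c (sym_entry l) (srow l) (scol l).

Lemma word_op_left l w : word_op true (l :: w) =
  if path (fun l l' => scol l == srow l') l w
  then letter true (\prod_(l <- l :: w) sym_entry l) (srow l) (scol (last l w)) else 0.
Proof.
rewrite /word_op; elim: w l => [|l' w IH] l; first by rewrite !big_seq1.
rewrite big_cons IH /=; case: path; last by rewrite mulr0 andbF.
by rewrite letterM_left andbT [in RHS]big_cons.
Qed.

Lemma word_op_right l w : word_op false (l :: w) =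
  if path (fun l l' => srow l == scol l') l w
  then letter false (\prod_(l <- l :: w) sym_entry l) (srow (last l w)) (scol l) else 0.
Proof.
rewrite /word_op; elim: w l => [|l' w IH] l; first by rewrite !big_seq1.
rewrite big_cons IH /=; case: path; last by rewrite mulr0 andbF.
by rewrite letterM_right andbT [in RHS]big_cons.
Qed.

Section Flatten.
Variables (n : nat) (chi : 'I_n -> bool) (w : 'I_n -> seq sym) (Tr : {set 'I_n}).
Hypothesis cyc : R_cyclic phi1 ZI ZJ.
Hypothesis w_gt0 : forall k, (0 < size (w k))%N.
Hypothesis w_color : forall k i om, (i < size (w k))%N ->
  (nth sym0 (w k) i).1.1 = Some om -> is_inl om = chi k.
Hypothesis w_true : forall k i, k \in Tr -> (i < size (w k))%N ->
  (nth sym0 (w k) i).1.1 = None -> srow (nth sym0 (w k) i) = scol (nth sym0 (w k) i).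
Hypothesis w_false : forall k, k \notin Tr -> size (w k) = 1%N /\
  (nth sym0 (w k) 0).1.1 = None.
Hypotheses (Tr0 : Tr != finset.set0) (TrT : Tr != [set: 'I_n]).

Let linked k := forall i, (i.+1 < size (w k))%N ->
  if chi k then scol (nth sym0 (w k) i) = srow (nth sym0 (w k) i.+1)
  else srow (nth sym0 (w k) i) = scol (nth sym0 (w k) i.+1).

(** Groups of uniform length allow position [p] to be decoded by division: [p %/ M] is its group,
    [p %% M] its place there. The padding of shorter words is left outside [U]. *)
Let M := \max_k size (w k).
Let N := (n * M)%N.

Let size_le k : (size (w k) <= M)%N. Proof. exact: leq_bigmax. Qed.
Let n_gt0 : (0 < n)%N.
Proof. by case/set0Pn: Tr0 => -[m mn] _; exact: leq_ltn_trans mn. Qed.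
Let M_gt0 : (0 < M)%N.
Proof. exact: leq_trans (w_gt0 (Ordinal n_gt0)) (size_le _). Qed.

Let h_lt (p : 'I_N) : (p %/ M < n)%N. Proof. by rewrite ltn_divLR ?ltn_ord. Qed.
Let h (p : 'I_N) : 'I_n := Ordinal (h_lt p).
Let U := [set p : 'I_N | p %% M < size (w (h p))]%N.
Let l (p : 'I_N) : sym := nth sym0 (w (h p)) (p %% M).
Let a' p := srow (l p).
Let b' p := scol (l p).
Let x' p := sym_entry (l p).
Let chi' p := chi (h p).

(** End points of the letter formed by a whole group. A right group is read backwards: it starts at
    the row of its last symbol and ends at the column of its first. *)
Let a k := srow (nth sym0 (w k) (if chi k then 0 else (size (w k)).-1)).
Let b k := scol (nth sym0 (w k) (if chi k then (size (w k)).-1 else 0)).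
Let x k := \prod_(l <- w k) sym_entry l.

Let pos_lt k (i : nat) : (i < size (w k))%N -> (k * M + i < N)%N.
Proof.
move=> ik; have iM := leq_trans ik (size_le k).
apply: (@leq_trans (k.+1 * M)); first by rewrite mulSn [(k * M + i)%N]addnC ltn_add2r.
by rewrite leq_mul2r ltn_ord orbT.
Qed.
Let pos k i (ik : (i < size (w k))%N) : 'I_N := Ordinal (pos_lt ik).

Let h_pos k i (ik : (i < size (w k))%N) : h (pos ik) = k.
Proof.
by apply/val_inj; rewrite /= divnMDl // divn_small ?addn0 // (leq_trans ik).
Qed.
Let pos_mod k i (ik : (i < size (w k))%N) : (pos ik %% M)%N = i.
Proof. by rewrite /= modnMDl modn_small // (leq_trans ik). Qed.
Let pos_U k i (ik : (i < size (w k))%N) : pos ik \in U.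
Proof. by rewrite inE h_pos pos_mod. Qed.

Let word_opE k : linked k -> word_op (chi k) (w k) = letter (chi k) (x k) (a k) (b k).
Proof.
rewrite /linked /x /a /b; case: (w k) (w_gt0 k) => [//|l0 s] _; case: (chi k) => lk.
  rewrite word_op_left (_ : path _ _ _ = true) /=; first by rewrite (last_nth sym0).
  by apply/(pathP sym0) => i si; apply/eqP; exact: lk.
rewrite word_op_right (_ : path _ _ _ = true) /=; first by rewrite (last_nth sym0).
by apply/(pathP sym0) => i si; apply/eqP; exact: lk.
Qed.

Let word_op0 k : ~ linked k -> word_op (chi k) (w k) = 0.
Proof.
rewrite /linked; case: (w k) (w_gt0 k) => [//|l0 s] _; case: (chi k) => lk.
  rewrite word_op_left; case: ifP => // /(pathP sym0) H; case: lk => i si.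
  by apply/eqP; exact: H.
rewrite word_op_right; case: ifP => // /(pathP sym0) H; case: lk => i si.
by apply/eqP; exact: H.
Qed.

Let block_xE V : block_moment phi x V = block_moment phi x' (pull U h V).
Proof.
rewrite /block_moment; congr (phi _).
(* [F] is 1 outside the pulled-back set, padding included, so the ordered product splits into groups
   of equal length. *)
pose F (q : nat) : A := if insub q is Some p then
  if p \in pull U h V then x' p else 1 else 1.
transitivity (\prod_(p < N) F p); last first.
  rewrite [RHS]big_mkcond; apply: eq_bigr => p _; rewrite /F.
  by case: insubP => [p' _ /val_inj ->|]; rewrite ?ltn_ord.
rewrite big_mkord_mul big_mkcond; apply: eq_bigr => k _.
transitivity (\prod_(0 <= j < M) F (k * M + j)%N); last by rewrite big_mkord.
rewrite (@big_cat_nat _ _ _ (size (w k))) //= [X in _ * X]big_nat [X in _ * X]big1 ?mulr1.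
  have FE i (ik : (i < size (w k))%N) :
      F (k * M + i)%N = if k \in V then sym_entry (nth sym0 (w k) i) else 1.
    rewrite /F; case: insubP => [p _ ep|]; last by rewrite pos_lt.
    have -> : p = pos ik by apply/val_inj.
    by rewrite mem_pull pos_U h_pos /x' /l h_pos pos_mod.
  rewrite big_nat (eq_bigr (fun i =>
    if k \in V then sym_entry (nth sym0 (w k) i) else 1)); last first.
    by move=> i /andP[_ ik]; exact: FE.
  rewrite -big_nat; case: ifP => _; last by rewrite big1.
  by rewrite /x (big_nth sym0).
move=> j /andP[jk jM]; rewrite /F; case: insubP => // p _ ep.
rewrite mem_pull inE; have -> : (p %% M)%N = j by rewrite ep modnMDl modn_small.
have -> : h p = k by apply/val_inj; rewrite /= ep divnMDl // divn_small ?addn0.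
by rewrite ltnNge jk.
Qed.

Lemma flatten_cumulant0 :
  cumulant1 (diag_space phi1 d) chi (fun k => word_op (chi k) (w k)) = 0.
Proof.
(* A word with a broken junction is the operator 0, and then the cumulant is 0 by linearity. *)
have [lk|/existsNP[k nlk]] := pselect (forall k, linked k); last first.
  by apply: (@cumulant1_0 _ _ _ _ _ _ _ k); exact: word_op0.
rewrite (_ : (fun k => _) = fun k => letter (chi k) (x k) (a k) (b k)); last first.
  by apply/funext=> k; exact: word_opE.
have [c cE] := cumulants_exist chi' (block_moment phi x').
apply/val_inj/matrixP=> i j; have [<-{j}|nij] := eqVneq i j; last first.
  have /is_diag_mxP -> // := valP (cumulant1 (diag_space phi1 d) chi
    (fun k => letter (chi k) (x k) (a k) (b k))).
  by rewrite [RHS]mxE.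
pose r k := index k (schi_seq chi); pose r' p := index p (schi_seq chi').
have h_lt_nat (p q : 'I_N) : (h p < h q)%N -> (p < q)%N.
  by apply: contraLR; rewrite -!leqNgt => qp; exact: leq_div2r.
have h_mono : {in U &, forall p q, chi_lt chi (h p) (h q) -> chi_lt chi' p q}.
  move=> p q _ _; rewrite !chi_ltE /chi'; case: (chi (h p)); case: (chi (h q)) => //=;
  exact: h_lt_nat.
have h_surj k : exists2 p, p \in U & h p = k.
  by exists (pos (w_gt0 k)); [exact: pos_U|exact: h_pos].
have UP p : p \in U -> (p %% M < size (w (h p)))%N by rewrite inE.
have posE p k o (ik : (o < size (w k))%N) : h p = k -> (pos ik < p)%N = (o < p %% M)%N.
  by move=> hp; rewrite {1}(divn_eq p M) (congr1 val hp : p %/ M = k)%N /= ltn_add2l.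
have posE' p k o (ik : (o < size (w k))%N) : h p = k -> (p < pos ik)%N = (p %% M < o)%N.
  by move=> hp; rewrite {1}(divn_eq p M) (congr1 val hp : p %/ M = k)%N /= ltn_add2l.
have lastk k : ((size (w k)).-1 < size (w k))%N by rewrite prednK.
have modk p : p \in U -> (p %% M <= (size (w (h p))).-1)%N.
  by move=> /UP; rewrite -{1}(prednK (w_gt0 (h p))) ltnS.
have a_first p : p \in U -> (forall q, q \in U -> h q = h p -> (r' p <= r' q)%N) -> a' p = a (h p).
  move=> pU; rewrite /a' /a /l; case chp : (chi (h p)) => pmin.
    have := pmin (pos (w_gt0 (h p))) (pos_U _) (h_pos _).
    rewrite leqNgt -/(chi_lt chi' _ _) chi_ltE /chi' !h_pos chp posE //= lt0n negbK.
    by move/eqP ->.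
  have := pmin (pos (lastk (h p))) (pos_U _) (h_pos _).
  rewrite leqNgt -/(chi_lt chi' _ _) chi_ltE /chi' !h_pos chp posE' //= -leqNgt => lep.
  by congr (srow (nth _ _ _)); apply/eqP; rewrite eqn_leq lep modk.
have b_last p : p \in U -> (forall q, q \in U -> h q = h p -> (r' q <= r' p)%N) -> b' p = b (h p).
  move=> pU; rewrite /b' /b /l; case chp : (chi (h p)) => pmax.
    have := pmax (pos (lastk (h p))) (pos_U _) (h_pos _).
    rewrite leqNgt -/(chi_lt chi' _ _) chi_ltE /chi' !h_pos chp posE' //= -leqNgt => lep.
    by congr (scol (nth _ _ _)); apply/eqP; rewrite eqn_leq lep modk.
  have := pmax (pos (w_gt0 (h p))) (pos_U _) (h_pos _).
  rewrite leqNgt -/(chi_lt chi' _ _) chi_ltE /chi' !h_pos chp posE //= lt0n negbK.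
  by move/eqP ->.
have same_lt (p q : 'I_N) : h p = h q -> (p < q)%N = (p %% M < q %% M)%N.
  move=> hpq; rewrite {1}(divn_eq p M) {1}(divn_eq q M).
  by rewrite (congr1 val hpq : p %/ M = q %/ M)%N ltn_add2l.
have h_link u q : u \in U -> q \in U -> h u = h q -> (r' u < r' q)%N ->
    (forall z, z \in U -> h z = h q -> ~~ (r' u < r' z < r' q)%N) -> a' q = b' u.
  move=> uU qU huq; rewrite -/(chi_lt chi' _ _) chi_ltE /chi' huq.
  have := lk (h q); rewrite /linked /a' /b' /l huq; case chq : (chi (h q)) => /= lkq.
    rewrite same_lt // => uq adj; have ltq := UP q qU.
    have eq : (q %% M = (u %% M).+1)%N.
      apply/eqP; rewrite eqn_leq uq andbT leqNgt; apply/negP=> uq'.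
      have lt := ltn_trans uq' ltq; case/negP: (adj (pos lt) (pos_U lt) (h_pos lt)).
      rewrite -!/(chi_lt chi' _ _) !chi_ltE /chi' !h_pos huq chq posE //.
      by rewrite uq' same_lt ?h_pos // pos_mod ltnSn.
    by rewrite eq lkq // -eq.
  rewrite same_lt // => qu adj; have ltu := UP u uU; rewrite huq in ltu.
  have eq : (u %% M = (q %% M).+1)%N.
    apply/eqP; rewrite eqn_leq qu andbT leqNgt; apply/negP=> qu'.
    have lt := ltn_trans qu' ltu; case/negP: (adj (pos lt) (pos_U lt) (h_pos lt)).
    rewrite -!/(chi_lt chi' _ _) !chi_ltE /chi' !h_pos huq chq.
    by rewrite posE ?huq // qu' same_lt ?h_pos // pos_mod ltnSn.
  by rewrite eq lkq // -eq.
rewrite (diag_cumulant_expand h_mono h_surj phi1 a b cE block_xE) // [RHS]mxE.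
case: ifP => // ch; apply: big1 => t tN; have tP := NC_partition tN.
have Tc : cclosed r a b [set: 'I_n].
  apply/(closed_blockP (chi := chi)) => //; first exact: ord_setT_neq0.
  by apply/existsP; exists i.
have l_color p om : (l p).1.1 = Some om -> is_inl om = chi' p.
  have [pU|pU] := ltnP (p %% M) (size (w (h p))); first exact: w_color.
  by rewrite /l nth_default.
(* Only partitions of non-zero weight matter, and the non-vanishing of the cumulants of their blocks
   yields both hypotheses on [t]. *)
have [c0|cn0] := eqVneq (\prod_(W in t) c W) 0.
  by apply: big1 => s _; rewrite c0 if_same mul0rz.
have cB B : B \in t -> c B != 0.
  by move=> Bt; apply: contraNneq cn0 => cB; rewrite (bigD1 B) //= cB mul0r.
have rE y z : chi_lt chi y z = (r y < r z)%N by [].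
have rE' p q : chi_lt chi' p q = (r' p < r' q)%N by [].
suff [t1 t2] : (forall B p q, B \in t -> p \in B -> q \in B -> h p \notin Tr -> p = q) /\
    (forall B, B \in t -> (forall p, p \in B -> h p \in Tr) -> cclosed r' a' b' B).
  exact (sum_compatible_closed rE rE' h_mono h_surj a_first b_last h_link tN t1 t2
    (\prod_(W in t) c W) Tc Tr0 TrT).
split.
- move=> B p q Bt pB qB pT; apply/eqP; apply: contraT => npq; case/eqP: (cB B Bt).
  apply: (block_cumulant_None phi1 cE pB qB npq).
  have pU := UP p (partition_in tP Bt pB).
  have [w1 wN] := w_false pT; move: pU; rewrite w1 ltnS leqn0 => /eqP p0.
  by rewrite /l p0.
move=> B Bt BT; have B0 := partition_ne tP Bt.
(* A block containing a scalar symbol is a singleton; in a group of [Tr] that symbol is a diagonal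
   unit, a loop, so the block is closed. *)
have [p0 /andP[p0B lp0]|noN] :=
    pickP (fun p => (p \in B) && (if (l p).1.1 is None then true else false)).
  have {}lp0 : (l p0).1.1 = None by case: (l p0).1.1 lp0.
  move=> p q pB qB _; have BE : forall q, q \in B -> q = p0.
    move=> q' q'B; apply/eqP; apply: contraT => nq; case/eqP: (cB B Bt).
    by apply: (block_cumulant_None phi1 cE p0B q'B _ lp0); rewrite eq_sym.
  rewrite (BE p pB) (BE q qB); apply: w_true => //; first exact: BT.
  exact: UP (partition_in tP Bt p0B).
have Bsome p : p \in B -> (l p).1.1 <> None.
  by move=> pB lp; have := noN p; rewrite pB lp.
refine (block_cumulant_closed l_color cE B0 _ Bsome (cB B Bt)).
by move=> om i' j'; apply: cyc; rewrite card_gt0.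
Qed.

End Flatten.
End Words.

(** * From R-cyclicity to bi-freeness *)

Section Forward.
Local Open Scope classical_set_scope.
Variables (K : fieldType) (A : algType K) (phi : {linear A -> K^o}) (phi1 : phi 1 = 1).
Variables (d : nat) (I J : Type) (ZI : I -> 'M[A]_d.+1) (ZJ : J -> 'M[A]_d.+1).
Local Notation word_op := (word_op ZI ZJ).

Lemma letterZ c (k : K) (x : A) (i j : 'I_d.+1) : letter c (k *: x) i j = k *: letter c x i j.
Proof. by rewrite -[k *: x]addr0 letter_linear letter0 addr0. Qed.

Definition mxLR (c : bool) (Z : 'M[A]_d.+1) : mxop A d := if c then mxL Z else mxR Z.

Lemma mxLR_sum c Z : mxLR c Z = \sum_(p : 'I_d.+1 * 'I_d.+1) letter c (Z p.1 p.2) p.1 p.2.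
Proof. by case: c; [exact: mxL_sum_letter|exact: mxR_sum_letter]. Qed.

(** [e] distinguishes the matrix face from the scalar one. Scalars inside the matrix face come from
    diagonal matrices, hence only diagonal units occur; the scalar face is already spanned by single
    units. *)
Definition good_word (c e : bool) (w : seq (sym d I J)) : Prop :=
  [/\ (0 < size w)%N,
      forall i om, (i < size w)%N -> (nth (sym0 d I J) w i).1.1 = Some om -> is_inl om = c,
      e -> forall i, (i < size w)%N -> (nth (sym0 d I J) w i).1.1 = None ->
        srow (nth (sym0 d I J) w i) = scol (nth (sym0 d I J) w i) &
      ~~ e -> size w = 1%N /\ (nth (sym0 d I J) w 0).1.1 = None].

Definition word_set (c e : bool) (T : mxop A d) : Prop :=
  exists2 w, good_word c e w & T = word_op c w.

Lemma span_letter c (e : bool) (l : sym d I J) :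
  (forall om, l.1.1 = Some om -> e /\ is_inl om = c) ->
  (l.1.1 = None -> e -> srow l = scol l) ->
  lin_span (word_set c e) (letter c (sym_entry ZI ZJ l) (srow l) (scol l)).
Proof.
move=> lS lN; apply: lin_span_sub; exists [:: l]; last by rewrite /word_op big_seq1.
split=> //=.
- by case=> // om _ /lS[].
- by move=> ee [|//] _ lN'; exact: lN.
- by move=> ne; split=> //; case le: l.1.1 => [om|//]; have [] := lS om le; rewrite (negbTE ne).
Qed.

Lemma span_scalar c (e : bool) (M : 'M[K]_d.+1) : (e -> is_diag_mx M) ->
  lin_span (word_set c e) (mxLR c (scal_mx A M)).
Proof.
move=> Md; rewrite mxLR_sum; apply: lin_span_sum => -[i j] /=.
rewrite scal_mxE letterZ; have [[ee nij]|ok] := pselect (e /\ i <> j).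
  have /is_diag_mxP -> := Md ee; last by apply/eqP => /val_inj.
  by rewrite scale0r; exact: lin_span0.
apply: lin_span_scale; apply: (@span_letter c e (None, i, j)) => // _ ee.
by apply: contrapT => nij; apply: ok.
Qed.

Lemma word_set_subalg c : is_subalg [set T | lin_span (word_set c true) T].
Proof.
split=> [|k x y|x y].
- have -> : (1 : mxop A d) = mxLR c (scal_mx A 1%:M).
    by case: c => /=; [have [<-] := scalL_monoid A d|rewrite -(scalR1 A d)].
  by apply: span_scalar => _; exact: scalar_mx_is_diag.
- exact: lin_span_comb.
apply: lin_span_mul => _ _ [w [w0 wc wd _] ->] [w' [w0' wc' wd' _] ->].
apply: lin_span_sub; exists (w ++ w'); last by rewrite /word_op big_cat.
split=> //.
- by rewrite size_cat addn_gt0 w0.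
- move=> i om; rewrite size_cat nth_cat => ilt; case: ltnP => iw; first exact: wc.
  by apply: wc'; rewrite ltn_subLR.
- move=> _ i; rewrite size_cat nth_cat => ilt; case: ltnP => iw; first exact: wd.
  by apply: wd' => //; rewrite ltn_subLR.
Qed.

Lemma matrix_lface_span T : lface (matrix_faces phi1 ZI ZJ) T ->
  lin_span (word_set true true) T.
Proof.
apply; split; first exact: word_set_subalg.
move=> _ [[be _ <-]|[k _ <-]] /=.
  by apply: (@span_scalar true true) => _; exact: (valP be).
rewrite -[mxL _]/(mxLR true (ZI k)) mxLR_sum; apply: lin_span_sum => -[i j] /=.
by apply: (@span_letter true true (Some (inl k), i, j)) => //= om [<-].
Qed.

Lemma matrix_rface_span T : rface (matrix_faces phi1 ZI ZJ) T ->
  lin_span (word_set false true) T.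
Proof.
apply; split; first exact: word_set_subalg.
move=> _ [[be _ <-]|[k _ <-]] /=.
  by apply: (@span_scalar false true) => _; exact: (valP be).
rewrite -[mxR _]/(mxLR false (ZJ k)) mxLR_sum; apply: lin_span_sum => -[i j] /=.
by apply: (@span_letter false true (Some (inr k), i, j)) => //= om [<-].
Qed.

Lemma R_cyclic_bifree : R_cyclic phi1 ZI ZJ ->
  bifree2 (matrix_faces phi1 ZI ZJ) (scalar_faces phi1 d).
Proof.
move=> cyc n chi e Z [k0 [k1 ek]] ZF.
apply: (cumulant1_span (G := fun k => word_set (chi k) (e k))); last first.
  move=> k; have := ZF k; case: (chi k); case: (e k).
  - exact: matrix_lface_span.
  - by move=> [M _ <-]; apply: (@span_scalar true false).
  - exact: matrix_rface_span.
  - by move=> [M _ <-]; apply: (@span_scalar false false).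
move=> {ZF}Z ZG.
have /choice[w wP] : forall k, exists w, good_word (chi k) (e k) w /\ Z k = word_op (chi k) w.
  by move=> k; have [w gw ew] := ZG k; exists w.
have -> : Z = fun k => word_op (chi k) (w k) by apply/funext=> k; case: (wP k).
have ne : exists k, ~~ e k.
  by case e0 : (e k0); case e1 : (e k1); [case: ek|exists k1|exists k0|case: ek];
    rewrite ?e0 ?e1.
have ye : exists k, e k.
  by case e0 : (e k0); case e1 : (e k1); [exists k0|exists k0|exists k1|case: ek];
    rewrite ?e0 ?e1.
(* [Tr] collects the positions of the matrix face; non-constancy of [e] makes it neither empty nor
   full. *)
apply: (flatten_cumulant0 (Tr := finset e) cyc).
- by move=> k; have [[]] := wP k.
- by move=> k i om; have [[_ wc _ _] _] := wP k; exact: wc.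
- by move=> k i; rewrite inE => ek'; have [[_ _ wd _] _] := wP k; exact: wd.
- by move=> k; rewrite inE => ek'; have [[_ _ _ wn] _] := wP k; exact: wn.
- by case: ye => k ek'; apply/set0Pn; exists k; rewrite inE.
by case: ne => k ek'; apply: contraNneq ek' => /setP/(_ k); rewrite !inE.
Qed.

End Forward.

(** * Insertion of matrix units into a word *)

Lemma partition_set1 (T : finType) (t : {set {set T}}) x :
  finset.partition t [set x] -> t = [set [set x]].
Proof.
move=> tP; have tE B : B \in t -> B = [set x].
  move=> Bt; apply/eqP; rewrite eqEsubset (partition_sub tP Bt) sub1set.
  by have [y yB] := partition_ex tP Bt; have /set1P <- := partition_in tP Bt yB.
have [B Bt _] := partition_cover tP (set11 x).
apply/setP=> C; rewrite inE; apply/idP/eqP=> [|->]; first exact: tE.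
by rewrite -(tE B Bt).
Qed.

Lemma cclosed_rank n d (r r' : 'I_n -> nat) (a b : 'I_n -> 'I_d.+1) B :
  (forall x y, (r x < r y)%N = (r' x < r' y)%N) -> cclosed r a b B -> cclosed r' a b B.
Proof.
move=> rr cl p q pB qB adj; apply: cl => // z zB; have /= -> := arc_embed p z q rr.
exact: adj.
Qed.

Section Insertion.
Variables (n d : nat) (chi : 'I_n -> bool) (i j : 'I_n -> 'I_d.+1).

Let idx k := index k (schi_seq chi).

Lemma index_schi_lt k : (idx k < n)%N.
Proof. by rewrite -[X in (_ < X)%N](size_schi_seq chi) index_mem mem_schi_seq. Qed.

Definition chi_succ k : 'I_n := schi chi (ordS (Ordinal (index_schi_lt k))).
Definition gap_fails k : bool := j k != i (chi_succ k).

Lemma chi_succ_schi q : chi_succ (schi chi q) = schi chi (ordS q).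
Proof. by congr (schi chi (ordS _)); apply/val_inj; rewrite /= /idx index_schi. Qed.

Lemma index_chi_succ k : idx (chi_succ k) = ((idx k).+1 %% n)%N.
Proof. by rewrite /idx index_schi. Qed.

(* Position [p] carries the letter [p./2] of the given word or the matrix unit
   inserted after it; since right letters are read backwards, the inserted
   letter comes naturally before a right letter. *)
Lemma ins_half_lt (p : 'I_n.*2) : (p./2 < n)%N.
Proof. by rewrite ltn_half_double. Qed.
Definition ins_src (p : 'I_n.*2) : 'I_n := Ordinal (ins_half_lt p).
Definition ins_orig (p : 'I_n.*2) : bool := odd p == ~~ chi (ins_src p).
(** Original letters get even ranks, and the unit inserted after a letter gets the next odd rank. *)
Definition ins_rank (p : 'I_n.*2) : nat := ((idx (ins_src p)).*2 + ~~ ins_orig p)%N.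

Lemma ins_pos_lt (k : 'I_n) (o : bool) : (o + k.*2 < n.*2)%N.
Proof. by rewrite -ltn_half_double half_bit_double. Qed.
Definition ins_pos (k : 'I_n) (o : bool) : 'I_n.*2 :=
  Ordinal (ins_pos_lt k (o == ~~ chi k)).

Lemma ins_src_pos k o : ins_src (ins_pos k o) = k.
Proof. by apply/val_inj; rewrite /= half_bit_double. Qed.

Lemma ins_orig_pos k o : ins_orig (ins_pos k o) = o.
Proof.
by rewrite /ins_orig ins_src_pos /= oddD odd_double addbF; case: o; case: (chi k).
Qed.

Lemma idx_inj : injective idx.
Proof.
move=> k k' e; rewrite -(nth_index k (mem_schi_seq chi k)) -/(idx k) e.
by rewrite nth_index ?mem_schi_seq.
Qed.

Lemma chi_lt_ins p q :
  chi_lt (chi \o ins_src) p q = (ins_rank p < ins_rank q)%N.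
Proof.
have eP (u : 'I_n.*2) : (u : nat) = (odd u + (ins_src u).*2)%N by rewrite /= odd_double_half.
rewrite chi_ltE /= /ins_rank /ins_orig; have [e|ne] := eqVneq (ins_src p) (ins_src q).
  rewrite -e (eP p) (eP q) -e; case: (chi (ins_src p)); case: (odd p); case: (odd q) => /=;
  by clear; lia.
have nidx : idx (ins_src p) != idx (ins_src q) by rewrite (inj_eq idx_inj).
have nval : (ins_src p : nat) != ins_src q by rewrite (inj_eq val_inj).
have := chi_ltE chi (ins_src p) (ins_src q); rewrite /chi_lt -/(idx _) -/(idx (ins_src q)).
rewrite (eP p) (eP q); move: nidx nval.
move: (idx _) (idx _) (ins_src p : nat) (ins_src q : nat) (odd p) (odd q) => x y u v o o'.
by case: (chi (ins_src p)); case: (chi (ins_src q)); case: o; case: o' => /=; clear; lia.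
Qed.

End Insertion.

(** * From bi-freeness to R-cyclicity *)

Section MatrixUnits.
Local Open Scope classical_set_scope.
Variables (K : fieldType) (A : algType K) (phi : {linear A -> K^o}) (phi1 : phi 1 = 1).
Variables (d : nat) (I J : Type) (ZI : I -> 'M[A]_d.+1) (ZJ : J -> 'M[A]_d.+1).

Lemma emx_delta (i j : 'I_d.+1) : scal_mx A (delta_mx i j) = emx 1 i j.
Proof.
by apply/matrixP=> k l; rewrite scal_mxE !mxE; case: (_ && _); rewrite ?scale1r ?scale0r.
Qed.

Lemma delta_mx_diag (i : 'I_d.+1) : delta_mx i i \in @diag_pred K d.
Proof.
apply/is_diag_mxP => k l nkl; rewrite mxE.
by case: eqP => // eki; case: eqP => // eli; rewrite eki eli eqxx in nkl.
Qed.

Lemma letter_corner_left Z (i j : 'I_d.+1) :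
  letter true (1 : A) i i * mxL Z * letter true 1 j j = letter true (Z i j) i j.
Proof.
apply: mxop_ext => M k l; rewrite !mxopE_mul /= !mxL_emx; case: eqP => // _.
rewrite mxLE mul1r (bigD1 j) //= mxL_emx eqxx mul1r big1 ?addr0 // => u /negbTE nuj.
by rewrite mxL_emx nuj mulr0.
Qed.

Lemma letter_corner_right Z (i j : 'I_d.+1) :
  letter false (1 : A) j j * mxR Z * letter false 1 i i = letter false (Z i j) i j.
Proof.
apply: mxop_ext => M k l; rewrite !mxopE_mul /= !mxR_emx; case: eqP => // _.
rewrite mxRE mul1r (bigD1 i) //= mxR_emx eqxx mul1r big1 ?addr0 // => u /negbTE nui.
by rewrite mxR_emx nui mulr0.
Qed.

(** The entry is cut out by diagonal matrix units, which belong to the face because it contains the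
    image of the diagonal algebra. On the right the two units trade places, since right operators
    compose backwards on indices. *)
Lemma corner_face w (i j : 'I_d.+1) :
  (if is_inl w then lface (matrix_faces phi1 ZI ZJ) else rface (matrix_faces phi1 ZI ZJ))
    (letter (is_inl w) (sum_family ZI ZJ w i j) i j).
Proof.
have unitE c k : letter c (1 : A) k k =
    if c then diagL A (DiagMx (delta_mx_diag k)) else diagR A (DiagMx (delta_mx_diag k)).
  by case: c; rewrite /= -emx_delta.
case: w => w /=.
  rewrite -[mxL (emx _ _ _)]/(letter true _ _ _) -letter_corner_left.
  have [_ _ gM] := gen_subalg_subalg (range (diagL (d := d) A) `|` range (fun k => mxL (ZI k))).
  apply: (gM); first apply: (gM).
  - by rewrite unitE => Y [_ XY]; apply: XY; left; exists (DiagMx (delta_mx_diag i)).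
  - by move=> Y [_ XY]; apply: XY; right; exists w.
  - by rewrite unitE => Y [_ XY]; apply: XY; left; exists (DiagMx (delta_mx_diag j)).
rewrite -[mxR (emx _ _ _)]/(letter false _ _ _) -letter_corner_right.
have [_ _ gM] := gen_subalg_subalg (range (diagR (d := d) A) `|` range (fun k => mxR (ZJ k))).
apply: (gM); first apply: (gM).
- by rewrite unitE => Y [_ XY]; apply: XY; left; exists (DiagMx (delta_mx_diag j)).
- by move=> Y [_ XY]; apply: XY; right; exists w.
- by rewrite unitE => Y [_ XY]; apply: XY; left; exists (DiagMx (delta_mx_diag i)).
Qed.

Lemma unit_face c (i j : 'I_d.+1) :
  (if c then lface (scalar_faces phi1 d) else rface (scalar_faces phi1 d))
    (letter c 1 i j).
Proof. by case: c; exists (delta_mx i j); rewrite // /letter /= -emx_delta. Qed.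

End MatrixUnits.

Section Backward.
Variables (K : fieldType) (A : algType K) (phi : {linear A -> K^o}) (phi1 : phi 1 = 1).
Variables (d : nat) (I J : Type) (ZI : I -> 'M[A]_d.+1) (ZJ : J -> 'M[A]_d.+1).
Hypothesis free : bifree2 (matrix_faces phi1 ZI ZJ) (scalar_faces phi1 d).

(** R-cyclicity at the single length [n]; the induction provides it at all smaller positive
    lengths. *)
Definition cyclic_upto (n : nat) : Prop :=
  forall (omega : 'I_n -> I + J) (i j : 'I_n -> 'I_d.+1),
    let chi := fun k => is_inl (omega k) in
    (exists q, j (schi chi q) <> i (schi chi (ordS q))) ->
    cumulant1 (scalar_space phi1) chi
      (fun k => sum_family ZI ZJ (omega k) (i k) (j k)) = 0.

Section Step.
Variables (n : nat) (omega : 'I_n -> I + J) (i j : 'I_n -> 'I_d.+1).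
Hypothesis IH : forall n', (0 < n')%N -> (n' < n)%N -> cyclic_upto n'.
Let chi k := is_inl (omega k).
Variable q0 : 'I_n.
Hypothesis q0_fails : j (schi chi q0) <> i (schi chi (ordS q0)).

Let src := @ins_src n.
Let orig := ins_orig chi.
Let idx k := index k (schi_seq chi).
Let U := [set p | orig p || gap_fails chi i j (src p)].
Let m := #|U|.
Let ev : 'I_m -> 'I_n.*2 := @enum_val _ (mem U).

Let k y := src (ev y).
Let o y := orig (ev y).
Let col y := chi (k y).
Let l y := if o y then Some (omega (k y)) else None.
(** An inserted unit is the edge from the column of its letter to the row of the next letter, which
    repairs the broken junction. *)
Let a y := if o y then i (k y) else j (k y).
Let b y := if o y then j (k y) else i (chi_succ chi (k y)).
Let x y := entry ZI ZJ (l y) (a y) (b y).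
Let r y := ins_rank chi (ev y).
Let V0 := [set y | o y].

Let n_gt0 : (0 < n)%N. Proof. exact: leq_ltn_trans (ltn_ord q0). Qed.

Let rE y z : chi_lt col y z = (r y < r z)%N.
Proof.
rewrite -chi_lt_ins -(chi_lt_comp (chi \o ins_src (n := n)) (g := ev)) //.
by move=> u v; exact: enum_val_increasing.
Qed.
Let r_inj := rank_inj rE.

Let evU y : orig (ev y) || gap_fails chi i j (src (ev y)).
Proof. by have := enum_valP y; rewrite inE. Qed.

Let rank_orig y : o y -> r y = (idx (k y)).*2.
Proof. by move=> oy; rewrite /r /ins_rank -/(orig _) -/(o y) oy addn0. Qed.

Let rank_ins y : ~~ o y -> r y = (idx (k y)).*2.+1.
Proof. by move=> oy; rewrite /r /ins_rank -/(orig _) -/(o y) oy addn1. Qed.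

Let ins_fails y : ~~ o y -> gap_fails chi i j (k y).
Proof. by move=> /negbTE oy; have := evU y; rewrite -/(o y) oy. Qed.

Let at_ex k' o' : o' || gap_fails chi i j k' -> exists2 y, k y = k' & o y = o'.
Proof.
move=> H; have pU : ins_pos chi k' o' \in U.
  by rewrite inE /orig ins_orig_pos /src ins_src_pos.
exists (enum_rank_in pU (ins_pos chi k' o')).
  by rewrite /k /ev enum_rankK_in // /src ins_src_pos.
by rewrite /o /ev enum_rankK_in // /orig ins_orig_pos.
Qed.

Let at_eq y z : k y = k z -> o y = o z -> y = z.
Proof.
move=> ek eo; apply: r_inj; have := eo; case oy : (o y) => oz.
  by rewrite !rank_orig ?ek.
by rewrite !rank_ins ?ek ?oy -?oz.
Qed.

Let idx_lt k' : (idx k' < n)%N. Proof. exact: index_schi_lt. Qed.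

Let r_lt y : (r y < n.*2)%N.
Proof.
have := idx_lt (k y); case oy : (o y); [rewrite rank_orig //|rewrite rank_ins ?oy //];
by clear; lia.
Qed.

Let chain_closed : cclosed r a b [set: 'I_m].
Proof.
move=> y z _ _ adj.
have succ y' : r y' = (r y).+1 -> z = y'.
  move=> ry'; apply: r_inj; move: (adj y' (in_setT _)); rewrite ry' /arc; clear; lia.
have idxn := idx_lt (k y).
(* The slot of highest rank is followed cyclically by the slot of rank 0. *)
have wrap y' : (r y).+1 = n.*2 -> r y' = 0%N -> z = y'.
  move=> ry ry'; apply: r_inj; move: (adj y' (in_setT _)) (r_lt z); rewrite ry' /arc.
  by move: ry; clear; lia.
have [y' ky' oy'] := @at_ex (chi_succ chi (k y)) true isT.
have ry' : r y' = (((idx (k y)).+1 %% n).*2)%N by rewrite rank_orig // ky' /idx index_chi_succ.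
case oy : (o y); last first.
  have ry : r y = (idx (k y)).*2.+1 by rewrite rank_ins ?oy.
  suff -> : z = y' by rewrite /a /b oy oy' ky'.
  have [lt|] := ltnP (idx (k y)).+1 n.
    by apply: succ; rewrite ry' ry modn_small // doubleS.
  rewrite leq_eqVlt ltnNge idxn orbF => /eqP en.
  by apply: wrap; rewrite ?ry ?ry' -?doubleS -?en ?modnn.
have ry : r y = (idx (k y)).*2 by rewrite rank_orig.
have [fy|nfy] := boolP (gap_fails chi i j (k y)).
  have [y2 ky2 oy2] := @at_ex (k y) false fy.
  have -> : z = y2 by apply: succ; rewrite ry rank_ins ?oy2 // ky2.
  by rewrite /a /b oy oy2 ky2.
(* Nothing is inserted at a junction that holds, so the odd slot after [y] is empty and the next
   original letter follows directly. *)
have nz : r z != (r y).+1.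
  case oz : (o z); first by rewrite rank_orig // ry; move: (idx _) (idx _); clear; lia.
  rewrite rank_ins ?oz // ry; apply: contra nfy => /eqP[/double_inj/idx_inj <-].
  by apply: ins_fails; rewrite oz.
suff -> : z = y' by rewrite /a /b oy oy' ky'; apply/esym/eqP; rewrite -[_ == _]negbK.
apply: r_inj; move: (adj y' (in_setT _)) (r_lt z) nz; rewrite ry' ry /arc.
have [lt|] := ltnP (idx (k y)).+1 n.
  by rewrite modn_small // doubleS; clear; lia.
rewrite leq_eqVlt ltnNge idxn orbF => /eqP en.
have -> : ((idx (k y)).+1 %% n = 0)%N by rewrite -en modnn.
by move: en; clear; lia.
Qed.

Let Zp_ex (k' : 'I_n) : exists y, (k y == k') && o y.
Proof. by have [y ky oy] := @at_ex k' true isT; exists y; rewrite ky eqxx. Qed.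
Let Zp k' : 'I_m := xchoose (Zp_ex k').
Let k_Zp k' : k (Zp k') = k'. Proof. by have /andP[/eqP] := xchooseP (Zp_ex k'). Qed.
Let o_Zp k' : o (Zp k'). Proof. by have /andP[] := xchooseP (Zp_ex k'). Qed.

Let Zp_increasing (u v : 'I_n) : (u < v)%N -> (Zp u < Zp v)%N.
Proof.
move=> uv; have evZ k' : (ev (Zp k') : nat) = (~~ chi k' + k'.*2)%N.
  have := o_Zp k'; rewrite /o /orig /ins_orig -/(src _) -/(k _) k_Zp => /eqP <-.
  have half : (ev (Zp k'))./2 = k' by exact: (congr1 val (k_Zp k')).
  by rewrite -[LHS]odd_double_half half.
have nat_lt : (ev (Zp u) < ev (Zp v))%N.
  by rewrite !evZ; move: uv; case: (chi u); case: (chi v); clear; lia.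
rewrite ltnNge leq_eqVlt; apply/negP=> /orP[/eqP/val_inj e|/enum_val_increasing lt].
  by move: nat_lt; rewrite e ltnn.
by have := ltn_trans nat_lt lt; rewrite ltnn.
Qed.

Let Zp_inj : injective Zp. Proof. exact: increasing_inj Zp_increasing. Qed.

Let V0E : V0 = Zp @: [set: 'I_n].
Proof.
apply/setP=> y; rewrite inE; apply/idP/imsetP=> [oy|[k' _ ->]]; last exact: o_Zp.
by exists (k y); rewrite ?in_setT //; apply: at_eq; rewrite ?k_Zp // o_Zp.
Qed.

Let card_V0 : #|V0| = n.
Proof. by rewrite V0E card_imset // cardsT card_ord. Qed.

Let q1_ex : exists q1, ~~ o q1.
Proof.
have f0 : gap_fails chi i j (schi chi q0).
  by rewrite /gap_fails chi_succ_schi; apply/eqP.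
by have [y _ oy] := @at_ex _ false f0; exists y; rewrite oy.
Qed.

Let m_gt0 : (0 < m)%N.
Proof. by case: q1_ex => -[y ym] _; exact: leq_ltn_trans ym. Qed.

Let V0_neq0 : V0 != finset.set0.
Proof. by rewrite -card_gt0 card_V0. Qed.

Let V0_neqT : V0 != [set: 'I_m].
Proof. by case: q1_ex => y oy; apply: contraNneq oy => /setP/(_ y); rewrite !inE. Qed.

Let t0 : {set {set 'I_m}} := V0 |: [set [set y] | y in ~: V0].

Let t0P B : reflect (B = V0 \/ exists2 y, ~~ o y & B = [set y]) (B \in t0).
Proof.
apply: (iffP setU1P) => -[->|H]; [by left| |by left|]; right.
  by case/imsetP: H => y; rewrite !inE => oy ->; exists y.
by case: H => y oy ->; apply/imsetP; exists y; rewrite ?inE.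
Qed.

Let t0_NC : t0 \in NC col [set: 'I_m].
Proof.
rewrite inE; apply/andP; split.
  apply: partition_intro.
  - by move=> B _; exact: subsetT.
  - move=> B /t0P[->|[y _ ->]]; last by exists y; rewrite inE.
    exact/set0Pn.
  - move=> y _; have [oy|oy] := boolP (o y).
      by exists V0; [apply/t0P; left|rewrite inE].
    by exists [set y]; [apply/t0P; right; exists y|rewrite inE].
  - move=> B C /t0P[->|[y oy ->]] /t0P[->|[z oz ->]] u //; rewrite !inE.
    + by move=> ou /eqP euz; rewrite -euz ou in oz.
    + by move=> /eqP-> oy'; rewrite oy' in oy.
    + by move=> /eqP-> /eqP->.
apply/noncrossingP=> B C u v w z /t0P[->|[y _ ->]] /t0P[->|[y' _ ->]] //.
- by move=> _ /set1P-> _ /set1P-> _ yw wy; have := chi_lt_trans yw wy; rewrite chi_ltxx.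
- by move=> /set1P-> _ /set1P-> _ yv vy; have := chi_lt_trans yv vy; rewrite chi_ltxx.
- by move=> /set1P-> _ /set1P-> _ yv vy; have := chi_lt_trans yv vy; rewrite chi_ltxx.
Qed.

Let l_color y w : l y = Some w -> is_inl w = col y.
Proof. by rewrite /l; case: (o y) => // -[<-]. Qed.

Section Coefficients.
Variable c : {set 'I_m} -> K^o.
Hypothesis cE : forall V, V != finset.set0 ->
  block_moment phi x V = \sum_(t in NC col V) \prod_(W in t) c W.

Let mu s := moebius (BNC col) (@refines m) s [set [set: 'I_m]].
Let term (t : {set {set 'I_m}}) (s : {set {set 'I_m}}) : K^o :=
  if [forall V in s, closed_block col a b V] && compatible id t s
  then \prod_(W in t) c W else 0.

(** Here every letter is its own group and [Tr] is [V0]. Blocks of fewer than [n] original letters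
    are closed by the induction hypothesis; a block of original letters with [n] elements is [V0],
    and the units being singletons, this forces [t = t0]. *)
Let term_neq0 t : t \in NC col [set: 'I_m] -> t != t0 ->
  \sum_(s in BNC col) term t s *~ mu s = 0.
Proof.
move=> tN nt; have tP := NC_partition tN.
have [c0|cn0] := eqVneq (\prod_(W in t) c W) 0.
  by apply: big1 => s _; rewrite /term c0 if_same mul0rz.
have cB B : B \in t -> c B != 0.
  by move=> Bt; apply: contraNneq cn0 => cB; rewrite (bigD1 B) //= cB mul0r.
have t1 B p q : B \in t -> p \in B -> q \in B -> id p \notin V0 -> p = q.
  rewrite inE => Bt pB qB op; apply/eqP; apply: contraT => npq; case/eqP: (cB B Bt).
  by apply: (block_cumulant_None phi1 cE pB qB npq); rewrite /l (negbTE op).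
have t2 B : B \in t -> (forall p, p \in B -> id p \in V0) -> cclosed r a b B.
  move=> Bt BV; have B0 := partition_ne tP Bt.
  have [Bn|nB] := ltnP #|B| n.
    apply: (@cclosed_rank _ _ (fun y => index y (schi_seq col))); first exact: rE.
    have Bsome p : p \in B -> l p <> None by move=> /BV; rewrite inE /l => ->.
    refine (block_cumulant_closed l_color cE B0 _ Bsome (cB B Bt)).
    by apply: IH; rewrite ?card_gt0.
  case/eqP: nt.
  have BV0 : B = V0.
    by apply/eqP; rewrite eqEcard card_V0 nB andbT; apply/subsetP.
  have single y : ~~ o y -> [set y] \in t.
    move=> oy; have [C Ct yC] := partition_cover tP (in_setT y).
    suff -> : [set y] = C by [].
    apply/setP=> z; rewrite inE; apply/eqP/idP=> [->//|zC].
    by apply/esym; apply: (t1 C y z) => //; rewrite inE.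
  apply/setP=> C; apply/idP/t0P=> [Ct|[->|[y oy ->]]]; first 1 last.
  - by rewrite -BV0.
  - exact: single.
  have [y yC] := partition_ex tP Ct; have [oy|oy] := boolP (o y).
    by left; rewrite -BV0; apply: (partition_eq tP Ct Bt yC); rewrite BV0 inE.
  by right; exists y => //; apply: (partition_eq tP Ct (single y oy) yC); rewrite inE.
have h_mono : {in [set: 'I_m] &, forall p q, (r (id p) < r (id q))%N -> (r p < r q)%N} by [].
have h_surj p : exists2 q, q \in [set: 'I_m] & id q = p by exists p.
have fst p : p \in [set: 'I_m] ->
  (forall q, q \in [set: 'I_m] -> id q = id p -> (r p <= r q)%N) -> a p = a (id p) by [].
have lst p : p \in [set: 'I_m] ->
  (forall q, q \in [set: 'I_m] -> id q = id p -> (r q <= r p)%N) -> b p = b (id p) by [].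
have lnk u q : u \in [set: 'I_m] -> q \in [set: 'I_m] -> id u = id q -> (r u < r q)%N ->
    (forall z, z \in [set: 'I_m] -> id z = id q -> ~~ (r u < r z < r q)%N) -> a q = b u.
  by move=> _ _ /= ->; rewrite ltnn.
exact (sum_compatible_closed rE rE h_mono h_surj fst lst lnk tN t1 t2
  (\prod_(W in t) c W) chain_closed V0_neq0 V0_neqT).
Qed.

(** A compatible [s] has [V0] inside one block [W]. Any other block consists of units; non-crossing
    keeps it from having two, and a single unit is not closed. Only the one-block partition remains,
    with coefficient 1. *)
Let term_t0 : \sum_(s in BNC col) term t0 s *~ mu s = \prod_(W in t0) c W.
Proof.
have topB := top_BNC col m_gt0; have t0B := NC_partition t0_NC.
rewrite (bigD1 [set [set: 'I_m]]) //= big1 ?addr0 => [|s /andP[sB nst]].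
  rewrite /mu (moebiusE (@BNC_refines_trans m col) (@BNC_refines_anti m col)) ?eqxx //;
    last exact: refines_refl.
  rewrite mulr1z /term ifT //; apply/andP; split.
    apply/forall_inP=> V /set1P->; apply/(closed_blockP rE) => //.
    exact: ord_setT_neq0.
  apply/compatibleP=> B p q _ _ _; have tT := NC_partition topB.
  by apply/eqP; rewrite (pblock_eqP _ tT (set11 _)) in_setT.
rewrite /term; case: andP => [[cl /compatibleP cmp]|_]; last by rewrite mul0rz.
case/eqP: nst; have sN : s \in NC col [set: 'I_m] by [].
have sP := NC_partition sN; have [v vV] := set0Pn _ V0_neq0.
have [W Ws vW] := partition_cover sP (in_setT v).
have VW y : o y -> y \in W.
  move=> oy; rewrite -(pblock_eqP y sP Ws vW); apply/eqP.
  by apply: (cmp V0); [apply/t0P; left|exact: vV|rewrite inE].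
have sW X : X \in s -> X = W.
  move=> Xs; apply/eqP; apply: contraT => nXW.
  have Xo y : y \in X -> ~~ o y.
    by move=> yX; apply: contra nXW => /VW yW; rewrite (partition_eq sP Xs Ws yX yW).
  have [y yX] := partition_ex sP Xs.
  have : ~~ [exists z in X, exists z' in X, r z < r z']%N.
    apply/exists_inP=> -[z zX /exists_inP[z' zX' zz]]; case/eqP: nXW.
    have /noncrossingP sC := NC_noncrossing sN; apply/esym.
    have lt : (idx (k z) < idx (k z'))%N.
      by move: zz; rewrite !rank_ins ?Xo // ltnS ltn_double.
    have rz := rank_ins (Xo z zX); have rz' := rank_ins (Xo z' zX').
    have rZ u : r (Zp u) = (idx u).*2 by rewrite rank_orig ?k_Zp ?o_Zp.
    (* Each unit comes just after its own letter, so these four positions alternate between [W] and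
       [X]. *)
    apply: (sC W X (Zp (k z)) z (Zp (k z')) z' Ws Xs (VW _ (o_Zp _)) zX (VW _ (o_Zp _)) zX');
      rewrite rE ?rZ ?rz ?rz'; move: lt; clear; lia.
  rewrite negb_exists_in => /forall_inP nlt.
  have eqX z : z \in X -> r z = r y.
    move=> zX; have := nlt z zX; have := nlt y yX; rewrite !negb_exists_in.
    by move=> /forall_inP/(_ z zX) h1 /forall_inP/(_ y yX) h2; move: h1 h2; clear; lia.
  have /(closed_blockP rE a b (partition_ne sP Xs)) Xcl := forall_inP cl X Xs.
  have ab : a y = b y.
    by apply: Xcl => // z /eqX ->; rewrite /arc; clear; lia.
  (* A closed singleton is a loop, but a unit is inserted only where its two indices differ. *)
  move: ab; rewrite /a /b (negbTE (Xo y yX)) => ab.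
  by have := ins_fails (Xo y yX); rewrite /gap_fails ab eqxx.
have WT : W = [set: 'I_m].
  apply/setP=> y; rewrite in_setT; have [X Xs yX] := partition_cover sP (in_setT y).
  by rewrite -(sW X Xs).
by apply/setP=> X; rewrite inE -WT; apply/idP/eqP=> [/sW|->].
Qed.

Let c_single y : ~~ o y -> c [set y] = 1.
Proof.
move=> oy; have := cE (V := [set y]).
have N1 : [set [set y]] \in NC col [set y].
  by apply: NC1; apply/set0Pn; exists y; rewrite inE.
rewrite (big_pred1 [set [set y]]) => [|t]; last first.
  apply/idP/eqP=> [/NC_partition/partition_set1//|->//].
rewrite big_set1 => <-; last by apply/set0Pn; exists y; rewrite inE.
by rewrite /block_moment big_set1 /x /entry /l (negbTE oy) phi1.
Qed.

Lemma insertion_cumulant0 : c V0 = 0.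
Proof.
pose e y := o y.
have T0 : cumulant1 (diag_space phi1 d) col (fun y => letter (col y) (x y) (a y) (b y)) = 0.
  apply: (free (e := e)).
    have [q1 oq1] := q1_ex; exists q1, (Zp (src (ev q1))).
    by rewrite /e o_Zp (negbTE oq1).
  move=> y; rewrite /e /x /l /a /b; case: (o y).
    exact (corner_face phi1 ZI ZJ (omega (k y)) (i (k y)) (j (k y))).
  exact (unit_face phi1 (col y) (j (k y)) (i (chi_succ chi (k y)))).
have [z cz] : exists z, chain a b z (chi_seq col [set: 'I_m]) z.
  by apply/existsP/(closed_blockP rE a b (ord_setT_neq0 m_gt0)).
have h_mono : {in [set: 'I_m] &, forall p q, chi_lt col (id p) (id q) -> chi_lt col p q} by [].
have h_surj p : exists2 q, q \in [set: 'I_m] & id q = p by exists p.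
have xE V : block_moment phi x V = block_moment phi x (pull [set: 'I_m] id V).
  by congr block_moment; apply/setP=> y; rewrite mem_pull in_setT.
have := diag_cumulant_expand h_mono h_surj phi1 a b cE xE z m_gt0.
rewrite T0 cz [LHS]mxE (bigD1 t0) ?t0_NC //= [X in _ + X]big1 ?addr0; last first.
  by move=> t /andP[tN nt]; exact: term_neq0.
rewrite [RHS]term_t0 => /esym/eqP; rewrite prodf_seq_eq0.
(* The singleton blocks of [t0] have weight 1, so the vanishing factor is [c V0]. *)
move=> /hasP[W _ /andP[/t0P[->|[y oy ->]] /eqP]] //.
by move=> c0; have := c_single oy; rewrite c0 => /esym/eqP; rewrite oner_eq0.
Qed.

End Coefficients.

Lemma cyclic_step : cumulant1 (scalar_space phi1) chi
  (fun k => sum_family ZI ZJ (omega k) (i k) (j k)) = 0.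
Proof.
have [c cE] := cumulants_exist col (block_moment phi x).
have := cumulant_restrict phi1 cE (g := Zp) n_gt0 Zp_increasing.
rewrite -V0E (insertion_cumulant0 cE) => <-.
have -> : col \o Zp = chi by apply/funext=> k' /=; rewrite /col k_Zp.
by congr cumulant1; apply/funext=> k'; rewrite /= /x /entry /l /a /b o_Zp k_Zp.
Qed.

End Step.

Lemma bifree_R_cyclic : R_cyclic phi1 ZI ZJ.
Proof.
suff H n : (0 < n)%N -> cyclic_upto n by move=> n omega i j n0 chi; exact: H.
have [N] := ubnP n; elim: N n => // N IH n ltnN n0 omega i j chi [q0 q0_fails].
apply: (cyclic_step _ q0_fails) => n' n0' ltn'; apply: IH => //.
exact: leq_trans ltn' _.
Qed.

End Backward.

Theorem theorem4p9 (R : realType) (A : algType R[i])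
    (phi : {linear A -> R[i]^o}) (phi1 : phi 1 = 1)
    (d : nat) (I J : Type)
    (ZI : I -> 'M[A]_d.+1) (ZJ : J -> 'M[A]_d.+1) :
  R_cyclic phi1 ZI ZJ <->
  bifree2 (matrix_faces phi1 ZI ZJ) (scalar_faces phi1 d).
Proof. by split; [exact: R_cyclic_bifree|exact: bifree_R_cyclic]. Qed.
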